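(* For $u\in H^1(\Omega)$ the following two conditions are equivalent: (1) $P(x)\nabla u(x)=0$ for a.e. $x\in\Omega$; (2) there exists a set $Z\subset\mathcal{M}$ with $\mathcal{H}^k(Z)=0$, and for every $p\in\mathcal{M}\setminus Z$ there exists a set $S_p\subset\phi^{-1}(p)$ with $\mathcal{H}^{\ell-k}(S_p)=0$, such that for all $p\in\mathcal{M}\setminus Z$ and all $\overline{x}\in\Omega_p$ there exists a constant $v(p,\overline{x})\in\mathbb{R}$ such that $u(x)=v(p,\overline{x})$ for all $x\in\Omega_p(\overline{x})\setminus S_p$.
   Context: Let $\ell,k,r$ be positive integers with $\ell\ge 2$, $r\ge 2$, $k<\ell$, and let $\mathcal{M}\subset\mathbb{R}^\ell$ be an embedded $k$-dimensional submanifold of class $C^r$. Let $N=\{(p,v)\in\mathcal{M}\times\mathbb{R}^\ell : v\perp T_p\mathcal{M}\}$. The pair $(\mathcal{U},\phi)$ is a tubular neighborhood of $\mathcal{M}$: there is an open subset $N_0$ of $N$ containing $\mathcal{M}\times\{0\}$, with $(p,\epsilon v)\in N_0$ whenever $(p,v)\in N_0$ and $\epsilon\in[0,1]$, such that $(p,v)\mapsto p+v$ is a $C^{r-1}$-diffeomorphism of $N_0$ onto an open set $\mathcal{U}\subset\mathbb{R}^\ell$, and $\phi:\mathcal{U}\to\mathcal{M}$ is the $C^{r-1}$ map with $\phi(p+v)=p$ for $(p,v)\in N_0$. For $x\in\mathcal{U}$, $Q(x):\mathbb{R}^\ell\to\mathbb{R}^\ell$ is the orthogonal projection onto $T_{\phi(x)}\mathcal{M}$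 and $P(x)=I-Q(x)$. $\Omega\subset\mathbb{R}^\ell$ is a nonempty bounded domain (open connected set) with $\operatorname{Cl}\Omega\subset\mathcal{U}$. For $p\in\mathcal{M}$, $\Omega_p:=\{x\in\Omega : \phi(x)=p\}$ is the normal section at $p$, and for $x\in\Omega_p$, $\Omega_p(x)$ is the connected component of $\Omega_p$ containing $x$. $\mathcal{H}^m$ denotes $m$-dimensional Hausdorff measure on $\mathbb{R}^\ell$. Gradients of Sobolev functions are weak gradients. *)

(* Defs.v *)
From HB Require Import structures.
From mathcomp Require Import all_boot all_order all_algebra.
From mathcomp Require Import all_classical all_reals all_analysis.

Set Implicit Arguments.
Unset Strict Implicit.
Unset Printing Implicit Defensive.
Import Order.TTheory GRing.Theory Num.Theory.
Import numFieldNormedType.Exports.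
Local Open Scope classical_set_scope.
Local Open Scope ring_scope.

(* R^n is 'rV[R]_n. The library puts the sup norm on it; the topology and the
   differential calculus do not depend on this, but angles and diameters do,
   hence the explicit Euclidean structure. *)
Section euclidean.
Context {R : realType} {n : nat}.

Definition dot (u v : 'rV[R]_n) : R := \sum_(i < n) u ord0 i * v ord0 i.

Definition enorm (u : 'rV[R]_n) : R := Num.sqrt (dot u u).

(* The point of S nearest to v; S is meant to be a linear subspace, for which
   the point w below exists and is unique. *)
Definition orth_proj (S : set 'rV[R]_n) (v : 'rV[R]_n) : 'rV[R]_n :=
  get [set w | S w /\ forall z, S z -> dot (v - w) z = 0].

End euclidean.

(* The sigma-algebra generated by the coordinates is the Borel sigma-algebra. *)
Section borel_rV.
Context {R : realType} {n : nat}.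

Let coord (i : 'I_n) (x : 'rV[R]_n) : measurableTypeR R := x ord0 i.

Let rV_set0 : g_sigma_preimage coord set0.
Proof. exact: sigma_algebra0. Qed.

Let rV_setC A : g_sigma_preimage coord A -> g_sigma_preimage coord (~` A).
Proof. exact: sigma_algebraC. Qed.

Let rV_bigcup (F : (set 'rV[R]_n)^nat) :
  (forall i, g_sigma_preimage coord (F i)) ->
  g_sigma_preimage coord (\bigcup_i F i).
Proof. exact: sigma_algebra_bigcup. Qed.

HB.instance Definition _ := @isMeasurable.Build
  (measure_tuple_display default_measure_display)
  'rV[R]_n (g_sigma_preimage coord) rV_set0 rV_setC rV_bigcup.

End borel_rV.

Section lebesgue_step.
Context {R : realType} {n : nat}.

Lemma measurable_rV_coord m (i : 'I_m) :
  measurable_fun setT (fun x : 'rV[R]_m => x ord0 i : measurableTypeR R).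
Proof.
move=> _ A mA; rewrite setTI; apply: sub_sigma_algebra => /=.
rewrite -bigcup_seq/=; exists i => /=; first by rewrite mem_index_enum.
by exists A => //; rewrite setTI.
Qed.

Lemma measurable_fun_rV d (T : measurableType d) m (f : T -> 'rV[R]_m) :
  (forall i, measurable_fun setT (fun x => f x ord0 i : measurableTypeR R)) ->
  measurable_fun setT f.
Proof.
move=> mf _ A mA; rewrite setTI.
suff : @measurable _ 'rV[R]_m `<=` image_set_system setT f measurable.
  by move=> /(_ A mA); rewrite /image_set_system/= setTI.
apply: smallest_sub; first exact/sigma_algebra_image/sigma_algebra_measurable.
rewrite -bigcup_seq/=; apply: bigcup_sub => i _ B [C mC <-].
rewrite /image_set_system/= !setTI.
by have := mf i measurableT _ mC; rewrite setTI.
Qed.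

Definition rV_cons (q : measurableTypeR R * 'rV[R]_n) : 'rV[R]_n.+1 :=
  \row_i if unlift ord0 i is Some j then q.2 ord0 j else q.1.

Definition rV_uncons (x : 'rV[R]_n.+1) : measurableTypeR R * 'rV[R]_n :=
  (x ord0 ord0, \row_j x ord0 (lift ord0 j)).

Lemma rV_consK : cancel rV_cons rV_uncons.
Proof.
move=> [a v]; congr (_, _); first by rewrite mxE unlift_none.
by apply/rowP => j; rewrite !mxE liftK.
Qed.

Lemma measurable_rV_cons : measurable_fun setT rV_cons.
Proof.
apply: measurable_fun_rV => i.
case: (unliftP ord0 i) => [j|] iE.
  rewrite (_ : (fun _ => _) = (fun x : 'rV[R]_n => x ord0 j) \o snd).
    by apply: measurableT_comp (measurable_rV_coord j) _; exact: measurable_snd.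
  by apply/funext => q; rewrite mxE iE liftK.
rewrite (_ : (fun _ => _) = fst); first exact: measurable_fst.
by apply/funext => q; rewrite mxE iE unlift_none.
Qed.

Lemma measurable_rV_uncons : measurable_fun setT rV_uncons.
Proof.
apply/measurable_fun_pairP; split; first exact: measurable_rV_coord.
apply: measurable_fun_rV => i.
rewrite (_ : (fun _ => _) = (fun x : 'rV[R]_n.+1 => x ord0 (lift ord0 i))).
  exact: measurable_rV_coord.
by apply/funext => x; rewrite /= mxE.
Qed.

Variable m : {sigma_finite_measure set 'rV[R]_n -> \bar R}.

Definition lebesgue_step (A : set 'rV[R]_n.+1) : \bar R :=
  pushforward (lebesgue_measure \x m)%E rV_cons A.

Let lebesgue_step0 : lebesgue_step set0 = 0%E.
Proof. by rewrite /lebesgue_step /pushforward preimage_set0 measure0. Qed.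

Let lebesgue_step_ge0 A : (0 <= lebesgue_step A)%E.
Proof. exact: (measure_ge0 (lebesgue_measure \x m)%E). Qed.

Let lebesgue_step_sigma_additive : semi_sigma_additive lebesgue_step.
Proof.
move=> F mF tF mUF; rewrite /lebesgue_step /pushforward preimage_bigcup.
apply: (@measure_semi_sigma_additive _ _ _ (lebesgue_measure \x m)%E).
- by move=> i; rewrite -[X in measurable X]setTI; exact: measurable_rV_cons.
- apply/trivIsetP => /= i j _ _ ij; rewrite -preimage_setI.
  by move/trivIsetP : tF => /(_ _ _ _ _ ij) ->//; rewrite preimage_set0.
- by rewrite -preimage_bigcup -[X in measurable X]setTI; exact: measurable_rV_cons.
Qed.

HB.instance Definition _ := isMeasure.Build _ _ _ lebesgue_step
  lebesgue_step0 lebesgue_step_ge0 lebesgue_step_sigma_additive.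

Let lebesgue_step_sigma_finite : sigma_finite setT lebesgue_step.
Proof.
have /sigma_finiteP[F [FT ndF Foo]] := sigma_finiteT (@lebesgue_measure R).
have /sigma_finiteP[G [GT ndG Goo]] := sigma_finiteT m.
exists (fun i => rV_uncons @^-1` (F i `*` G i)).
  rewrite -preimage_bigcup (_ : \bigcup_i _ = setT) ?preimage_setT//.
  rewrite predeqE => -[x y]; split=> // _.
  have [i _ Fix] : (\bigcup_i F i) x by rewrite -FT.
  have [j _ Gjy] : (\bigcup_i G i) y by rewrite -GT.
  exists (maxn i j) => //; split=> /=.
    by move: x Fix; exact/subsetPset/ndF/leq_maxl.
  by move: y Gjy; exact/subsetPset/ndG/leq_maxr.
move=> i; have [mF Fi] := Foo i; have [mG Gi] := Goo i; split.
  rewrite -[X in measurable X]setTI.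
  by apply: measurable_rV_uncons => //; exact: measurableX.
rewrite /lebesgue_step /pushforward -comp_preimage.
rewrite (_ : _ \o _ = id); last by apply/funext; exact: rV_consK.
by rewrite product_measure1E// lte_mul_pinfty// ge0_fin_numE.
Qed.

HB.instance Definition _ := Measure_isSigmaFinite.Build _ _ _ lebesgue_step
  lebesgue_step_sigma_finite.

End lebesgue_step.

(* The n-fold product of the one-dimensional Lebesgue measure. *)
Fixpoint borel_lebesgue (R : realType) (n : nat) :
    {sigma_finite_measure set 'rV[R]_n -> \bar R} :=
  match n with
  | 0 => \d_(0 : 'rV[R]_0)
  | n'.+1 => lebesgue_step (borel_lebesgue R n')
  end.

(* Completion of borel_lebesgue: its measurable sets are the Lebesgue
   measurable subsets of R^n. *)
Definition lebesgue_rV (R : realType) (n : nat) : measurableType _ :=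
  caratheodory_type ((borel_lebesgue R n)^*)%mu.

Definition lebesgue (R : realType) (n : nat) :
    set (lebesgue_rV R n) -> \bar R :=
  @completed_measure_extension _ _ _ (borel_lebesgue R n).

HB.instance Definition _ R n := Measure.on (@lebesgue R n).

Section hausdorff.
Context {R : realType} {n : nat}.
Implicit Types A : set 'rV[R]_n.
Local Open Scope ereal_scope.

(* Euclidean diameter; it is -oo for the empty set. *)
Definition diam A : \bar R :=
  ereal_sup [set (enorm (p.1 - p.2))%:E | p in A `*` A].

Definition hausdorff_gauge (m : nat) A : \bar R :=
  if A == set0 then 0 else diam A ^+ m.

Definition hausdorff_content (m : nat) (delta : R) A : \bar R :=
  ereal_inf [set \sum_(0 <= i <oo) hausdorff_gauge m (F i) |
    F in [set F : (set 'rV[R]_n)^nat |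
      A `<=` \bigcup_i F i /\ forall i, diam (F i) <= delta%:E]].

(* The limit as delta decreases to 0, which is a supremum. The constant factor
   (volume of the m-ball of diameter 1) used by some authors is omitted. *)
Definition hausdorff_measure (m : nat) A : \bar R :=
  ereal_sup [set hausdorff_content m delta A | delta in [set d : R | (0 < d)%R]].

End hausdorff.

Section smoothness.
Context {R : realType}.

(* Class C^m on an open set U. *)
Fixpoint Cn {V W : normedModType R} (m : nat) (U : set V) (f : V -> W) : Prop :=
  match m with
  | 0 => forall x, U x -> {for x, continuous f}
  | m'.+1 => (forall x, U x -> differentiable f x) /\
             forall v, Cn m' U ('D_v f)
  end.

(* Class C^m on an arbitrary subset A: local C^m extensions to open sets. On
   open sets this is Cn; on a submanifold it is the intrinsic notion. *)
Definition Cn_on {V W : normedModType R} (m : nat) (A : set V) (f : V -> W) :=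
  forall x, A x -> exists U g, [/\ open U, U x, Cn m U g &
    forall y, A y -> U y -> g y = f y].

Definition diffeo {V W : normedModType R} (m : nat) (A : set V) (B : set W)
    (f : V -> W) :=
  Cn_on m A f /\ exists g : W -> V,
    [/\ Cn_on m B g,
        forall x, A x -> B (f x) /\ g (f x) = x &
        forall y, B y -> A (g y) /\ f (g y) = y].

End smoothness.

Section submanifolds.
Context {R : realType} {l : nat}.
Implicit Types (M U : set 'rV[R]_l) (p x v : 'rV[R]_l).

(* Embedded k-dimensional submanifold of class C^r of R^l, by slice charts. *)
Definition submanifold (r k : nat) M :=
  forall p, M p -> exists V W (psi : 'rV[R]_l -> 'rV[R]_l),
    [/\ open V, V p, open W, diffeo r V W psi &
        forall x, V x ->
          (M x <-> forall i : 'I_l, (k <= i)%N -> psi x ord0 i = 0)].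

Definition tangent_space M p : set 'rV[R]_l :=
  [set v | exists (gamma : R^o -> 'rV[R]_l) (e : R),
    [/\ 0 < e, Cn 1 (ball (0 : R^o) e) gamma,
        forall t, ball (0 : R^o) e t -> M (gamma t),
        gamma 0 = p & 'D_1 gamma 0 = v]].

Definition normal_bundle M : set ('rV[R]_l * 'rV[R]_l) :=
  [set q | M q.1 /\ forall w, tangent_space M q.1 w -> dot q.2 w = 0].

(* s is the class of the tubular neighbourhood. phi is a total function whose
   values outside of U are irrelevant. *)
Definition tubular_neighborhood (s : nat) M U (phi : 'rV[R]_l -> 'rV[R]_l) :=
  [/\ open U, Cn_on s U phi, forall x, U x -> M (phi x) &
    exists N0 : set ('rV[R]_l * 'rV[R]_l),
      [/\ exists2 O, open O & N0 = normal_bundle M `&` O,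
          forall p, M p -> N0 (p, 0),
          forall p v (e : R), N0 (p, v) -> 0 <= e <= 1 -> N0 (p, e *: v),
          diffeo s N0 U (fun q => q.1 + q.2) &
          forall p v, N0 (p, v) -> phi (p + v) = p]].

Definition tangent_proj M (phi : 'rV[R]_l -> 'rV[R]_l) x v :=
  orth_proj (tangent_space M (phi x)) v.

Definition normal_proj M (phi : 'rV[R]_l -> 'rV[R]_l) x v :=
  v - tangent_proj M phi x v.

Definition normal_section (Omega : set 'rV[R]_l)
    (phi : 'rV[R]_l -> 'rV[R]_l) p : set 'rV[R]_l :=
  [set x | Omega x /\ phi x = p].

End submanifolds.

Section sobolev.
Context {R : realType} {n : nat}.
Variable Omega : set 'rV[R]_n.
Implicit Types (u psi : 'rV[R]_n -> R) (g : 'rV[R]_n -> 'rV[R]_n).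

Local Notation T := (lebesgue_rV R n).
Local Notation mu := (@lebesgue R n).

Definition test_function psi :=
  let supp := closure [set x | psi x != 0] in
  [/\ forall m, Cn m setT (psi : _ -> R^o), compact supp & supp `<=` Omega].

Definition square_integrable u :=
  measurable_fun (Omega : set T) (u : T -> measurableTypeR R) /\
  (\int[mu]_(x in Omega) ((u x) ^+ 2)%:E < +oo)%E.

Definition locally_integrable_in u :=
  forall K : set 'rV[R]_n, compact K -> K `<=` Omega ->
    mu.-integrable K (fun x => (u x)%:E).

Definition weak_gradient u g := forall i : 'I_n,
  locally_integrable_in (fun x => g x ord0 i) /\
  forall psi, test_function psi ->
    \int[mu]_(x in Omega) (u x * 'D_(delta_mx ord0 i) (psi : _ -> R^o) x) =
    - \int[mu]_(x in Omega) (g x ord0 i * psi x).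

(* Elements of H^1 are represented by functions; u is any member of its
   almost-everywhere class. *)
Definition sobolev_H1 u := square_integrable u /\
  exists g, weak_gradient u g /\
    forall i : 'I_n, square_integrable (fun x => g x ord0 i).

End sobolev.

(* Main.v *)
Require Import Defs.
From HB Require Import structures.
From mathcomp Require Import all_boot all_order all_algebra.
From mathcomp Require Import all_classical all_reals all_analysis.
From mathcomp Require Import measurable_realfun measurable_fun_approximation ring lra.
Import Order.TTheory GRing.Theory Num.Theory.
Import numFieldNormedType.Exports.
Local Open Scope classical_set_scope.
Local Open Scope ring_scope.
Set Implicit Arguments.
Unset Strict Implicit.
Unset Printing Implicit Defensive.

(** Write l = k + d. Near a point of Omega the tubular neighbourhood is
    straightened by the map G (a, z) = q a + z_1 n_1 a + ... + z_d n_d a, where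
    q parametrizes M (it is the inverse of a slice chart psi, restricted to the
    first k coordinates) and the rows n_i a are the gradients at q a of the last
    d coordinates of psi; they span the normal space there. Its inverse is
    explicit, and both maps are of class C^1, hence locally Lipschitz. So G is
    bi-Lipschitz on a small ball ([fibred_chart_exists]), the fibres of phi are
    the vertical slices a = constant, and null sets correspond to each other:
    Lebesgue null sets of the ball to Lebesgue null sets of R^l, Lebesgue null
    sets of values of a to H^k-null sets of M, Lebesgue null sets of a slice to
    H^d-null sets of a fibre. No change of variables formula is involved, only
    coverings by cubes ([outer_lebesgue_expanding], [hausdorff_null_lipschitz],
    [outer_lebesgue_null_expanding]).

    On the ball, condition (1) says that the derivatives
    h = sum_j (b n)_j (grad_j u) o G of w = u o G along the vertical vectors b
    vanish almost everywhere, by [chart_proj]. The point is to compare h with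
    the translates of w. Mollifying u, integrating along segments, and passing
    to the limit in the mean gives ([mean_value_inequality],
    [fibre_mean_value])

      int |w (y + b) - w y - h y| dy <= sup_(0<=s<=1) int |h (y + s b) - h y| dy.

    If h = 0 almost everywhere then w is invariant under small vertical
    translations ([fibre_shift_invariant]). Conversely, if w is invariant then
    int |h| is bounded by the right-hand side; replacing b by t b, dividing by
    t, and letting t tend to 0, continuity of translations in the mean
    ([transl_cont_L1]) gives h = 0 ([fibre_deriv_eq0]). By Tonelli's theorem
    invariance under vertical translations means that w is almost everywhere
    constant on almost every slice ([shift_invariant_fibre_constant],
    [fibre_constant_shift_invariant]). This is the equivalence in a chart.

    Globally, Omega is covered by countably many charts. From (2) to (1) this
    suffices, since a slice of a chart is connected and thus lies in one
    component of a normal section ([section_constant_fibre_constant]). From (1)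
    to (2), each chart gives a constant on its slice of the normal section; the
    constants of two charts agree where the slices overlap, because a nonempty
    relatively open part of a normal section is not H^d-null
    ([section_not_null]), and a locally constant function is constant on a
    connected component ([section_constant]). *)

(** * Row vectors: coordinates, balls and Borel sets *)

Section row_vectors.
Context {R : realType} {n : nat}.
Implicit Types (x y : 'rV[R]_n) (A : set 'rV[R]_n).

Lemma rV_norm_le x e : 0 <= e -> (forall i, `|x ord0 i| <= e) -> `|x| <= e.
Proof.
move=> e0 xe; rewrite -[X in X <= _]/(mx_norm x) mx_normrE.
by apply/bigmax_leP; split=> // -[i j] _ /=; rewrite ord1.
Qed.

Lemma rV_norm_lt x e : 0 < e -> (forall i, `|x ord0 i| < e) -> `|x| < e.
Proof.
move=> e0 xe; rewrite -[X in X < _]/(mx_norm x) mx_normrE.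
by apply/bigmax_ltP; split=> // -[i j] _ /=; rewrite ord1.
Qed.

Lemma rV_coord_le x i : `|x ord0 i| <= `|x|.
Proof.
rewrite -[leRHS]/(mx_norm x) mx_normrE.
exact: (le_bigmax _ (fun ij => `|x ij.1 ij.2|) (ord0, i)).
Qed.

Lemma rV_ballE x e : ball x e = [set y | `|x - y| < e].
Proof. by rewrite mx_norm_ball. Qed.

(** Balls with rational centre and radius 1/(m+1), a countable basis. *)
Definition qball (c : 'rV[rat]_n * nat) : set 'rV[R]_n :=
  ball (map_mx ratr c.1 : 'rV[R]_n) (c.2.+1%:R^-1).

Lemma qball_basis A x : open A -> A x -> exists c, qball c x /\ qball c `<=` A.
Proof.
move=> oA Ax; have /nbhs_ballP[e /= e0 eA] := open_nbhs_nbhs (conj oA Ax).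
have [m _ me] : \forall m \near \oo, m.+1%:R^-1 < e / 2.
  by apply: near_infty_natSinv_lt (PosNum (divr_gt0 e0 (ltr0Sn _ 1))).
have {me} me := me m (leqnn m).
have m0 : 0 < m.+1%:R^-1 :> R by rewrite invr_gt0.
have [q qE] : exists q : 'rV[rat]_n, ball (map_mx ratr q : 'rV[R]_n) (m.+1%:R^-1) x.
  have : forall i, exists q : rat, `|x ord0 i - ratr q| < m.+1%:R^-1.
    move=> i; have [z [/= xq [q _ qE]]] := @dense_rat R _
      (ex_intro _ _ (ballxx (x ord0 i) m0)) (ball_open _ _).
    by exists q; rewrite qE.
  move=> /choice[q qE]; exists (\row_i q i); rewrite rV_ballE/= distrC.
  by apply: rV_norm_lt => // i; rewrite !mxE.
exists (q, m); split => // y; rewrite /qball /= => qy; apply: eA.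
rewrite (splitr e); apply: (@ball_triangle _ _ (map_mx ratr q : 'rV[R]_n)).
  by apply/ball_sym/(le_ball _ qE)/ltW.
by apply: le_ball qy; exact/ltW.
Qed.

(** The balls of [qball] on which [P] holds form the cover; the other indices of
    the enumeration are given the empty set. *)
Lemma rV_lindelof A (P : set 'rV[R]_n -> Prop) :
    (forall B C, B `<=` C -> P C -> P B) ->
    (forall x, A x -> exists V, [/\ open V, V x & P V]) ->
  exists F : (set 'rV[R]_n)^nat,
    [/\ forall i, open (F i), forall i, P (F i) \/ F i = set0 &
      A `<=` \bigcup_i F i].
Proof.
move=> Pmono PA.
pose G c : set 'rV[R]_n := if pselect (P (qball c)) then qball c else set0.
pose F k : set 'rV[R]_n := if unpickle k is Some c then G c else set0.
have Gop c : open (G c) /\ (P (G c) \/ G c = set0).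
  rewrite /G; case: pselect => /= p; last by split; [exact: open0|right].
  by split; [exact: ball_open|left].
exists F; split=> [i|i|x Ax].
- by rewrite /F; case: unpickle => [c|]; [exact: (Gop c).1|exact: open0].
- by rewrite /F; case: unpickle => [c|]; [exact: (Gop c).2|right].
- have [V [oV Vx PV]] := PA _ Ax; have [c [cx cV]] := qball_basis oV Vx.
  exists (pickle c) => //; rewrite /F pickleK /G.
  by case: pselect => // -[]; exact: Pmono PV.
Qed.

Lemma measurable_coord_itv i (I : interval R) :
  measurable [set x : 'rV[R]_n | x ord0 i \in I].
Proof.
have := measurable_rV_coord i measurableT (measurable_itv I).
by rewrite setTI.
Qed.

Lemma measurable_forall_ord (P : 'I_n -> set 'rV[R]_n) :
  (forall i, measurable (P i)) -> measurable [set x | forall i, P i x].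
Proof.
move=> mP; rewrite (_ : [set x | _] = \bigcap_(i in [set: 'I_n]) P i).
  by apply: fin_bigcap_measurable => //; exact: finite_finset.
by apply/seteqP; split=> [x Px i _|x Px i]; exact: Px.
Qed.

Lemma measurable_rV_ball x e : measurable (ball x e).
Proof.
have [e0|e0] := ltP 0 e; last first.
  rewrite (_ : ball x e = set0)//; apply/seteqP; split=> // y.
  by move=> -[]; rewrite ltNge e0.
rewrite (_ : ball x e = [set y | forall i, y ord0 i \in
    `]x ord0 i - e, x ord0 i + e[]).
  by apply: measurable_forall_ord => i; exact: measurable_coord_itv.
apply/seteqP; split=> y; rewrite rV_ballE/= => xy.
  move=> i; rewrite in_itv/= -ltr_distlC.
  by apply: le_lt_trans xy; have := rV_coord_le (x - y) i; rewrite !mxE.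
by apply: rV_norm_lt => // i; rewrite !mxE ltr_distlC; have := xy i; rewrite in_itv.
Qed.

Lemma open_measurable_rV A : open A -> measurable A.
Proof.
move=> oA.
pose G c : set 'rV[R]_n := if pselect (qball c `<=` A) then qball c else set0.
rewrite (_ : A = \bigcup_c G c).
  apply: countable_bigcupT_measurable => [|c]; first exact: countableP.
  by rewrite /G; case: pselect => //= ?; exact: measurable_rV_ball.
apply/seteqP; split=> [x Ax|x [c _]].
  have [c [cx cA]] := qball_basis oA Ax; exists c => //.
  by rewrite /G; case: pselect.
by rewrite /G; case: pselect => // cA /cA.
Qed.

Lemma closed_measurable_rV A : closed A -> measurable A.
Proof.
move=> cA; rewrite -(setCK A); apply: measurableC; apply: open_measurable_rV.
exact: closed_openC.
Qed.

Lemma continuous_measurable_rV_real (D : set 'rV[R]_n) (f : 'rV[R]_n -> R) :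
  open D -> (forall x, D x -> {for x, continuous f}) ->
  measurable_fun D (f : _ -> measurableTypeR R).
Proof.
move=> oD cf mD.
apply: (measurability _ (measurable_realfun.RGenOpens.measurableE R)) => //.
move=> _ [_ [a [b ->]] <-].
apply: open_measurable_rV; rewrite openE => x [Dx Cx].
apply: filterI; first exact: open_nbhs_nbhs.
by apply: (cf _ Dx); apply: open_nbhs_nbhs; split=> //; exact: interval_open.
Qed.

End row_vectors.

Lemma measurable_fun_rV_in {R : realType} d (T : measurableType d) m (D : set T)
    (f : T -> 'rV[R]_m) :
  (forall i, measurable_fun D (fun x => f x ord0 i : measurableTypeR R)) ->
  measurable_fun D f.
Proof.
move=> mf mD /= A mA.
suff : @measurable _ 'rV[R]_m `<=` image_set_system D f measurable.
  by move=> /(_ A mA).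
apply: smallest_sub.
  apply: sigma_algebra_image; split=> // [B mB|F mF]; first exact: measurableD.
  exact: bigcupT_measurable.
rewrite -bigcup_seq/=; apply: bigcup_sub => i _ B [C mC <-].
by rewrite /image_set_system/= setTI; have := mf i mD _ mC.
Qed.

Lemma continuous_measurable_rV {R : realType} n m (D : set 'rV[R]_n)
    (f : 'rV[R]_n -> 'rV[R]_m) :
  open D -> (forall x, D x -> {for x, continuous f}) -> measurable_fun D f.
Proof.
move=> oD cf; apply: measurable_fun_rV_in => i.
apply: continuous_measurable_rV_real => // x Dx.
exact: (@continuous_comp _ _ _ f (fun y : 'rV[R]_m => y ord0 i) x (cf x Dx)
  (@coord_continuous _ _ _ ord0 i (f x))).
Qed.

(** * Lebesgue measure and coverings by boxes *)

Notation outer_lebesgue R n := (mu_ext (borel_lebesgue R n)).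

Section boxes.
Context {R : realType}.

(** Half-open on one side, so that cutting a box along a coordinate hyperplane
    gives two disjoint boxes. *)
Definition box {n} (p : 'rV[R]_n * 'rV[R]_n) : set 'rV[R]_n :=
  [set x | forall i, p.1 ord0 i < x ord0 i <= p.2 ord0 i].

Definition vol {n} (p : 'rV[R]_n * 'rV[R]_n) : R :=
  \prod_i Num.max 0 (p.2 ord0 i - p.1 ord0 i).

Lemma vol_ge0 n (p : 'rV[R]_n * 'rV[R]_n) : 0 <= vol p.
Proof. by apply: prodr_ge0 => i _; rewrite le_max lexx. Qed.

Lemma measurable_box n (p : 'rV[R]_n * 'rV[R]_n) : measurable (box p).
Proof.
apply: measurable_forall_ord => i.
have := @measurable_coord_itv R n i `]p.1 ord0 i, p.2 ord0 i].
by congr measurable; apply/seteqP; split=> x /=; rewrite in_itv.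
Qed.

Lemma lebesgue_measure_oc (a b : R) :
  lebesgue_measure (`]a, b]%classic : set R) = (Num.max 0 (b - a))%:E.
Proof.
rewrite lebesgue_measure_itv/= lte_fin; case: ltP => ab.
  by rewrite -EFinD max_r// subr_ge0 ltW.
by rewrite max_l// subr_le0.
Qed.

Lemma borel_lebesgue_box n (p : 'rV[R]_n * 'rV[R]_n) :
  borel_lebesgue R n (box p) = (vol p)%:E.
Proof.
elim: n p => [|n IHn] p.
  rewrite /vol big_ord0 /= diracE (_ : box p = setT) ?in_setT//.
  by apply/seteqP; split=> // x _ [].
pose tl (v : 'rV[R]_n.+1) : 'rV[R]_n := \row_j v ord0 (lift ord0 j).
have -> : borel_lebesgue R n.+1 (box p) = (lebesgue_measure \x borel_lebesgue R n)%E
    (`]p.1 ord0 ord0, p.2 ord0 ord0] `*` box (tl p.1, tl p.2)).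
  rewrite /= /lebesgue_step /pushforward; congr (product_measure1 _ _ _).
  apply/seteqP; split=> -[a v] /=.
    move=> pav; split.
      by have := pav ord0; rewrite mxE unlift_none/= in_itv.
    by move=> i; have := pav (lift ord0 i); rewrite !mxE liftK.
  rewrite /= in_itv/= => -[pa pv] i; rewrite mxE.
  by case: unliftP => [j|] -> //=; have := pv j; rewrite !mxE.
rewrite product_measure1E//; last exact: measurable_box.
rewrite /vol big_ord_recl EFinM; congr (_ * _)%E; first exact: lebesgue_measure_oc.
by rewrite [LHS]IHn /vol; congr EFin; apply: eq_bigr => i _; rewrite !mxE.
Qed.

Lemma vol_split n (p : 'rV[R]_n * 'rV[R]_n) i c :
  vol (p.1, \row_j if j == i then Num.min (p.2 ord0 i) c else p.2 ord0 j) +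
  vol (\row_j if j == i then Num.max (p.1 ord0 i) c else p.1 ord0 j, p.2)
  <= vol p.
Proof.
rewrite /vol (bigD1 i)//= [X in _ + X](bigD1 i)//= [leRHS](bigD1 i)//= !mxE eqxx.
rewrite (eq_bigr (fun j => Num.max 0 (p.2 ord0 j - p.1 ord0 j))); last first.
  by move=> j /negbTE ji; rewrite mxE ji.
rewrite [X in _ + _ * X](eq_bigr (fun j => Num.max 0 (p.2 ord0 j - p.1 ord0 j))).
  rewrite -mulrDl ler_wpM2r//.
    by apply: prodr_ge0 => j _; rewrite le_max lexx.
  move: (p.1 ord0 i) (p.2 ord0 i) => a b.
  rewrite /Num.max /Num.min /Order.max /Order.min.
  by do ![case: ifPn => ?]; lra.
by move=> j /negbTE ji; rewrite mxE ji.
Qed.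

End boxes.

Section box_outer_measure.
Context {R : realType} {n : nat}.
Implicit Types (A : set 'rV[R]_n) (p : 'rV[R]_n * 'rV[R]_n).
Local Open Scope ereal_scope.

(** The outer measure generated by [box_hull] is the classical outer measure
    by countable coverings with boxes: a set that lies in no box has value
    +oo. *)
Definition box_hull A : \bar R :=
  ereal_inf [set (vol p)%:E | p in [set p | A `<=` box p]].

Hypothesis n0 : (0 < n)%N.

Lemma box_hull_ge0 A : 0 <= box_hull A.
Proof. by apply: le_ereal_inf_tmp => _ [p _ <-]; rewrite lee_fin vol_ge0. Qed.

Lemma box_hull_le A p : A `<=` box p -> box_hull A <= (vol p)%:E.
Proof. by move=> Ap; apply: ereal_inf_lbound; exists p. Qed.

Lemma box_hull0 : box_hull set0 = 0.
Proof.
apply/eqP; rewrite eq_le box_hull_ge0 andbT.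
apply: le_trans (box_hull_le (p := (0, 0)%R) _) _ => //.
rewrite /vol (bigD1 (Ordinal n0))//= !mxE subrr maxxx mul0r//.
Qed.

Definition box_outer : set 'rV[R]_n -> \bar R := mu_ext box_hull.

HB.instance Definition _ := isOuterMeasure.Build R _ box_outer
  (mu_ext0 box_hull0 box_hull_ge0) (mu_ext_ge0 box_hull_ge0) (le_mu_ext box_hull)
  (mu_ext_sigma_subadditive box_hull_ge0).

(** A half-space cuts a box in two boxes whose volumes add up. *)
Lemma caratheodory_half_space i (c : R) :
  box_outer.-caratheodory [set x : 'rV[R]_n | (x ord0 i <= c)%R].
Proof.
set H := [set x | _].
have mH : measurable H.
  have := @measurable_coord_itv R n i `]-oo, c].
  by congr measurable; apply/seteqP; split=> x /=; rewrite in_itv.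
apply: le_caratheodory_measurable => X.
apply: le_ereal_inf_tmp => _ [F [mF XF] <-].
have hull_split A : box_hull (A `&` H) + box_hull (A `&` ~` H) <= box_hull A.
  apply: le_ereal_inf_tmp => _ [p Ap <-].
  apply: le_trans (_ : _ <= (_ + _)%:E) _; last by rewrite lee_fin; exact: (vol_split p i c).
  rewrite EFinD; apply: leeD; apply: box_hull_le => x [Ax Hx] j /=.
    have := Ap _ Ax j; rewrite mxE; case: eqVneq => [->|//] /andP[-> xi].
    by rewrite le_min xi.
  have := Ap _ Ax j; rewrite mxE; case: eqVneq => [->|//] /andP[xi ->].
  by rewrite gt_max xi ltNge andbT; exact/negP.
apply: (@le_trans _ _ (\sum_(k <oo) (box_hull (F k `&` H)) +
                       \sum_(k <oo) (box_hull (F k `&` ~` H)))).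
  apply: leeD; apply: ereal_inf_lbound.
    exists (fun k => F k `&` H) => //; split; first by move=> k; exact: measurableI.
    by move=> x [/XF[k _ Fx] Hx]; exists k.
  exists (fun k => F k `&` ~` H) => //; split.
    by move=> k; apply: measurableI => //; exact: measurableC.
  by move=> x [/XF[k _ Fx] Hx]; exists k.
rewrite -nneseriesD; [|by move=> *; exact: box_hull_ge0..].
by apply: lee_nneseries => // k _ _; rewrite adde_ge0// box_hull_ge0.
Qed.

(** The half-spaces generate the Borel sets. *)
Lemma measurable_caratheodory A : measurable A -> box_outer.-caratheodory A.
Proof.
move: A; apply: smallest_sub.
  split; first exact: caratheodory_measurable_set0.
    by move=> A cA; rewrite setTD; exact: caratheodory_measurable_setC.
  by move=> F cF; exact: caratheodory_measurable_bigcup.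
rewrite -bigcup_seq/=; apply: bigcup_sub => i _ B [C mC <-].
rewrite setTI; move: C mC.
apply: smallest_sub; first split.
- by rewrite preimage_set0; exact: caratheodory_measurable_set0.
- move=> A cA; rewrite setTD preimage_setC.
  exact: caratheodory_measurable_setC.
- move=> F cF; rewrite preimage_bigcup.
  exact: caratheodory_measurable_bigcup.
move=> C; rewrite /ocitv => -[[a b] _ <-] /=.
rewrite [X in caratheodory_measurable _ X](_ : _ =
  [set x : 'rV[R]_n | (x ord0 i <= b)%R] `&` ~` [set x : 'rV[R]_n | (x ord0 i <= a)%R]).
  apply: caratheodory_measurable_setI; first exact: caratheodory_half_space.
  by apply: caratheodory_measurable_setC; exact: caratheodory_half_space.
apply/seteqP; split=> x /=; rewrite in_itv/=.
  by move=> /andP[ax xb]; split=> //; apply/negP; rewrite -ltNge.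
by move=> [-> /negP]; rewrite -ltNge => ->.
Qed.

Lemma borel_le_box_outer A : measurable A -> borel_lebesgue R n A <= box_outer A.
Proof.
move=> mA; apply: le_ereal_inf_tmp => _ [F [mF AF] <-].
apply: (le_trans (measure_sigma_subadditive _ mF mA AF)) => //.
apply: lee_nneseries => // k _; apply: le_ereal_inf_tmp => _ [p Fp <-].
rewrite -borel_lebesgue_box; apply: le_measure; rewrite ?inE//.
exact: measurable_box.
Qed.

Lemma box_outer_le_vol p : box_outer (box p) <= (vol p)%:E.
Proof.
apply: le_trans (box_hull_le (@subset_refl _ (box p))).
apply: ereal_inf_lbound; exists (fun k => if k == 0%N then box p else set0).
  by split=> [[|k] /=|x px]; [exact: measurable_box|exact: measurable0|exists 0%N].
rewrite (nneseries_split _ 1%N); last by move=> k _; exact: box_hull_ge0.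
rewrite big_nat1 eseries0 ?adde0// => -[//|k] _ _; exact: box_hull0.
Qed.

(** Complementation inside a box turns the inequality of
    [borel_le_box_outer] around, as both sides are additive there. *)
Lemma box_outer_sub_box A p :
  measurable A -> A `<=` box p -> box_outer A <= borel_lebesgue R n A.
Proof.
move=> mA Ap; have mp := measurable_box p.
have fin B : measurable B -> B `<=` box p -> borel_lebesgue R n B \is a fin_num.
  move=> mB Bp; rewrite ge0_fin_numE//.
  apply: (@le_lt_trans _ _ (vol p)%:E); last by rewrite ltry.
  by rewrite -borel_lebesgue_box; apply: le_measure; rewrite ?inE.
have mpA : measurable (box p `&` ~` A) by apply: measurableI => //; exact: measurableC.
have : box_outer A + box_outer (box p `&` ~` A) <=
    borel_lebesgue R n A + borel_lebesgue R n (box p `&` ~` A).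
  have := measurable_caratheodory mA (box p).
  rewrite (setIidr Ap) => <-; apply: le_trans (box_outer_le_vol p) _.
  rewrite -borel_lebesgue_box -measureU//.
    by rewrite setUIr setUCr setIT setUidr.
  by rewrite setICA setICr setI0.
move=> h.
have := le_trans (leeD2l (box_outer A) (borel_le_box_outer mpA)) h.
by rewrite leeD2rE// fin// => x [].
Qed.

Lemma box_outer_le A : measurable A -> box_outer A <= borel_lebesgue R n A.
Proof.
move=> mA.
pose Q (m : nat) : set 'rV[R]_n := box (const_mx (- m%:R)%R, const_mx m%:R).
have mQ m : measurable (Q m) := measurable_box _.
have AE : A = \bigcup_m (A `&` seqD Q m).
  rewrite -setI_bigcupr; apply/esym/setIidl; rewrite eq_bigcup_seqD => x _.
  have [m _ mx] : \forall m \near \oo, (`|x| < m%:R)%R by exact: nbhs_infty_gtr.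
  exists m => // i /=; rewrite !mxE.
  have xi : (`|x ord0 i| < m%:R)%R.
    by apply: le_lt_trans (mx m (leqnn m)); exact: rV_coord_le.
  by move: xi; rewrite ltr_norml => /andP[-> /ltW].
have mAQ m : measurable (A `&` seqD Q m).
  by apply: measurableI => //; case: m => [|m]; [exact: mQ|exact: measurableD].
rewrite [in leRHS]AE measure_bigcup//; last first.
  apply: trivIset_setIl; apply: trivIset_seqD => a b ab.
  apply/subsetPset => x Qx i; have := Qx i; rewrite /= !mxE => /andP[ax xa].
  have abR : (a%:R <= b%:R :> R)%R by rewrite ler_nat.
  by rewrite (le_trans xa abR) andbT (le_lt_trans _ ax)// lerN2.
rewrite {1}AE; apply: (le_trans (outer_measure_sigma_subadditive box_outer _)).
rewrite [leRHS](_ : _ = \sum_(0 <= m <oo) borel_lebesgue R n (A `&` seqD Q m)); last first.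
  by apply: eq_eseriesl => k; rewrite in_setT.
apply: lee_nneseries => [m _ _|m _].
  exact: (outer_measure_ge0 box_outer).
apply: (@box_outer_sub_box _ (const_mx (- m%:R)%R, const_mx m%:R)) => // x [_].
by case: m {mAQ mQ} => [//|m] [].
Qed.

(** The measure is built by iterated products and Hausdorff measure by coverings;
    this is where the two descriptions meet. *)
Lemma outer_lebesgue_boxE A : outer_lebesgue R n A = box_outer A.
Proof.
apply/eqP; rewrite eq_le; apply/andP; split.
  apply: le_ereal_inf_tmp => _ [F [mF AF] <-].
  apply: (@le_trans _ _ (\sum_(k <oo) borel_lebesgue R n (F k))).
    by apply: ereal_inf_lbound; exists F.
  apply: lee_nneseries => // k _; apply: le_ereal_inf_tmp => _ [p Fp <-].
  rewrite -borel_lebesgue_box; apply: le_measure; rewrite ?inE//.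
  exact: measurable_box.
apply: le_ereal_inf_tmp => _ [F [mF AF] <-].
apply: (le_trans (le_outer_measure box_outer _ _ AF)).
apply: (le_trans (outer_measure_sigma_subadditive box_outer F)).
apply: lee_nneseries => [k _ _|k _]; last exact: box_outer_le.
exact: (outer_measure_ge0 box_outer).
Qed.

End box_outer_measure.

(** * Coverings by small cubes *)

Lemma outer_measure_sum_le {R : realType} (T : Type) (I : finType)
    (mu : {outer_measure set T -> \bar R}) (P : pred I) (F : I -> set T) :
  (mu (\big[setU/set0]_(i | P i) F i) <= \sum_(i | P i) mu (F i))%E.
Proof.
elim/big_rec2: _ => [|i y B _ IH]; first by rewrite outer_measure0.
by apply: le_trans (outer_measureU2 mu _ _) _; exact: leeD2l.
Qed.

Section cubes.
Context {R : realType} {n : nat}.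
Implicit Types (A : set 'rV[R]_n) (p : 'rV[R]_n * 'rV[R]_n).
Local Open Scope ereal_scope.

Definition cube (c : 'rV[R]_n) (r : R) : set 'rV[R]_n :=
  [set x | (`|x - c| <= r)%R].

Variable delta : R.
Hypotheses (n0 : (0 < n)%N) (delta0 : (0 < delta)%R).

(** As [r] is half the side of [cube c r], [r ^+ n] is its volume up to the
    factor [2 ^ n]. The bound on [r] makes the coverings fine. *)
Definition cube_hull A : \bar R :=
  ereal_inf [set (r ^+ n)%:E | r in
    [set r | (0 < r <= delta)%R /\ exists c, A `<=` cube c r]].

Lemma cube_hull_ge0 A : 0 <= cube_hull A.
Proof.
apply: le_ereal_inf_tmp => _ [r [/andP[r0 _] _] <-].
by rewrite lee_fin exprn_ge0// ltW.
Qed.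

Lemma cube_hull_le A c r :
  (0 < r <= delta)%R -> A `<=` cube c r -> cube_hull A <= (r ^+ n)%:E.
Proof. by move=> r0 Ac; apply: ereal_inf_lbound; exists r => //; split=> //; exists c. Qed.

Lemma cube_hull0 : cube_hull set0 = 0.
Proof.
apply/eqP; rewrite eq_le cube_hull_ge0 andbT.
apply/lee_addgt0Pr => e e0; rewrite add0e.
pose r := Num.min delta (Num.min 1 e)%R.
have r0 : (0 < r)%R by rewrite !lt_min delta0 e0 ltr01.
apply: (@le_trans _ _ (r ^+ n)%:E).
  by apply: (@cube_hull_le _ 0%R) => //; rewrite r0 ge_min lexx.
rewrite lee_fin; apply: (@le_trans _ _ r); last by rewrite !ge_min lexx !orbT.
rewrite -[leRHS]expr1 ler_wiXn2l//; first exact: ltW.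
by rewrite !ge_min lexx !orbT.
Qed.

Definition cube_outer : set 'rV[R]_n -> \bar R := mu_ext cube_hull.

HB.instance Definition _ := isOuterMeasure.Build R _ cube_outer
  (mu_ext0 cube_hull0 cube_hull_ge0) (mu_ext_ge0 cube_hull_ge0)
  (le_mu_ext cube_hull) (mu_ext_sigma_subadditive cube_hull_ge0).

Lemma measurable_cube c r : measurable (cube c r).
Proof.
apply: closed_measurable_rV.
have -> : cube c r = closed_ball_ (fun x : 'rV[R]_n => `|x|%R) c r.
  by apply/seteqP; split=> x; rewrite /cube/closed_ball_/= distrC.
exact: closed_closed_ball_.
Qed.

Lemma cube_outer_le c r :
  (0 < r <= delta)%R -> cube_outer (cube c r) <= (r ^+ n)%:E.
Proof.
move=> r0; apply: le_trans (cube_hull_le r0 (@subset_refl _ (cube c r))).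
apply: ereal_inf_lbound; exists (fun k => if k == 0%N then cube c r else set0).
  by split=> [[|k] /=|x px]; [exact: measurable_cube|exact: measurable0|exists 0%N].
rewrite (nneseries_split _ 1%N); last by move=> k _; exact: cube_hull_ge0.
rewrite big_nat1 eseries0 ?adde0// => -[//|k] _ _; exact: cube_hull0.
Qed.

(** A box is tiled by cubes of half-side [r]; one more row of tiles in each
    direction is paid for by taking [2 * r] below each side of the box. *)
Lemma cube_outer_box p : cube_outer (box p) <= (vol p)%:E.
Proof.
have [[i pi]|p_lt] := pselect (exists i, (p.2 ord0 i <= p.1 ord0 i)%R).
  rewrite (_ : box p = set0) ?outer_measure0 ?lee_fin ?vol_ge0//.
  apply/seteqP; split=> // x /(_ i) /andP[x1 x2].
  by have := lt_le_trans x1 (le_trans x2 pi); rewrite ltxx.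
pose L i := (p.2 ord0 i - p.1 ord0 i)%R.
have L0 i : (0 < L i)%R.
  by rewrite subr_gt0 ltNge; apply/negP => ?; apply: p_lt; exists i.
pose r := (\big[Num.min/delta]_i (L i / 2))%R.
have r0 : (0 < r)%R by apply/bigmin_gtP; split=> // i _; rewrite divr_gt0.
have rd : (r <= delta)%R by apply: bigmin_le_id.
have rL i : (r <= L i / 2)%R by apply: bigmin_le_cond.
have r20 : (0 < 2 * r)%R by rewrite mulr_gt0.
pose N i := (Num.trunc (L i / (2 * r))).+1.
pose M := (\max_i N i)%N.
have NM i : (N i <= M)%N by exact: leq_bigmax.
have NL i : (r *+ N i <= L i)%R.
  have q1 : (1 <= L i / (2 * r))%R.
    by rewrite ler_pdivlMr// mul1r -ler_pdivlMl// mulrC.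
  have qN : ((Num.trunc (L i / (2 * r)))%:R <= L i / (2 * r))%R.
    by rewrite truncn_le; apply: le_trans q1.
  rewrite -mulr_natr [leRHS](_ : _ = r * (L i / (2 * r) + L i / (2 * r)))%R.
    by rewrite ler_wpM2l ?(ltW r0)// /N -natr1 lerD.
  by field; rewrite gt_eqF.
pose C (f : {ffun 'I_n -> 'I_M}) : 'rV[R]_n :=
  \row_i (p.1 ord0 i + (f i)%:R * (2 * r) + r)%R.
have cover : box p `<=` \big[setU/set0]_(f in family (fun i (j : 'I_M) => (j < N i)%N)) cube (C f) r.
  move=> x px.
  pose q i := ((x ord0 i - p.1 ord0 i) / (2 * r))%R.
  have q0 i : (0 <= q i)%R.
    by have /andP[/ltW ? _] := px i; rewrite divr_ge0 ?subr_ge0// ltW.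
  have qN i : (Num.trunc (q i) < N i)%N.
    rewrite ltnS le_truncn// ler_wpM2r ?invr_ge0 ?(ltW r20)//.
    by have /andP[_ ?] := px i; rewrite /L lerD2r.
  pose f := [ffun i => Ordinal (leq_trans (qN i) (NM i))].
  rewrite (bigD1 f)/=; last by apply/familyP => i; rewrite ffunE; exact: qN.
  left; apply: rV_norm_le => [|i]; first exact: ltW.
  rewrite !mxE ffunE/=.
  have /andP[] := truncn_itv (q0 i); rewrite -natr1.
  have := px i; move: (q0 i); rewrite /q.
  move: (Num.trunc _)%:R => m _ _; rewrite ler_pdivlMr// ltr_pdivrMr//.
  by move=> h1 h2; rewrite ler_norml; apply/andP; split; lra.
apply: (le_trans (le_outer_measure cube_outer _ _ cover)).
apply: (le_trans (outer_measure_sum_le cube_outer _ _)).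
apply: (@le_trans _ _ (\sum_(f in family (fun i (j : 'I_M) => (j < N i)%N)) (r ^+ n)%:E)).
  by apply: lee_sum => f _; apply: cube_outer_le; rewrite r0.
rewrite sumEFin lee_fin.
rewrite (eq_bigr (fun f : {ffun 'I_n -> 'I_M} => \prod_(i < n) r)%R); last first.
  by move=> f _; rewrite prodr_const card_ord.
rewrite -(bigA_distr_big_dep (fun i (j : 'I_M) => (j < N i)%N) (fun _ _ => r)).
apply: ler_prod => i _; rewrite -(big_ord_widen M (fun=> r) (NM i)) sumr_const card_ord.
by rewrite mulrn_wge0 ?(ltW r0)//= max_r; [exact: NL|exact/ltW/L0].
Qed.

Lemma cube_outer_le_lebesgue A : cube_outer A <= outer_lebesgue R n A.
Proof.
rewrite outer_lebesgue_boxE//; apply: le_ereal_inf_tmp => _ [F [mF AF] <-].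
apply: (le_trans (le_outer_measure cube_outer _ _ AF)).
apply: (le_trans (outer_measure_sigma_subadditive cube_outer F)).
apply: lee_nneseries => [k _ _|k _]; first exact: (outer_measure_ge0 cube_outer).
apply: le_ereal_inf_tmp => _ [p Fp <-].
exact: le_trans (le_outer_measure cube_outer _ _ Fp) (cube_outer_box p).
Qed.

(** A set of outer measure less than [e] is covered by small cubes, the
    volumes of which add up to at most [2 ^ n * e]. *)
Lemma cube_cover A (e : R) : outer_lebesgue R n A < e%:E ->
  exists (c : nat -> 'rV[R]_n) (r : nat -> R),
    [/\ forall k, (0 < r k <= delta)%R, A `<=` \bigcup_k cube (c k) (r k) &
        \sum_(k <oo) (r k ^+ n)%:E <= e%:E].
Proof.
move=> Ae; have {Ae} := le_lt_trans (cube_outer_le_lebesgue A) Ae.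
move=> /ereal_inf_lt[_ [F [mF AF] <-]] Fe.
pose s := \sum_(k <oo) cube_hull (F k).
have s0 : 0 <= s by apply: nneseries_ge0 => *; exact: cube_hull_ge0.
have sfin : s \is a fin_num by rewrite ge0_fin_numE// (lt_trans Fe)// ltry.
pose d := (e - fine s)%R.
have d0 : (0 < d)%R by rewrite subr_gt0 -lte_fin fineK.
have hfin k : cube_hull (F k) \is a fin_num.
  rewrite ge0_fin_numE ?cube_hull_ge0//; apply: (le_lt_trans _ (lt_trans Fe (ltry e))).
  apply: le_trans (nneseries_lim_ge k.+1 _); last by move=> *; exact: cube_hull_ge0.
  rewrite big_nat_recr//= leeDr// sume_ge0// => *; exact: cube_hull_ge0.
have /choice[cr crP] k : exists cr : 'rV[R]_n * R, [/\ (0 < cr.2 <= delta)%R,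
    F k `<=` cube cr.1 cr.2 &
    (cr.2 ^+ n)%:E <= cube_hull (F k) + (d / (2 ^ k.+1)%:R)%:E].
  have dk : (0 < d / (2 ^ k.+1)%:R)%R by rewrite divr_gt0// ltr0n expn_gt0.
  have [_ [r [rd [c Fc]] <-] rlt] := lb_ereal_inf_adherent dk (hfin k).
  by exists (c, r); split=> //; exact: ltW.
exists (fun k => (cr k).1), (fun k => (cr k).2); split.
- by move=> k; have [] := crP k.
- by move=> x /AF[k _ Fx]; exists k => //; have [_ + _] := crP k; exact.
apply: (@le_trans _ _ (\sum_(k <oo) (cube_hull (F k) + (d / (2 ^ k.+1)%:R)%:E))).
  apply: lee_nneseries => k; last by have [] := crP k.
  by have [/andP[/ltW ? _] _ _] := crP k; rewrite lee_fin exprn_ge0.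
apply: le_trans (epsilon_trick _ _ (ltW d0)) _; first by move=> k; exact: cube_hull_ge0.
by rewrite -/s -(fineK sfin) -EFinD lee_fin /d subrKC.
Qed.
End cubes.

(** * Null sets and Lipschitz maps *)

Section euclidean_norm.
Context {R : realType} {n : nat}.
Implicit Types x : 'rV[R]_n.

Lemma norm_le_enorm x : `|x| <= enorm x.
Proof.
apply: rV_norm_le => [|i]; first exact: sqrtr_ge0.
rewrite -sqrtr_sqr ler_wsqrtr// /dot (bigD1 i)//= -expr2 lerDl.
by apply: sumr_ge0 => j _; rewrite -expr2 sqr_ge0.
Qed.

Lemma enorm_le_norm x : enorm x <= n.+1%:R * `|x|.
Proof.
rewrite -[leRHS]ger0_norm ?mulr_ge0// -sqrtr_sqr ler_wsqrtr//.
apply: (@le_trans _ _ (\sum_(i < n) `|x| ^+ 2)).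
  apply: ler_sum => i _; rewrite -expr2 -real_normK ?num_real//.
  by rewrite lerXn2r ?nnegrE// rV_coord_le.
rewrite sumr_const card_ord exprMn -[leLHS]mulr_natl ler_wpM2r ?exprn_ge0//.
by rewrite -natrX ler_nat (leq_trans (leqnSn n))// -mulnn leq_pmulr.
Qed.

End euclidean_norm.

Section outer_lebesgue_cube.
Context {R : realType} {n : nat}.
Local Open Scope ereal_scope.

Lemma outer_lebesgueE (A : set 'rV[R]_n) :
  measurable A -> outer_lebesgue R n A = borel_lebesgue R n A.
Proof. exact: measurable_mu_extE. Qed.

(** The closed cube of half-side [r] lies in a half-open box of side [4 * r];
    for [r = 0] that box is empty and small boxes take its place. *)
Lemma outer_lebesgue_sub_cube (c : 'rV[R]_n) (r : R) (A : set 'rV[R]_n) :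
  (0 < n)%N -> (0 <= r)%R -> A `<=` cube c r ->
  outer_lebesgue R n A <= ((4 * r) ^+ n)%:E.
Proof.
move=> n0 r0 Ac.
have pos s : (r <= s)%R -> (0 < s)%R -> outer_lebesgue R n A <= ((4 * s) ^+ n)%:E.
  move=> rs s0; pose p : 'rV[R]_n * 'rV[R]_n :=
    (c - const_mx (2 * s), c + const_mx (2 * s))%R.
  apply: (@le_trans _ _ (outer_lebesgue R n (box p))).
    apply: le_mu_ext => x /Ac xc i; rewrite !mxE.
    have : (`|x ord0 i - c ord0 i| <= s)%R.
      by apply: le_trans rs; apply: le_trans xc; have := rV_coord_le (x - c) i; rewrite !mxE.
    by rewrite ler_norml => /andP[h1 h2]; apply/andP; split; lra.
  rewrite outer_lebesgueE; last exact: measurable_box.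
  rewrite borel_lebesgue_box lee_fin /vol (eq_bigr (fun=> 4 * s)%R).
    by rewrite prodr_const card_ord.
  move=> i _; rewrite !mxE max_r; first by ring.
  by lra.
have [r_gt0|] := ltP 0%R r; first exact: pos.
move=> r_le0; have -> : r = 0%R by apply/eqP; rewrite eq_le r_le0.
rewrite mulr0 expr0n eqn0Ngt n0/=.
apply/lee_addgt0Pr => e e0; rewrite add0e.
pose s := Num.min 1%R e.
have s0 : (0 < s)%R by rewrite lt_min ltr01.
apply: le_trans (pos (s / 4) _ _)%R _; rewrite ?divr_gt0//.
  by rewrite (le_trans r_le0)// divr_ge0// ltW.
rewrite lee_fin mulrC divfK//; apply: (@le_trans _ _ s); last by rewrite ge_min lexx orbT.
by rewrite -[leRHS]expr1 ler_wiXn2l// ?(ltW s0)// ge_min lexx.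
Qed.

End outer_lebesgue_cube.

Section lipschitz_images.
Context {R : realType}.
Local Open Scope ereal_scope.

(** A map that contracts distances by at most [C] pulls back small cubes to
    sets that lie in small cubes. The factor 8 is a 2 for centring the cube at a
    point of the set, times the 4 of [outer_lebesgue_sub_cube]. *)
Lemma outer_lebesgue_expanding n (A : set 'rV[R]_n) (F : 'rV[R]_n -> 'rV[R]_n) (C : R) :
  (0 < n)%N -> (0 < C)%R ->
  (forall x y, A x -> A y -> (`|x - y| <= C * `|F x - F y|)%R) ->
  outer_lebesgue R n A <= ((8 * C) ^+ n)%:E * outer_lebesgue R n (F @` A).
Proof.
move=> n0 C0 AF; have K0 : (0 < (8 * C) ^+ n)%R by rewrite exprn_gt0// mulr_gt0.
have FA0 : 0 <= outer_lebesgue R n (F @` A) by exact: outer_measure_ge0.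
have [FAoo|FAfin] := eqVneq (outer_lebesgue R n (F @` A)) +oo.
  by rewrite FAoo gt0_muley ?lte_fin// leey.
have fin : outer_lebesgue R n (F @` A) \is a fin_num.
  by rewrite ge0_fin_numE// ltey.
rewrite -(fineK fin) -EFinM; apply/lee_addgt0Pr => e e0.
pose d := (e / (8 * C) ^+ n)%R.
have d0 : (0 < d)%R by rewrite divr_gt0.
have : outer_lebesgue R n (F @` A) < (fine (outer_lebesgue R n (F @` A)) + d)%:E.
  by rewrite EFinD fineK// lteDl.
move=> /(cube_cover n0 (@ltr01 R))[c [r [r0 FAc rs]]].
apply: (@le_trans _ _ (\sum_(k <oo) outer_lebesgue R n (A `&` F @^-1` cube (c k) (r k)))).
  apply: le_trans _ (outer_measure_sigma_subadditive _ _).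
  apply: le_mu_ext => x Ax; have [k _ Fx] := FAc _ (imageP F Ax).
  by exists k.
apply: (@le_trans _ _ (\sum_(k <oo) ((8 * C) ^+ n)%:E * (r k ^+ n)%:E)).
  apply: lee_nneseries => [k _ _|k _]; first exact: outer_measure_ge0.
  have /andP[rk0 _] := r0 k.
  have [[x0 [Ax0 Fx0]]|E0] := pselect (exists x, (A `&` F @^-1` cube (c k) (r k)) x).
    have -> : ((8 * C) ^+ n)%:E * (r k ^+ n)%:E = ((4 * (2 * C * r k)) ^+ n)%:E.
      by rewrite -EFinM -exprMn; congr ((_ ^+ n)%:E); ring.
    apply: (@outer_lebesgue_sub_cube _ _ x0) => //.
      by rewrite !mulr_ge0// ltW.
    move=> x [Ax Fx]; rewrite /cube/=; apply: le_trans (AF _ _ Ax Ax0) _.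
    rewrite mulrAC mulrC ler_wpM2r ?(ltW C0)//.
    rewrite (_ : F x - F x0 = F x - c k - (F x0 - c k))%R; last by rewrite opprB addrA subrK.
    by apply: le_trans (ler_normB _ _) _; rewrite mulr_natl mulr2n lerD.
  rewrite (_ : _ `&` _ = set0) ?outer_measure0.
    by rewrite -EFinM lee_fin mulr_ge0 ?exprn_ge0 ?mulr_ge0// ltW.
  by apply/seteqP; split=> // x Ex; apply: E0; exists x.
rewrite nneseriesZl; last by move=> k _; have /andP[/ltW ? _] := r0 k; rewrite lee_fin exprn_ge0.
apply: le_trans (lee_wpmul2l _ rs) _; first by rewrite lee_fin ltW.
by rewrite -EFinM -EFinD lee_fin mulrDr lerD2l /d mulrC divfK// gt_eqF.
Qed.

Lemma diam_ge n (A : set 'rV[R]_n) x y : A x -> A y -> (enorm (x - y))%:E <= diam A.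
Proof. by move=> Ax Ay; apply: ereal_sup_ubound; exists (x, y). Qed.

Lemma diam_le n (A : set 'rV[R]_n) (d : R) :
  (forall x y, A x -> A y -> (enorm (x - y) <= d)%R) -> diam A <= d%:E.
Proof.
by move=> Ad; apply: ge_ereal_sup => _ [[x y] [Ax Ay] <-]; rewrite lee_fin Ad.
Qed.

Lemma hausdorff_gauge_ge0 n m (A : set 'rV[R]_n) : 0 <= hausdorff_gauge m A.
Proof.
rewrite /hausdorff_gauge; case: eqVneq => // /set0P[x Ax].
apply: expe_ge0; apply: le_trans (diam_ge Ax Ax).
by rewrite lee_fin sqrtr_ge0.
Qed.

Lemma hausdorff_content_ge0 n m d (A : set 'rV[R]_n) : 0 <= hausdorff_content m d A.
Proof.
apply: le_ereal_inf_tmp => _ [F _ <-]; apply: nneseries_ge0 => k _ _.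
exact: hausdorff_gauge_ge0.
Qed.

Lemma hausdorff_null_content n m (A : set 'rV[R]_n) :
  hausdorff_measure m A = 0 <->
  forall d : R, (0 < d)%R -> hausdorff_content m d A = 0.
Proof.
split=> [A0 d d0|A0].
  apply/eqP; rewrite eq_le hausdorff_content_ge0 andbT -A0.
  by apply: ereal_sup_ubound; exists d.
rewrite /hausdorff_measure (_ : [set _ | _ in _] = [set 0]) ?ereal_sup1//.
apply/seteqP; split=> [_ [d /= d0 <-]|_ ->]; first exact: A0.
by exists 1%R => //=; apply: A0.
Qed.

Lemma hausdorff_content_mono n m d (A B : set 'rV[R]_n) :
  A `<=` B -> hausdorff_content m d A <= hausdorff_content m d B.
Proof.
move=> AB; apply: ereal_inf_le_tmp => _ [F [BF Fd] <-]; exists F => //; split=> //.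
exact: subset_trans BF.
Qed.

Lemma hausdorff_null_subset n m (A B : set 'rV[R]_n) :
  A `<=` B -> hausdorff_measure m B = 0 -> hausdorff_measure m A = 0.
Proof.
move=> AB /hausdorff_null_content B0; apply/hausdorff_null_content => d d0.
by apply/eqP; rewrite eq_le hausdorff_content_ge0 andbT -(B0 d d0) hausdorff_content_mono.
Qed.

Lemma hausdorff_null_bigcup n m (A : (set 'rV[R]_n)^nat) : (0 < m)%N ->
  (forall i, hausdorff_measure m (A i) = 0) -> hausdorff_measure m (\bigcup_i A i) = 0.
Proof.
move=> m0 A0; apply/hausdorff_null_content => d d0.
(* The content is the outer measure generated by the gauge of the sets of
   diameter at most d, all sets being allowed in coverings. *)
pose T := g_sigma_algebraType (@setT (set 'rV[R]_n)).
pose g (E : set T) := if diam E <= d%:E then hausdorff_gauge m E else +oo.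
have g_ge0 E : 0 <= g E by rewrite /g; case: ifP => _; [exact: hausdorff_gauge_ge0|].
have g0 : g set0 = 0.
  rewrite /g ifT; first by rewrite /hausdorff_gauge eqxx.
  by apply: diam_le.
have cg E : hausdorff_content m d E <= mu_ext g E.
  apply: le_ereal_inf_tmp => _ [F [_ EF] <-].
  have [[i Fi]|Fd] := pselect (exists i, ~ (diam (F i) <= d%:E)).
    rewrite (eseries_pinfty (k := i)) ?leey// => [j _|].
      by rewrite -ltNye (lt_le_trans _ (g_ge0 _)).
    by rewrite /g ifF//; exact/negbTE/negP.
  have {}Fd i : diam (F i) <= d%:E by apply: contrapT => ?; apply: Fd; exists i.
  apply: ereal_inf_lbound; exists F => //.
  by apply: eq_eseriesr => i _; rewrite /g Fd.
have gc E : mu_ext g E <= hausdorff_content m d E.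
  apply: le_ereal_inf_tmp => _ [F [EF Fd] <-].
  apply: ereal_inf_lbound; exists F; first by split=> // i; exact: sub_sigma_algebra.
  by apply: eq_eseriesr => i _; rewrite /g Fd.
apply/eqP; rewrite eq_le hausdorff_content_ge0 andbT.
apply: (le_trans (cg _)); apply: (le_trans (mu_ext_sigma_subadditive g_ge0 A)).
rewrite eseries0// => i _ _; apply/eqP; rewrite eq_le (mu_ext_ge0 g_ge0) andbT.
by apply: (le_trans (gc _)); rewrite (hausdorff_null_content _ _).1.
Qed.

(** Small cubes that cover a null set are mapped to sets of comparable diameter,
    whose gauge is comparable to the volume of the cubes. *)
Lemma hausdorff_null_lipschitz n m (A : set 'rV[R]_n) (F : 'rV[R]_n -> 'rV[R]_m) (C : R) :
  (0 < n)%N -> (0 < C)%R ->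
  (forall x y, A x -> A y -> (`|F x - F y| <= C * `|x - y|)%R) ->
  outer_lebesgue R n A = 0 -> hausdorff_measure n (F @` A) = 0.
Proof.
move=> n0 C0 AF A0; apply/hausdorff_null_content => d d0.
apply/eqP; rewrite eq_le hausdorff_content_ge0 andbT.
apply/lee_addgt0Pr => e e0; rewrite add0e.
pose K := (2 * m.+1%:R * C)%R.
have K0 : (0 < K)%R by rewrite !mulr_gt0.
have dK0 : (0 < d / K)%R by rewrite divr_gt0.
have eK0 : (0 < e / K ^+ n)%R by rewrite divr_gt0// exprn_gt0.
have : outer_lebesgue R n A < (e / K ^+ n)%:E by rewrite A0 lte_fin.
move=> /(cube_cover n0 dK0)[c [r [r0 Ac rs]]].
have Fdiam k : diam (F @` (A `&` cube (c k) (r k))) <= (K * r k)%:E.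
  apply: diam_le => _ _ [x [Ax xc] <-] [y [Ay yc] <-].
  apply: le_trans (enorm_le_norm _) _.
  have -> : (K * r k = m.+1%:R * (C * (r k + r k)))%R by rewrite /K; ring.
  rewrite ler_wpM2l//; apply: le_trans (AF _ _ Ax Ay) _; rewrite ler_wpM2l ?(ltW C0)//.
  rewrite (_ : x - y = x - c k - (y - c k))%R; last by rewrite opprB addrA subrK.
  by apply: le_trans (ler_normB _ _) _; rewrite lerD.
apply: (@le_trans _ _ (\sum_(k <oo) hausdorff_gauge n (F @` (A `&` cube (c k) (r k))))).
  apply: ereal_inf_lbound; exists (fun k => F @` (A `&` cube (c k) (r k))) => //; split.
    by move=> _ [x Ax <-]; have [k _ xc] := Ac _ Ax; exists k => //; exists x.
  move=> k; apply: le_trans (Fdiam k) _; rewrite lee_fin mulrC -ler_pdivlMr//.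
  by have /andP[] := r0 k.
apply: (@le_trans _ _ (\sum_(k <oo) (K ^+ n)%:E * (r k ^+ n)%:E)).
  apply: lee_nneseries => [k _ _|k _]; first exact: hausdorff_gauge_ge0.
  have /andP[/ltW rk0 _] := r0 k.
  have rK0 : 0 <= (K ^+ n)%:E * (r k ^+ n)%:E.
    by rewrite -EFinM lee_fin mulr_ge0// exprn_ge0// ltW.
  rewrite {1}/hausdorff_gauge; case: eqVneq => // /set0P[y Fy].
  have dge0 : 0 <= diam (F @` (A `&` cube (c k) (r k))).
    by apply: le_trans (diam_ge Fy Fy); rewrite lee_fin sqrtr_ge0.
  have dfin : diam (F @` (A `&` cube (c k) (r k))) \is a fin_num.
    by rewrite ge0_fin_numE//; apply: le_lt_trans (Fdiam k) _; rewrite ltry.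
  have := Fdiam k; rewrite -EFinM -exprMn -(fineK dfin) -EFin_expe !lee_fin => h.
  by rewrite lerXn2r// nnegrE ?fine_ge0// (le_trans _ h)// fine_ge0.
rewrite nneseriesZl; last by move=> k _; have /andP[/ltW ? _] := r0 k; rewrite lee_fin exprn_ge0.
apply: le_trans (lee_wpmul2l _ rs) _; first by rewrite lee_fin exprn_ge0// ltW.
by rewrite -EFinM lee_fin mulrC divfK// gt_eqF// exprn_gt0.
Qed.

(** The sets of a covering of the image pull back to sets of comparable diameter,
    which lie in cubes of comparable volume. *)
Lemma outer_lebesgue_null_expanding n m (A : set 'rV[R]_n) (F : 'rV[R]_n -> 'rV[R]_m) (C : R) :
  (0 < n)%N -> (0 < C)%R ->
  (forall x y, A x -> A y -> (`|x - y| <= C * `|F x - F y|)%R) ->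
  hausdorff_measure n (F @` A) = 0 -> outer_lebesgue R n A = 0.
Proof.
move=> n0 C0 AF /hausdorff_null_content/(_ 1%R ltr01) FA0.
apply/eqP; rewrite eq_le outer_measure_ge0 andbT.
apply/lee_addgt0Pr => e e0; rewrite add0e.
pose K := (4 * C)%R.
have K0 : (0 < K)%R by rewrite mulr_gt0.
have eK0 : (0 < e / K ^+ n)%R by rewrite divr_gt0// exprn_gt0.
have : hausdorff_content n 1%R (F @` A) < (e / K ^+ n)%:E by rewrite FA0 lte_fin.
move=> /ereal_inf_lt[_ [E [FE E1] <-]] Es.
apply: (@le_trans _ _ (\sum_(k <oo) outer_lebesgue R n (A `&` F @^-1` E k))).
  apply: le_trans _ (outer_measure_sigma_subadditive _ _).
  by apply: le_mu_ext => x Ax; have [k _ Fx] := FE _ (imageP F Ax); exists k.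
apply: (@le_trans _ _ (\sum_(k <oo) (K ^+ n)%:E * hausdorff_gauge n (E k))).
  apply: lee_nneseries => [k _ _|k _]; first exact: outer_measure_ge0.
  have [[x0 [Ax0 Fx0]]|E0] := pselect (exists x, (A `&` F @^-1` E k) x); last first.
    rewrite (_ : _ `&` _ = set0) ?outer_measure0.
      by rewrite mule_ge0 ?hausdorff_gauge_ge0// lee_fin exprn_ge0// ltW.
    by apply/seteqP; split=> // x Ex; apply: E0; exists x.
  rewrite /hausdorff_gauge; case: eqVneq => [E0|_]; first by move: Fx0; rewrite /= E0.
  have dge0 : 0 <= diam (E k).
    by apply: le_trans (@diam_ge _ (E k) _ _ Fx0 Fx0); rewrite lee_fin sqrtr_ge0.
  have dfin : diam (E k) \is a fin_num.
    by rewrite ge0_fin_numE//; apply: le_lt_trans (E1 k) _; rewrite ltry.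
  have -> : (K ^+ n)%:E * diam (E k) ^+ n = ((4 * (C * fine (diam (E k)))) ^+ n)%:E.
    by rewrite -(fineK dfin) -EFin_expe -EFinM -exprMn mulrA.
  apply: (@outer_lebesgue_sub_cube _ _ x0) => //.
    by rewrite mulr_ge0 ?fine_ge0// ltW.
  move=> x [Ax Fx]; rewrite /cube/=; apply: le_trans (AF _ _ Ax Ax0) _.
  rewrite ler_wpM2l ?(ltW C0)//; apply: le_trans (norm_le_enorm _) _.
  by rewrite -lee_fin fineK//; exact: (@diam_ge _ (E k)).
rewrite nneseriesZl; last by move=> k _; exact: hausdorff_gauge_ge0.
apply: le_trans (lee_wpmul2l _ (ltW Es)) _; first by rewrite lee_fin exprn_ge0// ltW.
by rewrite -EFinM lee_fin mulrC divfK// gt_eqF// exprn_gt0.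
Qed.

End lipschitz_images.

(** * Translations and slices *)

Section translation.
Context {R : realType} {n : nat}.
Implicit Types (A : set 'rV[R]_n) (c : 'rV[R]_n).
Local Open Scope ereal_scope.

Lemma measurable_shift c : measurable_fun setT (fun x : 'rV[R]_n => (x + c)%R).
Proof.
apply: continuous_measurable_rV => [|x _]; first exact: openT.
apply: (@continuousD _ _ _ id (cst c)); [exact: cvg_id|exact: cst_continuous].
Qed.

Hypothesis n0 : (0 < n)%N.

Let shift_le c A : box_outer [set x | A (x + c)%R] <= box_outer A.
Proof.
apply: le_ereal_inf_tmp => _ [F [mF AF] <-].
apply: (@le_trans _ _ (\sum_(k <oo) box_hull [set x | F k (x + c)%R])).
  apply: ereal_inf_lbound; exists (fun k => [set x | F k (x + c)%R]) => //; split.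
    by move=> k; have := measurable_shift c measurableT (mF k); rewrite setTI.
  by move=> x /AF[k _ Fx]; exists k.
apply: lee_nneseries => [k _ _|k _]; first exact: box_hull_ge0.
apply: le_ereal_inf_tmp => _ [p Fp <-].
apply: le_trans (box_hull_le (p := (p.1 - c, p.2 - c)%R) _) _.
  by move=> x /Fp xp i; have := xp i; rewrite !mxE ltrBlDr lerBrDr.
by rewrite lee_fin /vol le_eqVlt; apply/orP; left; apply/eqP; apply: eq_bigr => i _;
  rewrite !mxE opprB addrA subrK.
Qed.

(** Translations permute the boxes and preserve their volumes, and boxes
    determine the measure. *)
Lemma borel_lebesgue_shift c A : measurable A ->
  borel_lebesgue R n [set x | A (x + c)%R] = borel_lebesgue R n A.
Proof.
move=> mA; have mAc : measurable [set x | A (x + c)%R].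
  by have := measurable_shift c measurableT mA; rewrite setTI.
rewrite -!outer_lebesgueE// !outer_lebesgue_boxE//.
apply/eqP; rewrite eq_le shift_le/=.
have := shift_le (- c) [set x | A (x + c)%R].
by under eq_set do rewrite /= subrK.
Qed.

Lemma ge0_integral_shift c (f : 'rV[R]_n -> \bar R) :
  measurable_fun setT f -> (forall x, 0 <= f x) ->
  \int[borel_lebesgue R n]_x f (x + c)%R = \int[borel_lebesgue R n]_x f x.
Proof.
move=> mf f0; rewrite -[LHS](ge0_integral_pushforward (measurable_shift c) _ measurableT mf)//.
apply: eq_measure_integral => [|? A mA _]; first exact: measurable_shift.
by rewrite -[RHS](borel_lebesgue_shift c mA).
Qed.

End translation.

Section slices.
Context {R : realType}.
Local Open Scope ereal_scope.

Lemma measurable_row_mx k d :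
  measurable_fun setT (fun p : 'rV[R]_k * 'rV[R]_d => row_mx p.1 p.2).
Proof.
apply: measurable_fun_rV => i; case: (splitP i) => j ij.
  rewrite (_ : (fun _ => _) = (fun y : 'rV[R]_k => y ord0 j) \o fst).
    by apply: measurableT_comp; [exact: measurable_rV_coord|exact: measurable_fst].
  apply/funext => p /=; rewrite (_ : i = lshift d j); last exact: val_inj.
  by rewrite row_mxEl.
rewrite (_ : (fun _ => _) = (fun z : 'rV[R]_d => z ord0 j) \o snd).
  by apply: measurableT_comp; [exact: measurable_rV_coord|exact: measurable_snd].
apply/funext => p /=; rewrite (_ : i = rshift k j); last exact: val_inj.
by rewrite row_mxEr.
Qed.

Lemma rV_cons_row_mx k d (a : measurableTypeR R) (y : 'rV[R]_k) (z : 'rV[R]_d) :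
  row_mx (rV_cons (a, y)) z = rV_cons (a, row_mx y z) :> 'rV[R]_(k + d).+1.
Proof.
apply/rowP => i; rewrite [RHS]mxE; case: unliftP => [j|] ->.
  case: (splitP j) => m jm.
    rewrite (_ : j = lshift d m); last exact: val_inj.
    rewrite (_ : lift ord0 (lshift d m) = lshift d (lift ord0 m)); last exact: val_inj.
    by rewrite [LHS]row_mxEl mxE liftK/= row_mxEl.
  rewrite (_ : j = rshift k m); last exact: val_inj.
  rewrite (_ : lift ord0 (rshift k m) = rshift k.+1 m); last exact: val_inj.
  by rewrite [LHS]row_mxEr/= row_mxEr.
rewrite (_ : ord0 = lshift d (@ord0 k)); last exact: val_inj.
by rewrite [LHS]row_mxEl mxE unlift_none.
Qed.

(** Lebesgue measure on the product of two coordinate spaces; by induction, as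
    the measure is built by adding one coordinate at a time. *)
Lemma borel_lebesgue_row_mx k d (A : set 'rV[R]_(k + d)) : measurable A ->
  borel_lebesgue R (k + d) A = (borel_lebesgue R k \x borel_lebesgue R d)
    ((fun p : 'rV[R]_k * 'rV[R]_d => row_mx p.1 p.2) @^-1` A).
Proof.
elim: k A => [|k IHk] A mA.
  rewrite /= /product_measure1 integral_dirac//=; last first.
    apply: measurable_fun_xsection.
    by have := @measurable_row_mx 0 d measurableT _ mA; rewrite setTI.
  rewrite diracT mul1e; congr (borel_lebesgue R d _).
  by apply/seteqP; split=> z; rewrite /xsection/= in_setE/= row_thin_mx.
have mB : measurable ((fun p : 'rV[R]_k.+1 * 'rV[R]_d => row_mx p.1 p.2) @^-1` A).
  by have := @measurable_row_mx k.+1 d measurableT _ mA; rewrite setTI.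
set B := _ @^-1` A in mB *.
have mC : measurable (@rV_cons R (k + d) @^-1` A).
  by have := @measurable_rV_cons R (k + d) measurableT _ mA; rewrite setTI.
pose g (y : 'rV[R]_k.+1) := borel_lebesgue R d (xsection B y).
have mg : measurable_fun setT g by exact: measurable_fun_xsection.
rewrite [LHS]/= /lebesgue_step /pushforward /product_measure1.
transitivity (\int[lebesgue_measure]_a \int[borel_lebesgue R k]_y g (rV_cons (a, y))).
  apply: eq_integral => a _ /=.
  rewrite IHk; last exact: measurable_xsection.
  rewrite /product_measure1; apply: eq_integral => y _ /=; congr (borel_lebesgue R d _).
  apply/seteqP; split=> z; rewrite /xsection/= !in_setE /B/= in_setE/=.
    by rewrite -rV_cons_row_mx.
  by rewrite -rV_cons_row_mx.
have mgc : measurable_fun setT (g \o @rV_cons R k).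
  exact: (measurableT_comp mg (@measurable_rV_cons R k)).
rewrite -(@fubini_tonelli1 _ _ _ _ _ lebesgue_measure (borel_lebesgue R k) _ mgc)//.
rewrite -[LHS](ge0_integral_pushforward measurable_rV_cons _ measurableT mg)//.
Qed.

Definition slice k d (A : set 'rV[R]_(k + d)) (y : 'rV[R]_k) : set 'rV[R]_d :=
  [set z | A (row_mx y z)].

Lemma measurable_slice k d (A : set 'rV[R]_(k + d)) y :
  measurable A -> measurable (slice A y).
Proof.
move=> mA; have := @measurable_row_mx k d measurableT _ mA; rewrite setTI.
move=> /(measurable_xsection y); congr measurable.
by apply/seteqP; split=> z; rewrite /xsection/= in_setE.
Qed.

Lemma borel_lebesgue_slice k d (A : set 'rV[R]_(k + d)) : measurable A ->
  measurable_fun setT (fun y => borel_lebesgue R d (slice A y)) /\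
  borel_lebesgue R (k + d) A =
    \int[borel_lebesgue R k]_y borel_lebesgue R d (slice A y).
Proof.
move=> mA; rewrite borel_lebesgue_row_mx//.
have mB := @measurable_row_mx k d measurableT _ mA; rewrite setTI in mB.
have E y : borel_lebesgue R d (slice A y) = borel_lebesgue R d
    (xsection ((fun p : 'rV[R]_k * 'rV[R]_d => row_mx p.1 p.2) @^-1` A) y).
  congr (borel_lebesgue R d _).
  by apply/seteqP; split=> z; rewrite /xsection/= in_setE.
by split; [under eq_fun do rewrite E; exact: measurable_fun_xsection|
  apply: eq_integral => y _; rewrite E].
Qed.

End slices.

(** * Completion of the Borel measure *)

Section completion.
Context {R : realType} {n : nat}.
Implicit Types (A N : set 'rV[R]_n).
Local Open Scope ereal_scope.
Local Notation L := (borel_lebesgue R n).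
Local Notation oL := (outer_lebesgue R n).

Lemma outer_null_subset A N : A `<=` N -> oL N = 0 -> oL A = 0.
Proof.
move=> AN N0; apply/eqP; rewrite eq_le outer_measure_ge0 andbT -N0.
exact: le_outer_measure.
Qed.

Lemma outer_null_bigcup (F : (set 'rV[R]_n)^nat) :
  (forall k, oL (F k) = 0) -> oL (\bigcup_k F k) = 0.
Proof.
move=> F0; apply/eqP; rewrite eq_le outer_measure_ge0 andbT.
apply: (le_trans (outer_measure_sigma_subadditive _ _)).
by rewrite eseries0// => k _ _; exact: F0.
Qed.

Lemma outer_nullU A N : oL A = 0 -> oL N = 0 -> oL (A `|` N) = 0.
Proof.
move=> A0 N0; apply/eqP; rewrite eq_le outer_measure_ge0 andbT.
have <- : oL A + oL N = 0 by rewrite A0 N0 adde0.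
exact: outer_measureU2.
Qed.

(** Intersect countable unions that nearly realize the outer measure. *)
Lemma borel_hull A : oL A < +oo ->
  exists B, [/\ measurable B, A `<=` B & L B = oL A].
Proof.
move=> Afin; have A0 : 0 <= oL A by exact: outer_measure_ge0.
have fin : oL A \is a fin_num by rewrite ge0_fin_numE.
have /choice[B BP] (m : nat) : exists B,
    [/\ measurable B, A `<=` B & L B <= oL A + m.+1%:R^-1%:E].
  have m0 : (0 < m.+1%:R^-1 :> R)%R by rewrite invr_gt0.
  have [_ [F [mF AF] <-] Fm] := lb_ereal_inf_adherent m0 fin.
  exists (\bigcup_k F k); split=> //; first exact: bigcupT_measurable.
  apply: (le_trans _ (ltW Fm)); apply: measure_sigma_subadditive => //.
  exact: bigcupT_measurable.
exists (\bigcap_m B m); have mB : measurable (\bigcap_m B m).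
  by apply: bigcapT_measurable => m; have [] := BP m.
split=> //; first by move=> x Ax m _; have [_ + _] := BP m; exact.
apply/eqP; rewrite eq_le; apply/andP; split; last first.
  rewrite -outer_lebesgueE//; apply: le_outer_measure => x Ax m _.
  by have [_ + _] := BP m; exact.
apply/lee_addgt0Pr => e e0.
have [m _ me] := near_infty_natSinv_lt (PosNum e0).
have [mBm _ Bm] := BP m.
apply: (@le_trans _ _ (L (B m))).
  by apply: le_measure; rewrite ?inE//; exact: bigcap_inf.
by apply: (le_trans Bm); rewrite leeD2l// lee_fin ltW//; exact: (me m (leqnn m)).
Qed.

Lemma borel_null_hull A : oL A = 0 ->
  exists B, [/\ measurable B, A `<=` B & L B = 0].
Proof.
move=> A0; have [|B [mB AB BA]] := @borel_hull A; first by rewrite A0 ltey.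
by exists B; split=> //; rewrite -[RHS]A0 -BA.
Qed.

Lemma borel_measurable_lebesgue A :
  measurable A -> measurable (A : set (lebesgue_rV R n)).
Proof. by move=> mA; apply: sub_caratheodory; exact: sub_sigma_algebra. Qed.

Lemma lebesgue_aeP (P : 'rV[R]_n -> Prop) :
  {ae @lebesgue R n, forall x, P x} <-> oL [set x | ~ P x] = 0.
Proof.
split=> [[A [mA A0 PA]]|P0]; first exact: outer_null_subset PA A0.
have [B [mB PB B0]] := borel_null_hull P0.
exists B; split => //; first exact: borel_measurable_lebesgue.
by rewrite -[RHS]B0; exact: outer_lebesgueE.
Qed.

(** On a piece of finite measure, the difference between a Caratheodory
    measurable set and its Borel hull is a null set. *)
Lemma lebesgue_measurable_borel A : measurable (A : set (lebesgue_rV R n)) ->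
  exists B N, [/\ measurable B, measurable N, L N = 0 &
    forall x, ~ N x -> (A x <-> B x)].
Proof.
move=> mA.
have /sigma_finiteP[Q [QT _ Qfin]] := sigma_finiteT L.
have /choice[B BP] (k : nat) : exists B, [/\ measurable B, A `&` Q k `<=` B &
    oL (B `&` ~` A) = 0].
  have [mQ Qk] := Qfin k.
  have AQfin : oL (A `&` Q k) < +oo.
    apply: (@le_lt_trans _ _ (oL (Q k))); first by apply: le_outer_measure => x [].
    by rewrite (outer_lebesgueE mQ); exact: Qk.
  have [B [mB AB BA]] := borel_hull AQfin.
  exists (B `&` Q k); split=> //; first exact: measurableI.
    by move=> x Ax; split; [exact: AB|case: Ax].
  have := mA (B `&` Q k); rewrite (_ : B `&` Q k `&` A = A `&` Q k); last first.
    apply/seteqP; split=> x; first by case=> -[].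
    by case=> Ax Qx; split=> //; split=> //; exact: AB.
  move=> E; have : oL (A `&` Q k) + oL (B `&` Q k `&` ~` A) <= oL (A `&` Q k) + 0.
    rewrite adde0 -E -BA -outer_lebesgueE//.
    by apply: le_outer_measure => x [].
  rewrite leeD2lE; last by rewrite ge0_fin_numE// outer_measure_ge0.
  by move=> h; apply/eqP; rewrite eq_le h outer_measure_ge0.
have N0 : oL (\bigcup_k (B k `&` ~` A)) = 0.
  by apply: outer_null_bigcup => k; have [] := BP k.
have [N [mN BN NN]] := borel_null_hull N0.
exists (\bigcup_k B k), N; split=> //.
  by apply: bigcupT_measurable => k; have [] := BP k.
move=> x Nx; split=> [Ax|[k _ Bx]].
  have [k _ Qx] : (\bigcup_k Q k) x by rewrite -QT.
  by exists k => //; have [_ + _] := BP k; apply.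
by apply: contrapT => Ax; apply: Nx; apply: BN; exists k.
Qed.

(** A function measurable for the completed measure agrees with a Borel
    function off a Borel null set: it suffices to correct its sublevel sets at
    rational levels. *)
Lemma borel_representative (D : set 'rV[R]_n) (u : 'rV[R]_n -> R) :
  measurable D ->
  measurable_fun (D : set (lebesgue_rV R n)) (u : lebesgue_rV R n -> measurableTypeR R) ->
  exists N, [/\ measurable N, L N = 0 &
    measurable_fun setT ((u \_ (D `\` N)) : 'rV[R]_n -> measurableTypeR R)].
Proof.
move=> mD mu.
have /choice[BN BNP] (q : rat) : exists BN : set 'rV[R]_n * set 'rV[R]_n,
    [/\ measurable BN.1, measurable BN.2, L BN.2 = 0 &
    forall x, ~ BN.2 x -> ((D `&` [set x | (u x < ratr q)%R]) x <-> BN.1 x)].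
  have mq : measurable (D `&` [set x | (u x < ratr q)%R] : set (lebesgue_rV R n)).
    have := mu (borel_measurable_lebesgue mD) _ (measurable_itv `]-oo, ratr q[).
    congr measurable; apply/seteqP; split=> x [Dx] /=; rewrite in_itv/= => ux; split=> //.
  have [B [N [? ? ? ?]]] := lebesgue_measurable_borel mq.
  by exists (B, N).
pose N := \bigcup_q (BN q).2.
have mN : measurable N.
  by apply: countable_bigcupT_measurable => [|q]; [exact: countableP|have [] := BNP q].
have N0 : L N = 0.
  pose F k := if unpickle k is Some q then (BN q).2 else set0.
  rewrite -outer_lebesgueE//.
  apply: (@outer_null_subset _ (\bigcup_k F k)).
    move=> x [q _ qx]; exists (pickle q); first exact: I.
    by rewrite /F pickleK.
  apply: outer_null_bigcup => k; rewrite /F; case: unpickle => [q|]; last exact: outer_measure0.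
  by have [_ mq Lq _] := BNP q; rewrite outer_lebesgueE.
exists N; split=> // _; apply: (measurability _ (RGenInftyO.measurableE R)) => //.
move=> _ [_ [r ->] <-]; rewrite setTI.
have mDN : measurable (D `\` N) by exact: measurableD.
pose E := (D `\` N) `&` \bigcup_(q in [set q : rat | (ratr q < r)%R]) (BN q).1.
have mE : measurable E.
  apply: measurableI => //; rewrite bigcup_mkcond.
  apply: countable_bigcupT_measurable => [|q]; first exact: countableP.
  by case: ifPn => // _; have [] := BNP q.
have EP x : (D `\` N) x -> (E x <-> (u x < r)%R).
  move=> DNx; split=> [[_ [q /= qr Bx]]|ur].
    have [_ _ _ /(_ x)[|_ /(_ Bx)[_ /lt_trans]]] := BNP q; last exact.
    by move=> Nx; apply: DNx.2; exists q.
  split=> //; have [q] := rat_in_itvoo ur.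
  rewrite in_itv/= => /andP[uq qr]; exists q => //.
  have [_ _ _ /(_ x)[|+ _]] := BNP q; last by apply; split=> //; exact: DNx.1.
  by move=> Nx; apply: DNx.2; exists q.
rewrite (_ : _ @^-1` _ = E `|` (if (0 < r)%R then ~` (D `\` N) else set0)).
  by apply: measurableU => //; case: ifP => // _; exact: measurableC.
apply/seteqP; split=> x; rewrite /= in_itv/= /patch.
  case: ifPn => [/set_mem DNx /(EP _ DNx)|]; first by left.
  by rewrite notin_setE => DNx r0; right; rewrite r0.
case=> [Ex|]; first by rewrite mem_set ?(EP _ Ex.1).1//; exact: Ex.1.
by case: ifP => // r0 /= DNx; rewrite memNset.
Qed.

(** The identity map pushes the completed measure forward to the Borel one. *)
Lemma ge0_integral_lebesgue (f : 'rV[R]_n -> \bar R) :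
  measurable_fun setT f -> (forall x, 0 <= f x) ->
  \int[@lebesgue R n]_x f x = \int[L]_x f x.
Proof.
move=> mf f0.
have mid : measurable_fun setT (id : lebesgue_rV R n -> 'rV[R]_n).
  by move=> _ A mA; rewrite setTI; exact: borel_measurable_lebesgue.
rewrite -[LHS](ge0_integral_pushforward mid _ measurableT mf)//.
apply: eq_measure_integral => A mA _.
exact: outer_lebesgueE.
Qed.

Lemma integral_lebesgue (f : 'rV[R]_n -> \bar R) :
  measurable_fun setT f -> \int[@lebesgue R n]_x f x = \int[L]_x f x.
Proof.
move=> mf; rewrite integralE [RHS]integralE; congr (_ - _).
  by apply: ge0_integral_lebesgue => //; exact: measurable_funepos.
by apply: ge0_integral_lebesgue => //; exact: measurable_funeneg.
Qed.

End completion.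

(** * A smooth function with compact support *)

Section flat_functions.
Context {R : realType}.

(** The functions P(1/t) exp(-1/t) for t > 0, extended by 0: this family is
    closed under differentiation. *)
Definition flat (P : {poly R}) (t : R) : R :=
  if 0 < t then P.[t^-1] * expR (- t^-1) else 0.

Definition flat_deriv (P : {poly R}) : {poly R} := 'X^2 * (P - P^`()).

Lemma poly_growth (P : {poly R}) : exists C m, 0 <= C /\
  forall s : R, 1 <= s -> `|P.[s]| <= C * s ^+ m.
Proof.
elim/poly_ind: P => [|p c [C [m [C0 pC]]]].
  by exists 0, 0%N; split=> // s _; rewrite horner0 normr0 mul0r.
exists (C + `|c|), m.+1; split=> [|s s1]; first by rewrite addr_ge0.
have s0 : 0 <= s by apply: le_trans s1.
rewrite hornerMXaddC; apply: le_trans (ler_normD _ _) _.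
rewrite normrM (ger0_norm s0) mulrDl exprSr mulrA lerD ?ler_wpM2r ?pC//.
by rewrite ler_peMr// -exprSr exprn_ege1.
Qed.

Lemma expR_ge_power (m : nat) (s : R) : 0 <= s ->
  s ^+ m <= m.+1%:R ^+ m.+1 * expR s.
Proof.
move=> s0; have sm : 0 <= s / m.+1%:R by rewrite divr_ge0.
have -> : expR s = expR (s / m.+1%:R) ^+ m.+1.
  by rewrite -expRM_natl mulrC divfK// pnatr_eq0.
rewrite -exprMn; apply: (@le_trans _ _ ((1 + s) ^+ m.+1)).
  apply: (@le_trans _ _ ((1 + s) ^+ m)); last by rewrite ler_weXn2l// lerDl.
  by rewrite lerXn2r ?nnegrE ?addr_ge0// lerDr.
rewrite lerXn2r ?nnegrE ?addr_ge0 ?mulr_ge0 ?expR_ge0//.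
apply: (@le_trans _ _ (m.+1%:R * (1 + s / m.+1%:R))).
  by rewrite mulrDr mulr1 mulrC divfK ?pnatr_eq0// lerD2r ler1n.
by rewrite ler_wpM2l// expR_ge1Dx.
Qed.

(** This gives the derivative 0 at the origin. *)
Lemma flat_le_sq (P : {poly R}) : exists C, forall h : R, `|h| < 1 ->
  `|flat P h| <= C * `|h| ^+ 2.
Proof.
have [C [m [C0 PC]]] := poly_growth P.
have [K [K0 PK]] : exists K : R, 0 <= K /\
    forall s, 0 <= s -> s ^+ m.+2 <= K * expR s.
  exists (m.+3%:R ^+ m.+3); split=> [|s s0]; first exact: exprn_ge0.
  exact: expR_ge_power.
exists (C * K) => h h1; rewrite /flat.
case: ltP => [h0|_]; last first.
  rewrite normr0; apply: mulr_ge0; last exact: exprn_ge0.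
  exact: mulr_ge0.
rewrite (gtr0_norm h0) in h1 *.
have s1 : 1 <= h^-1 by rewrite invf_ge1// ltW.
have s0 : 0 <= h^-1 by rewrite invr_ge0 ltW.
rewrite normrM (gtr0_norm (expR_gt0 _)) expRN.
apply: (@le_trans _ _ (C * h^-1 ^+ m / expR h^-1)).
  by rewrite ler_wpM2r ?invr_ge0 ?expR_ge0// PC.
rewrite -!mulrA ler_wpM2l// ler_pdivrMr ?expR_gt0//.
have := PK _ s0.
rewrite -(ler_pM2r (exprn_gt0 2 h0)) [leRHS]mulrAC.
have -> // : h^-1 ^+ m.+2 * h ^+ 2 = h^-1 ^+ m.
by rewrite -addn2 exprD -mulrA -exprMn mulVf ?gt_eqF// expr1n mulr1.
Qed.

Lemma is_derive_flat (P : {poly R}) (t : R) :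
  is_derive t 1 (flat P) (flat (flat_deriv P) t).
Proof.
have [t0|t0|->] := ltgtP t 0.
- apply: (@near_eq_is_derive _ _ _ (cst 0)).
    near=> s; rewrite /flat ltNge; have -> // : s <= 0.
    by apply/ltW; near: s; exact: lt_nbhsl.
  by rewrite /flat ltNge (ltW t0)/=; exact: is_derive_cst.
- apply: (@near_eq_is_derive _ _ _ (fun s : R => P.[s^-1] * expR (- s^-1))).
    by near=> s; rewrite /flat ifT//; near: s; exact: lt_nbhsr.
  have tn0 : t != 0 by rewrite gt_eqF.
  have iV : is_derive t 1 (fun s : R => s^-1) (- t ^- 2).
    apply: is_derive_eq (@is_deriveV R id t 1 1 tn0 (is_derive_id _ _)) _.
    by rewrite /= [LHS]mulr1.
  have iN : is_derive t 1 (fun s : R => - s^-1) (t ^- 2).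
    by apply: is_derive_eq (is_deriveN iV) _; rewrite opprK.
  have i1 := is_derive1_comp (is_derive_poly P t^-1) iV.
  have i2 := @is_derive1_comp R expR (fun s : R => - s^-1) t _ _ (is_derive_expR (- t^-1)) iN.
  apply: is_derive_eq (is_deriveM i1 i2) _.
  rewrite /flat t0 /flat_deriv hornerM hornerXn hornerD hornerN /=.
  by rewrite /GRing.scale/= exprVn; ring.
- rewrite {2}/flat ltxx.
  have [C PC] := flat_le_sq P.
  have C0 : 0 <= `|C| + 1 by rewrite addr_ge0.
  suff cv : h^-1 *: (flat P (h *: 1 + 0) - flat P 0) @[h --> 0^'] --> 0.
    by split; [apply/cvg_ex; exists 0|exact/cvg_lim].
  apply/cvgr0Pnorm_lt => e e0; near=> h.
  have h0 : 0 < `|h| by rewrite normr_gt0; near: h; exact: nbhs_dnbhs_neq.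
  have h1 : `|h| < 1.
    by near: h; exact: dnbhs0_lt.
  have he : `|h| < e / (`|C| + 1).
    by near: h; apply: dnbhs0_lt; rewrite divr_gt0// ltr_wpDl.
  rewrite {2}/flat ltxx subr0 addr0 normrZ normfV [h *: 1]mulr1.
  rewrite ltr_pdivrMl//; apply: le_lt_trans (PC _ h1) _.
  apply: (@le_lt_trans _ _ (`|C| * `|h| ^+ 2)).
    by rewrite ler_wpM2r ?exprn_ge0// ler_norm.
  rewrite expr2 mulrCA ltr_pM2l//.
  move: he; rewrite ltr_pdivlMr ?ltr_wpDl// mulrC; apply: le_lt_trans.
  by rewrite ler_wpM2r// lerDl.
Unshelve. all: by end_near. Qed.

End flat_functions.

Section smooth_expressions.
Context {R : realType} {n : nat}.
Implicit Types f g : 'rV[R]_n -> R.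

(** A class of functions that is stable under directional derivatives, hence
    consists of functions of class C^m for all m. *)
Inductive smooth_expr : ('rV[R]_n -> R) -> Prop :=
| smooth_cst c : smooth_expr (fun=> c)
| smooth_coord i : smooth_expr (fun x => x ord0 i)
| smooth_add f g : smooth_expr f -> smooth_expr g -> smooth_expr (fun x => f x + g x)
| smooth_mul f g : smooth_expr f -> smooth_expr g -> smooth_expr (fun x => f x * g x)
| smooth_flat P f : smooth_expr f -> smooth_expr (fun x => flat P (f x)).

Lemma derive_coord (i : 'I_n) (x v : 'rV[R]_n) :
  'D_v (fun y : 'rV[R]_n => y ord0 i : R^o) x = v ord0 i.
Proof.
apply/cvg_lim => //; apply: (cvg_trans _ (@cvg_cst _ (v ord0 i) _ (0^') _)).
apply: near_eq_cvg; near=> h.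
have h0 : h != 0 by near: h; exact: nbhs_dnbhs_neq.
by rewrite /= !mxE addrK /GRing.scale/= mulKf.
Unshelve. all: by end_near. Qed.

Lemma smooth_expr_diff f : smooth_expr f -> forall x, differentiable (f : _ -> R^o) x.
Proof.
elim=> [c|i|{}f g _ df _ dg|{}f g _ df _ dg|P {}f _ df] x.
- exact: differentiable_cst.
- exact: differentiable_coord.
- exact: (@differentiableD _ _ _ (f : _ -> R^o) g).
- exact: (@differentiableM _ _ f g).
- apply: (@differentiable_comp _ _ _ _ (f : _ -> R^o) (flat P : R^o -> R^o)) => //.
  by apply/derivable1_diffP; have [] := @is_derive_flat R P (f x).
Qed.

Lemma smooth_expr_derive f v : smooth_expr f -> smooth_expr ('D_v (f : _ -> R^o)).
Proof.
elim=> [c|i|{}f g sf df sg dg|{}f g sf df sg dg|P {}f sf df].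
- rewrite (_ : 'D_v _ = fun=> 0); first exact: smooth_cst.
  by apply/funext => x; exact: derive_cst.
- rewrite (_ : 'D_v _ = fun=> v ord0 i); first exact: smooth_cst.
  by apply/funext => x; exact: derive_coord.
- rewrite (_ : 'D_v _ = fun x => 'D_v (f : _ -> R^o) x + 'D_v (g : _ -> R^o) x).
    exact: smooth_add.
  by apply/funext => x; apply: (@deriveD _ _ _ (f : _ -> R^o) g);
    exact/diff_derivable/smooth_expr_diff.
- rewrite (_ : 'D_v _ = fun x => f x * 'D_v (g : _ -> R^o) x + g x * 'D_v (f : _ -> R^o) x).
    by apply: smooth_add; apply: smooth_mul.
  by apply/funext => x; apply: (@deriveM _ _ (f : _ -> R^o) g);
    exact/diff_derivable/smooth_expr_diff.
- rewrite (_ : 'D_v _ = fun x => flat (flat_deriv P) (f x) * 'D_v (f : _ -> R^o) x).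
    by apply: smooth_mul => //; exact: smooth_flat.
  apply/funext => x.
  have dF : differentiable (flat P : R^o -> R^o) (f x).
    by apply/derivable1_diffP; have [] := @is_derive_flat R P (f x).
  have df' := smooth_expr_diff sf x.
  rewrite deriveE; last exact: (@differentiable_comp _ _ _ _ (f : _ -> R^o) (flat P : R^o -> R^o)).
  rewrite (@diff_comp _ _ _ _ (f : _ -> R^o) (flat P : R^o -> R^o))//=.
  rewrite deriveE// mulrC -[X in 'd _ _ X]mulr1 [LHS]linearZ /=.
  congr (_ * _); rewrite -deriveE//.
  by have [_ ->] := @is_derive_flat R P (f x).
Qed.

Lemma smooth_expr_Cn f m U : smooth_expr f -> Cn m U (f : _ -> R^o).
Proof.
elim: m f => [|m IH] f sf /=.
  by move=> x _; apply: differentiable_continuous; exact: smooth_expr_diff.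
split=> [x _|v]; first exact: smooth_expr_diff.
by apply: IH; exact: smooth_expr_derive.
Qed.

Lemma smooth_expr_continuous f : smooth_expr f -> continuous f.
Proof.
by move=> sf x; exact: (differentiable_continuous (smooth_expr_diff sf x)).
Qed.

Lemma smooth_expr_sum (I : finType) (F : I -> 'rV[R]_n -> R) :
  (forall i, smooth_expr (F i)) -> smooth_expr (fun x => \sum_i F i x).
Proof.
move=> sF; rewrite /index_enum; elim: (Finite.enum _) => [|i s IH].
  under eq_fun do rewrite big_nil; exact: smooth_cst.
by under eq_fun do rewrite big_cons; exact: smooth_add.
Qed.

Lemma smooth_expr_shift f c : smooth_expr f -> smooth_expr (fun x => f (x - c)).
Proof.
elim=> [a|i|{}f g _ sf _ sg|{}f g _ sf _ sg|P {}f _ sf].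
- exact: smooth_cst.
- under eq_fun do rewrite !mxE.
  by apply: smooth_add; [exact: smooth_coord|exact: smooth_cst].
- exact: smooth_add.
- exact: smooth_mul.
- exact: smooth_flat.
Qed.

Lemma derive_shift f c v x :
  'D_v (fun y => f (y - c) : R^o) x = 'D_v (f : _ -> R^o) (x - c).
Proof.
rewrite /derive; set F := (X in lim (X @ _)); set G := (X in _ = lim (X @ _)).
by have -> : F = G by apply/funext => h; rewrite /F /G /= addrA.
Qed.

(** The bump of radius rho: smooth, positive in the Euclidean ball of radius
    rho about 0 and zero outside. *)
Definition bump (rho : R) (x : 'rV[R]_n) : R := flat 1 (rho ^+ 2 - dot x x).

Lemma smooth_bump rho : smooth_expr (bump rho).
Proof.
apply: smooth_flat.
rewrite (_ : (fun _ => _) = (fun x : 'rV[R]_n => rho ^+ 2 + -1 * dot x x)).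
  apply: smooth_add; first exact: smooth_cst.
  apply: smooth_mul; first exact: smooth_cst.
  by apply: smooth_expr_sum => i; apply: smooth_mul; exact: smooth_coord.
by apply/funext => x; rewrite mulN1r.
Qed.

Lemma bump_ge0 rho x : 0 <= bump rho x.
Proof. by rewrite /bump /flat hornerC mul1r; case: ifP => // _; exact: expR_ge0. Qed.

Lemma bump_gt0 rho x : dot x x < rho ^+ 2 -> 0 < bump rho x.
Proof. by move=> xr; rewrite /bump /flat hornerC mul1r subr_gt0 xr expR_gt0. Qed.

Lemma bump_support rho x : 0 < rho -> bump rho x != 0 -> `|x| <= rho.
Proof.
move=> rho0; rewrite /bump /flat subr_gt0; case: ifPn => [xr _|_]; last by rewrite eqxx.
apply: rV_norm_le => [|i]; first exact: ltW.
have r0 := ltW rho0; rewrite -(@ler_pXn2r _ 2)// ?nnegrE// real_normK ?num_real//.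
apply: (@le_trans _ _ (dot x x)); last exact: ltW.
 rewrite /dot (bigD1 i)//= -expr2 lerDl.
by apply: sumr_ge0 => j _; rewrite -expr2 sqr_ge0.
Qed.

Lemma derive_support f rho v x : (forall y, f y != 0 -> `|y| <= rho) ->
  rho < `|x| -> 'D_v (f : _ -> R^o) x = 0.
Proof.
move=> sf rx; have -> : 'D_v (f : _ -> R^o) x = 'D_v (cst (0 : R^o)) x; last first.
  exact: derive_cst.
apply: near_eq_derive; near=> y; apply/eqP; apply: contraT => /sf.
rewrite leNgt => /negP[]; near: y.
by apply: (cvgr_gt `|x|); [exact: norm_continuous|].
Unshelve. all: by end_near. Qed.

Lemma closed_cube (c : 'rV[R]_n) (r : R) : closed (cube c r).
Proof.
have -> : cube c r = closed_ball_ (fun x : 'rV[R]_n => `|x|) c r.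
  by apply/seteqP; split=> x; rewrite /cube/closed_ball_/= distrC.
exact: closed_closed_ball_.
Qed.

Lemma compact_cube (c : 'rV[R]_n) (r : R) : compact (cube c r).
Proof.
apply: bounded_closed_compact; last exact: closed_cube.
exists (r + `|c|); split; first exact: num_real.
move=> M rM x xc; apply: le_trans (ltW rM).
by rewrite -[x](subrK c); apply: le_trans (ler_normD _ _) _; rewrite lerD2r.
Qed.

Lemma test_function_shift Omega f c rho : smooth_expr f ->
  (forall y, f y != 0 -> `|y| <= rho) -> cube c rho `<=` Omega ->
  test_function Omega (fun x => f (x - c)).
Proof.
move=> sf fr cO.
have cl : closure [set x | f (x - c) != 0] `<=` cube c rho.
  rewrite [X in _ `<=` X]((closure_id _).1 (@closed_cube c rho)).
  by apply: closure_subset => x; exact: fr.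
split=> [m| |].
- by apply: smooth_expr_Cn; exact: smooth_expr_shift.
- apply: (subclosed_compact _ (@compact_cube c rho)) => //; exact: closed_closure.
- exact: subset_trans cl cO.
Qed.

End smooth_expressions.

(** * Continuity of translations in the mean *)

Section norm1.
Context d (T : measurableType d) {R : realType} (mu : {measure set T -> \bar R}).
Local Open Scope ereal_scope.

Implicit Types f g : T -> R.

Definition norm1 f : \bar R := \int[mu]_x `|f x|%:E.

Lemma norm1_ge0 f : 0 <= norm1 f.
Proof. by apply: integral_ge0 => x _; rewrite lee_fin. Qed.

Lemma measurable_abs_EFin D f : measurable_fun D f ->
  measurable_fun D (fun x => `|f x|%:E).
Proof. by move=> mf; apply/measurable_EFinP; exact: measurableT_comp. Qed.

Lemma ge0_integralS_le (D : set T) (f g : T -> \bar R) : measurable D ->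
  measurable_fun setT f -> measurable_fun setT g -> (forall x, 0 <= f x) ->
  (forall x, 0 <= g x) -> (forall x, D x -> f x <= g x) ->
  \int[mu]_(x in D) f x <= \int[mu]_x g x.
Proof.
move=> mD mf mg f0 g0 fg.
apply: (@le_trans _ _ (\int[mu]_(x in D) g x)).
  apply: ge0_le_integral => //; exact: measurable_funTS.
by apply: ge0_subset_integral => //.
Qed.

Lemma norm1_le f g : measurable_fun setT f -> measurable_fun setT g ->
  (forall x, (`|f x| <= `|g x|)%R) -> norm1 f <= norm1 g.
Proof.
move=> mf mg fg; apply: ge0_le_integral => //.
- exact: measurable_abs_EFin.
- exact: measurable_abs_EFin.
- by move=> x _; rewrite lee_fin.
Qed.

Lemma norm1D f g : measurable_fun setT f -> measurable_fun setT g ->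
  norm1 (fun x => f x + g x)%R <= norm1 f + norm1 g.
Proof.
move=> mf mg; rewrite /norm1 -ge0_integralD//; [|exact: measurable_abs_EFin..].
apply: ge0_le_integral => //.
- by apply: measurable_abs_EFin; exact: measurable_funD.
- by apply: emeasurable_funD; exact: measurable_abs_EFin.
- by move=> x _; rewrite -EFinD lee_fin ler_normD.
Qed.

Lemma norm1Z k f : measurable_fun setT f ->
  norm1 (fun x => k * f x)%R = `|k|%:E * norm1 f.
Proof.
move=> mf; rewrite /norm1 -ge0_integralZl_EFin//; last exact: measurable_abs_EFin.
by apply: eq_integral => x _; rewrite normrM EFinM.
Qed.

Lemma norm1_indic A : measurable A -> norm1 \1_A = mu A.
Proof.
move=> mA; transitivity (\int[mu]_x (\1_A x)%:E).
  by apply: eq_integral => x _; rewrite ger0_norm.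
by rewrite integral_indic// setIT.
Qed.

Lemma norm1_sum (I : finType) (F : I -> T -> R) :
  (forall i, measurable_fun setT (F i)) ->
  norm1 (fun x => \sum_i F i x)%R <= \sum_i norm1 (F i).
Proof.
move=> mF; rewrite /index_enum; elim: (Finite.enum _) => [|i s IH].
  rewrite big_nil (_ : (fun _ => _) = cst 0%R); last first.
    by apply/funext => x; rewrite big_nil.
  by rewrite /norm1; under eq_integral do rewrite normr0; rewrite integral0.
rewrite big_cons; apply: (le_trans _ (leeD2l _ IH)).
rewrite (_ : (fun x => \sum_(j <- _) F j x)%R =
  (fun x => F i x + (fun x => \sum_(j <- s) F j x) x)%R); last first.
  by apply/funext => x; rewrite big_cons.
by apply: norm1D => //; exact: measurable_sum.
Qed.

End norm1.

Section translation_continuity.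
Context {R : realType} {n : nat}.
Hypothesis n0 : (0 < n)%N.
Local Notation L := (borel_lebesgue R n).
Local Notation N1 := (norm1 L).
Implicit Types (f g : 'rV[R]_n -> R) (A E : set 'rV[R]_n).
Local Open Scope ereal_scope.

Lemma measurable_fun_shift d (T : measurableType d) (f : 'rV[R]_n -> T) (h : 'rV[R]_n) :
  measurable_fun setT f -> measurable_fun setT (fun x : 'rV[R]_n => f (x + h)%R).
Proof. by move=> mf; exact: (measurableT_comp mf (measurable_shift h)). Qed.

Lemma norm1_shift f (h : 'rV[R]_n) : measurable_fun setT (f : _ -> measurableTypeR R) ->
  N1 (fun x : 'rV[R]_n => f (x + h)%R) = N1 f.
Proof.
move=> mf; rewrite /norm1 -[RHS](ge0_integral_shift n0 h)//.
exact: measurable_abs_EFin.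
Qed.

Lemma cvg_ereal_lt (u : nat -> \bar R) (l b : \bar R) :
  u @ \oo --> l -> l < b -> exists m, u m < b.
Proof.
move=> cu lb; apply: contrapT => h; move: lb; rewrite ltNge => /negP[].
rewrite -(cvg_lim _ cu)//; apply: lime_ge; first by apply/cvg_ex; exists l.
by apply: nearW => m; rewrite leNgt; apply/negP => ?; apply: h; exists m.
Qed.

Lemma open_box_above (p : 'rV[R]_n * 'rV[R]_n) (e : R) : (0 < e)%R ->
  exists U, [/\ open U, box p `<=` U & L U <= (vol p)%:E + e%:E].
Proof.
move=> e0.
pose U (m : nat) : set 'rV[R]_n :=
  [set x : 'rV[R]_n | forall i, x ord0 i \in `]p.1 ord0 i, (p.2 ord0 i + m.+1%:R^-1)%R[].
have mU m : measurable (U m).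
  by apply: measurable_forall_ord => i; exact: measurable_coord_itv.
have oU m : open (U m).
  rewrite openE => x Ux; exists (fun _ i => `]p.1 ord0 i, (p.2 ord0 i + m.+1%:R^-1)%R[%classic).
    by move=> i j; apply: open_nbhs_nbhs; split; [exact: interval_open|rewrite (ord1 i); exact: (Ux j)].
  by move=> y Uy i; exact: Uy.
have UE : \bigcap_m U m = box p.
  apply/seteqP; split=> [x Ux i|x px m _ i]; last first.
    rewrite in_itv/=; have /andP[-> xi] := px i.
    by rewrite (le_lt_trans xi)// ltrDl invr_gt0.
  apply/andP; split.
    by have := Ux 0%N I i; rewrite in_itv/= => /andP[].
  apply/ler_addgt0Pr => d d0; have [m _ md] := near_infty_natSinv_lt (PosNum d0).
  have := Ux m I i; rewrite in_itv/= => /andP[_ /ltW xi].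
  by apply: (le_trans xi); rewrite lerD2l ltW//; exact: (md m (leqnn m)).
have U0fin : L (U 0%N) < +oo.
  apply: (@le_lt_trans _ _ (vol (p.1, p.2 + const_mx 1)%R)%:E); last by rewrite ltry.
  rewrite -borel_lebesgue_box; apply: le_measure; rewrite ?inE//; first exact: measurable_box.
  by move=> x Ux i /=; have := Ux i; rewrite in_itv/= !mxE invr1 => /andP[-> /ltW ->].
have cvg : L \o U @ \oo --> L (box p).
  rewrite -UE; apply: nonincreasing_cvg_mu => //; first by rewrite UE; exact: measurable_box.
  move=> a b ab; apply/subsetPset => x Ux i; have := Ux i.
  rewrite !in_itv/= => /andP[-> xi] /=; apply: (lt_le_trans xi).
  by rewrite lerD2l lef_pV2 ?posrE// ler_nat ltnS.
have : L (box p) < (vol p)%:E + e%:E.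
  by rewrite borel_lebesgue_box -EFinD lte_fin ltrDl.
move=> /(cvg_ereal_lt cvg)[m me].
exists (U m); split=> //; first by rewrite -UE => x; exact.
exact: ltW me.
Qed.

(** Outer regularity: cover by boxes and thicken each of them. *)
Lemma open_hull A (e : R) : measurable A -> L A < +oo -> (0 < e)%R ->
  exists E, [/\ open E, A `<=` E & L E <= L A + e%:E].
Proof.
move=> mA Afin e0.
have e20 : (0 < e / 2)%R by rewrite divr_gt0.
have : box_outer A < L A + (e / 2)%:E.
  by rewrite -outer_lebesgue_boxE// outer_lebesgueE// lteDl ?ge0_fin_numE// lte_fin.
move=> /ereal_inf_lt[_ [F [mF AF] <-]] Fe.
have hfin k : box_hull (F k) \is a fin_num.
  rewrite ge0_fin_numE ?box_hull_ge0//; apply: (le_lt_trans _ (lt_le_trans Fe (leey _))).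
  apply: le_trans (nneseries_lim_ge k.+1 _); last by move=> *; exact: box_hull_ge0.
  by rewrite big_nat_recr//= leeDr// sume_ge0// => *; exact: box_hull_ge0.
have /choice[E EP] k : exists E, [/\ open E, F k `<=` E &
    L E <= box_hull (F k) + (e / 2 / (2 ^ k.+1)%:R)%:E].
  have dk : (0 < e / 2 / (2 ^ k.+1)%:R / 2)%R.
    by rewrite !divr_gt0// ltr0n expn_gt0.
  have [_ [p Fp <-] plt] := lb_ereal_inf_adherent dk (hfin k).
  have [U [oU pU LU]] := open_box_above p dk.
  exists U; split=> //; first exact: subset_trans pU.
  apply: (le_trans LU); apply: (le_trans (leeD2r _ (ltW plt))).
  by rewrite -addeA -EFinD -splitr.
have oE : open (\bigcup_k E k) by apply: bigcup_open => k _; have [] := EP k.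
exists (\bigcup_k E k); split=> //.
  by move=> x /AF[k _ Fx]; exists k => //; have [_ + _] := EP k; exact.
apply: (@le_trans _ _ (\sum_(k <oo) L (E k))).
  apply: measure_sigma_subadditive => // [k|]; last exact: open_measurable_rV.
  by have [? _ _] := EP k; exact: open_measurable_rV.
apply: (@le_trans _ _ (\sum_(k <oo) (box_hull (F k) + (e / 2 / (2 ^ k.+1)%:R)%:E))).
  by apply: lee_nneseries => // k _; have [] := EP k.
apply: le_trans (epsilon_trick _ _ (ltW e20)) _; first by move=> k; exact: box_hull_ge0.
by apply: (le_trans (leeD2r _ (ltW Fe))); rewrite -addeA -EFinD -splitr.
Qed.

Definition transl_cont f := forall e : R, (0 < e)%R ->
  exists2 d : R, (0 < d)%R & forall h : 'rV[R]_n, (`|h| < d)%R -> N1 (fun x : 'rV[R]_n => f (x + h) - f x)%R <= e%:E.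

Lemma measurable_transl f (h : 'rV[R]_n) : measurable_fun setT f ->
  measurable_fun setT (fun x : 'rV[R]_n => f (x + h) - f x)%R.
Proof. by move=> mf; apply: measurable_funB => //; exact: measurable_fun_shift. Qed.

(** Away from the boundary of an open set [E] small translations do not leave
    [E], and what they bring into [E] has the measure of what they take out. *)
Lemma transl_cont_open E : open E -> L E < +oo -> transl_cont \1_E.
Proof.
move=> oE Efin e e0; have mE := open_measurable_rV oE.
pose I (m : nat) : set 'rV[R]_n := [set x | exists2 y, ~ E y & (`|y - x| < m.+1%:R^-1)%R].
have oI m : open (I m).
  rewrite (_ : I m = \bigcup_(y in ~` E) ball y m.+1%:R^-1).
    by apply: bigcup_open => y _; exact: ball_open.
  apply/seteqP; split=> [x [y Ey xy]|x [y Ey]]; first by exists y => //; rewrite rV_ballE.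
  by rewrite rV_ballE => xy; exists y.
have mEI m : measurable (E `&` I m).
  by apply: measurableI => //; exact: open_measurable_rV.
have cvg : (fun m => L (E `&` I m)) @ \oo --> L set0.
  rewrite (_ : set0 = \bigcap_m (E `&` I m)).
    apply: nonincreasing_cvg_mu => //.
    - by apply: le_lt_trans Efin; apply: le_measure; rewrite ?inE.
    - exact: bigcapT_measurable.
    - move=> a b ab; apply/subsetPset => x [Ex [y Ey xy]]; split=> //; exists y => //.
      by apply: (lt_le_trans xy); rewrite lef_pV2 ?posrE// ler_nat ltnS.
  apply/esym/seteqP; split=> // x Ix; have [Ex _] := Ix 0%N Logic.I.
  have /nbhs_ballP[d /= d0 dE] := open_nbhs_nbhs (conj oE Ex).
  have [m _ md] := near_infty_natSinv_lt (PosNum d0).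
  have [_ [y Ey xy]] := Ix m Logic.I; apply: Ey; apply: dE; rewrite rV_ballE/= distrC.
  by apply: (lt_trans xy); exact: (md m (leqnn m)).
rewrite measure0 in cvg.
have e20 : 0 < (e / 2)%:E by rewrite lte_fin divr_gt0.
have [m me] := cvg_ereal_lt cvg e20.
exists m.+1%:R^-1%R => [|h hm]; first by rewrite invr_gt0.
pose Eh : set 'rV[R]_n := [set x | E (x + h)%R].
have mEh : measurable Eh by have := measurable_shift h measurableT mE; rewrite setTI.
have LEh : L Eh = L E by exact: borel_lebesgue_shift.
have out : L (E `\` Eh) <= (e / 2)%:E.
  apply: le_trans (ltW me); apply: le_measure; rewrite ?inE//.
    exact: measurableD.
  move=> x [Ex Ehx]; split=> //; exists (x + h)%R => //.
  by rewrite addrAC subrr add0r.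
have inn : L (Eh `\` E) = L (E `\` Eh).
  rewrite !measureD//; last by apply: (le_lt_trans _ Efin); rewrite -LEh.
  by rewrite [LHS](_ : _ = L E - L (E `&` Eh)) // [X in X - _]LEh setIC.
apply: (@le_trans _ _ (L (E `\` Eh) + L (Eh `\` E))); last first.
  by rewrite inn [e]splitr EFinD leeD.
rewrite -!(norm1_indic L); [|exact: measurableD..].
have mEEh : measurable_fun setT (\1_(E `\` Eh) : _ -> R).
  by apply: measurable_indic; exact: measurableD.
have mEhE : measurable_fun setT (\1_(Eh `\` E) : _ -> R).
  by apply: measurable_indic; exact: measurableD.
apply: le_trans (norm1D _ mEEh mEhE).
apply: norm1_le.
- by apply: measurable_transl; exact: measurable_indic.
- exact: measurable_funD.
move=> x; rewrite !indicE.
rewrite (_ : (x + h \in E)%R = (x \in Eh)); last by apply/idP/idP; rewrite !inE.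
rewrite !in_setD; case: (x \in E); case: (x \in Eh) => /=; rewrite ?addr0 ?add0r ?subrr ?subr0 ?sub0r ?normrN ?normr1 ?normr0//.
Qed.

Lemma transl_cont_approx f : measurable_fun setT f ->
  (forall e : R, (0 < e)%R -> exists g, [/\ measurable_fun setT g, transl_cont g &
    N1 (fun x => f x - g x)%R <= e%:E]) -> transl_cont f.
Proof.
move=> mf fg e e0; have e30 : (0 < e / 3)%R by rewrite divr_gt0.
have [g [mg cg Ng]] := fg _ e30; have [d d0 dg] := cg _ e30.
have mfg : measurable_fun setT (fun x => f x - g x)%R by exact: measurable_funB.
exists d => // h /dg gh.
have mfgh := measurable_fun_shift h mfg.
have mgf : measurable_fun setT (fun x => -1 * (f x - g x))%R.
  by apply: measurable_funM => //; exact: measurable_cst.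
have mgt := measurable_transl h mg.
rewrite (_ : (fun x => f (x + h) - f x)%R = (fun x => (f (x + h) - g (x + h)) +
    ((g (x + h) - g x) + -1 * (f x - g x)))%R); last first.
  by apply/funext => x; ring.
apply: le_trans (norm1D _ mfgh (measurable_funD mgt mgf)) _.
apply: (le_trans (leeD2l _ (norm1D _ mgt mgf))).
rewrite (norm1_shift _ mfg) norm1Z// normrN normr1 mul1e.
have -> : e%:E = (e / 3)%:E + ((e / 3)%:E + (e / 3)%:E) by rewrite -!EFinD; congr EFin; field.
by apply: leeD => //; exact: leeD.
Qed.

Lemma transl_contD f g : measurable_fun setT f -> measurable_fun setT g ->
  transl_cont f -> transl_cont g -> transl_cont (fun x => f x + g x)%R.
Proof.
move=> mf mg cf cg e e0; have e20 : (0 < e / 2)%R by rewrite divr_gt0.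
have [a a0 fa] := cf _ e20; have [b b0 gb] := cg _ e20.
exists (Num.min a b) => [|h]; first by rewrite lt_min a0.
rewrite lt_min => /andP[/fa fh /gb gh].
rewrite (_ : (fun _ => _) = (fun x => (f (x + h) - f x) + (g (x + h) - g x))%R); last first.
  by apply/funext => x; ring.
apply: le_trans (norm1D _ (measurable_transl h mf) (measurable_transl h mg)) _.
by rewrite [e]splitr EFinD leeD.
Qed.

Lemma transl_contZ k f : measurable_fun setT f -> transl_cont f ->
  transl_cont (fun x => k * f x)%R.
Proof.
move=> mf cf e e0; have k0 : (0 < `|k| + 1)%R by rewrite ltr_wpDl.
have [d d0 fd] := cf _ (divr_gt0 e0 k0).
exists d => // h /fd fh.
rewrite (_ : (fun _ => _) = (fun x => k * (f (x + h) - f x))%R); last first.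
  by apply/funext => x; ring.
rewrite (norm1Z _ _ (measurable_transl h mf)).
apply: le_trans (lee_wpmul2l _ fh) _ => //.
rewrite -EFinM lee_fin mulrA ler_pdivrMr// mulrC ler_wpM2l ?(ltW e0)//.
by rewrite lerDl.
Qed.

Lemma transl_cont0 : transl_cont (fun=> 0%R).
Proof.
move=> e e0; exists 1%R => // h _; rewrite /norm1.
by under eq_integral do rewrite subrr normr0; rewrite integral0 lee_fin ltW.
Qed.

Lemma transl_cont_indic A : measurable A -> L A < +oo -> transl_cont \1_A.
Proof.
move=> mA Afin; apply: transl_cont_approx => [|e e0]; first exact: measurable_indic.
have [E [oE AE LE]] := open_hull mA Afin e0.
have mE := open_measurable_rV oE.
have Efin : L E < +oo by apply: le_lt_trans LE _; rewrite lte_add_pinfty// ltry.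
exists \1_E; split; [exact: measurable_indic|exact: transl_cont_open|].
apply: (@le_trans _ _ (L (E `\` A))).
  have mEA : measurable (E `\` A) by exact: measurableD.
  rewrite -(norm1_indic L mEA); apply: norm1_le.
  - by apply: measurable_funB; exact: measurable_indic.
  - exact: measurable_indic.
  move=> x; rewrite !indicE in_setD.
  have [xA|xA] := boolP (x \in A).
    by rewrite (mem_set (AE _ (set_mem xA))) /= subrr normr0.
  by rewrite sub0r normrN; case: (x \in E); rewrite /= ?normr1 ?normr0.
rewrite measureD//.
by rewrite (setIidr AE) leeBlDl// ge0_fin_numE.
Qed.

Import HBSimple.

(** Indicators of open sets are continuous in the mean, hence by outer regularity
    those of sets of finite measure, hence simple functions, which are dense. *)
Lemma transl_cont_L1 f : measurable_fun setT f -> N1 f < +oo -> transl_cont f.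
Proof.
move=> mf Nf; apply: transl_cont_approx => // e e0.
have intf : (L : {measure set _ -> \bar R}).-integrable setT (EFin \o f).
  apply/integrableP; split; first exact/measurable_EFinP.
  exact: Nf.
have [g [intg _ cg]] := approximation_sfun_integrable measurableT intf.
have /cvg_ereal_lt := cg => /(_ e%:E)[|k]; first by rewrite lte_fin.
set G := g k => /ltW Ge; exists G; split=> //.
have mG : measurable_fun setT G by [].
have NG : N1 G < +oo.
  by have /integrableP[_] := intg k.
have -> : (G : _ -> R) = (fun x => \sum_(y <- finmap.enum_fset (fset_set (range G))) y * \1_(G @^-1` [set y]) x)%R.
  by apply/funext => x; rewrite {1}fimfunE fsbig_finite.
elim: (finmap.enum_fset (fset_set (range G))) => [|y s IH].
  by under eq_fun do rewrite big_nil; exact: transl_cont0.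
under eq_fun do rewrite big_cons.
have mGz z : measurable (G @^-1` [set z]) by exact: measurable_sfunP.
have mGy := mGz y.
apply: transl_contD => //.
- by apply: measurable_funM => //; exact: measurable_indic.
- apply: measurable_sum => z; apply: measurable_funM => //; exact: measurable_indic.
have [->|y0] := eqVneq y 0%R.
  by under eq_fun do rewrite mul0r; exact: transl_cont0.
apply: transl_contZ; first exact: measurable_indic.
apply: transl_cont_indic => //.
have ynorm : (0 < `|y|)%R by rewrite normr_gt0.
have : `|y|%:E * L (G @^-1` [set y]) <= N1 G.
  rewrite -(norm1_indic L mGy) -norm1Z; last exact: measurable_indic.
  apply: norm1_le => //.
    by apply: measurable_funM => //; exact: measurable_indic.
  move=> x; rewrite indicE; have [/set_mem/= ->|_] := boolP (x \in _).
    by rewrite mulr1.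
  by rewrite mulr0 normr0.
move=> /le_lt_trans/(_ NG); rewrite !ltey; apply: contra => /eqP ->.
by rewrite gt0_muley// lte_fin.
Qed.

End translation_continuity.

(** * Mollification *)

Section mollifier.
Context {R : realType} {n : nat}.
Hypothesis n0 : (0 < n)%N.
Local Notation L := (borel_lebesgue R n).
Local Notation N1 := (norm1 L).
Implicit Types (f g phi : 'rV[R]_n -> R) (x v : 'rV[R]_n).

Definition small_support (rho : R) phi := forall y, phi y != 0 -> `|y| <= rho.

Lemma small_supportP rho phi y : small_support rho phi -> rho < `|y| -> phi y = 0.
Proof.
by move=> sphi ry; apply/eqP; apply: contraTT ry => /sphi; rewrite -leNgt.
Qed.

Lemma small_support_derive rho phi v : small_support rho phi ->
  small_support rho ('D_v (phi : _ -> R^o)).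
Proof.
move=> sphi y; apply: contraNT; rewrite -ltNge => ry.
by apply/eqP; exact: derive_support sphi ry.
Qed.

(** A continuous function on the compact cube of half-side [rho]. *)
Lemma smooth_bounded rho phi : smooth_expr phi -> small_support rho phi ->
  exists2 C, 0 <= C & forall x, `|phi x| <= C.
Proof.
move=> sphi supp.
have : bounded_set (phi @` cube 0 rho).
  apply: compact_bounded; apply: continuous_compact; last exact: compact_cube.
  by apply: continuous_subspaceT; exact: smooth_expr_continuous.
move=> [M [_ /(_ (`|M| + 1))]] bM; exists (`|M| + 1); first exact: addr_ge0.
move=> x; have [xr|xr] := leP `|x| rho; last first.
  by rewrite (small_supportP supp xr) normr0 addr_ge0.
apply: bM; first by rewrite (le_lt_trans (ler_norm _))// ltrDl.
by exists x => //; rewrite /cube/= subr0.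
Qed.

Lemma measurable_smooth phi : smooth_expr phi -> measurable_fun setT phi.
Proof.
move=> sphi; apply: continuous_measurable_rV_real => [|x _]; first exact: openT.
exact: smooth_expr_continuous.
Qed.

Lemma norm1_integrable f : measurable_fun setT f -> (N1 f < +oo)%E ->
  L.-integrable setT (EFin \o f).
Proof. by move=> mf Nf; apply/integrableP; split; [exact/measurable_EFinP|exact: Nf]. Qed.

Lemma integrable_mul_bounded f phi C : measurable_fun setT f -> (N1 f < +oo)%E ->
  measurable_fun setT phi -> (forall x, `|phi x| <= C) ->
  L.-integrable setT (EFin \o (fun x => f x * phi x)).
Proof.
move=> mf Nf mphi phiC.
apply: (@le_integrable _ _ _ L setT _ _ (EFin \o (fun x => C * f x))) => //.
- by apply/measurable_EFinP; exact: measurable_funM.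
- move=> x _ /=; rewrite lee_fin !normrM mulrC ler_wpM2r//.
  by apply: le_trans (phiC x) _; exact: ler_norm.
exact: (integrableZl measurableT C (norm1_integrable mf Nf)).
Qed.

Lemma integral_shift (F : 'rV[R]_n -> \bar R) x : measurable_fun setT F ->
  (\int[L]_z F (z + x)%R = \int[L]_z F z)%E.
Proof.
move=> mF; rewrite -[X in integral _ _ X]/(F \o (fun z => z + x)).
rewrite integralE [RHS]integralE funepos_comp funeneg_comp; congr (_ - _)%E.
  exact: (ge0_integral_shift n0 x (measurable_funepos mF) (funepos_ge0 F)).
exact: (ge0_integral_shift n0 x (measurable_funeneg mF) (funeneg_ge0 F)).
Qed.

(** The mollification of [f] by [phi]; [phi] is reflected so that translations
    suffice in the change of variables. *)
Definition conv phi f x : R := \int[L]_z (f z * phi (z - x)).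

Lemma measurable_conv_integrand phi f x :
  measurable_fun setT phi -> measurable_fun setT f ->
  measurable_fun setT (fun z : 'rV[R]_n => f z * phi (z - x)).
Proof. by move=> mphi mf; apply: measurable_funM => //; exact: measurable_fun_shift. Qed.

Lemma line_derive phi (c v : 'rV[R]_n) (s : R) : differentiable (phi : _ -> R^o) (c - s *: v) ->
  is_derive s 1 (fun t : R => phi (c - t *: v) : R^o) ('D_(- v) (phi : _ -> R^o) (c - s *: v)).
Proof.
move=> dphi.
have E : (fun h : R => h^-1 *: (phi (c - (h *: 1 + s) *: v) - phi (c - s *: v) : R^o)) =
    (fun h : R => h^-1 *: (phi (h *: (- v) + (c - s *: v)) - phi (c - s *: v) : R^o)).
  apply/funext => h; congr (_ *: (phi _ - _)).
  by rewrite [h *: 1]mulr1 scalerDl opprD scalerN addrCA addrA.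
have := diff_derivable (v := - v) dphi.
split; first by rewrite /derivable E.
by rewrite /derive E.
Qed.

Section conv_derive.
Variables (rho : R) (phi : 'rV[R]_n -> R).
Hypotheses (sphi : smooth_expr phi) (supp : small_support rho phi).

Lemma conv_integrable f x : measurable_fun setT f -> (N1 f < +oo)%E ->
  L.-integrable setT (EFin \o (fun z => f z * phi (z - x))).
Proof.
move=> mf Nf; have [C _ phiC] := smooth_bounded sphi supp.
apply: (@integrable_mul_bounded f (fun z => phi (z - x)) C) => //.
by apply: measurable_fun_shift; exact: measurable_smooth.
Qed.

End conv_derive.

(** Differentiation under the integral sign along a line. *)
Lemma is_derive_conv rho phi f x v (s : R) :
  smooth_expr phi -> small_support rho phi ->
  measurable_fun setT f -> (N1 f < +oo)%E ->
  is_derive s 1 (fun t : R => conv phi f (x + t *: v) : R^o)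
    (conv ('D_(- v) (phi : _ -> R^o)) f (x + s *: v)).
Proof.
move=> sphi supp mf Nf.
have sd := smooth_expr_derive (- v) sphi.
have sud := small_support_derive (v := - v) supp.
have [C C0 dC] := smooth_bounded sd sud.
pose F (t : R) (z : 'rV[R]_n) := f z * phi (z - x - t *: v).
have dF (t : R) (z : 'rV[R]_n) : is_derive t 1 (F ^~ z : R -> R^o) (f z * 'D_(- v) (phi : _ -> R^o) (z - x - t *: v)).
  have := line_derive (smooth_expr_diff sphi (z - x - t *: v)).
  by move=> /(is_deriveZ (f z)).
have FE : (fun t : R => conv phi f (x + t *: v) : R^o) = (fun t => \int[L]_z F t z).
  by apply/funext => t; apply: eq_Rintegral => z _; rewrite /F opprD addrA.
have IF t : `](s - 1), (s + 1)[%classic t -> L.-integrable setT (EFin \o F t).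
  move=> _; have := conv_integrable sphi supp (x + t *: v) mf Nf.
  by congr (L.-integrable _ _); apply/funext => z; rewrite /F /= opprD addrA.
have derF (t : R) (z : 'rV[R]_n) : `](s - 1), (s + 1)[%classic t -> setT z -> derivable (F ^~ z) t 1.
  by move=> _ _; have [] := dF t z.
have IG : L.-integrable setT (EFin \o (fun z => C * `|f z|)).
  exact: (integrableZl measurableT C (integrable_norm (norm1_integrable mf Nf))).
have s1 : `](s - 1), (s + 1)[%classic s by rewrite /= in_itv/= ltrBlDr ltrDl ltr01.
have FG (t : R) (z : 'rV[R]_n) : `](s - 1), (s + 1)[%classic t -> setT z ->
    `|partial1of2 F t z| <= C * `|f z|.
  by move=> _ _; have [_ dFE] := dF t z; rewrite partial1of2E dFE normrM mulrC ler_wpM2r.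
have G0 z : 0 <= C * `|f z| by rewrite mulr_ge0.
have de := @differentiation_under_integral R _ _ L F setT measurableT s _ _ s1 IF derF _ G0 IG FG.
have dd := @derivable_under_integral R _ _ L F setT measurableT s _ _ s1 IF derF _ G0 IG FG.
rewrite FE; split; first exact: dd.
rewrite -derive1E [LHS]de; apply: eq_Rintegral => z _.
by have [_ dFE] := dF s z; rewrite partial1of2E dFE opprD addrA.
Qed.

End mollifier.

Section mollified_gradient.
Context {R : realType} {n : nat}.
Hypothesis n0 : (0 < n)%N.
Local Notation L := (borel_lebesgue R n).
Local Notation N1 := (norm1 L).
Implicit Types (f phi : 'rV[R]_n -> R) (g : 'I_n -> 'rV[R]_n -> R).

(** [g] is the weak gradient of [f] on [K], tested on the smooth functions that
    serve as mollifiers. *)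
Definition weak_grad_on (K : set 'rV[R]_n) f g :=
  forall phi rho c, smooth_expr phi -> small_support rho phi -> cube c rho `<=` K ->
  forall j, conv ('D_(delta_mx ord0 j) (phi : _ -> R^o)) f c = - conv phi (g j) c.

Lemma conv_sum (I : Type) (s : seq I) (a : I -> R) (psi : I -> 'rV[R]_n -> R) rho f c :
  (forall i, smooth_expr (psi i)) -> (forall i, small_support rho (psi i)) ->
  measurable_fun setT f -> (N1 f < +oo)%E ->
  L.-integrable setT (EFin \o (fun z => f z * (\sum_(i <- s) a i * psi i (z - c)))) /\
  conv (fun y => \sum_(i <- s) a i * psi i y) f c = \sum_(i <- s) a i * conv (psi i) f c.
Proof.
move=> spsi supp mf Nf; elim: s => [|i s [IHi IH]].
  split.
    rewrite (_ : _ \o _ = cst 0%E); first exact: integrable0.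
    by apply/funext => z /=; rewrite big_nil mulr0.
  rewrite big_nil /conv (_ : (fun _ => _) = cst 0).
    by rewrite Rintegral_cst ?mul0r.
  by apply/funext => z; rewrite big_nil mulr0.
have Ii : L.-integrable setT (EFin \o (fun z => a i * (f z * psi i (z - c)))).
  exact: (integrableZl measurableT (a i) (conv_integrable (spsi i) (supp i) c mf Nf)).
split.
  have := integrableD measurableT Ii IHi; congr (L.-integrable _ _).
  by apply/funext => z /=; rewrite big_cons -EFinD; congr EFin; ring.
rewrite big_cons -IH /conv.
rewrite -(@RintegralZl _ _ _ L setT _ (a i) measurableT (conv_integrable (spsi i) (supp i) c mf Nf)).
rewrite -(@RintegralD _ _ _ L setT _ _ measurableT Ii IHi).
by apply: eq_Rintegral => z _; rewrite big_cons; ring.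
Qed.

Lemma derive_sum_coord phi (v y : 'rV[R]_n) : differentiable (phi : _ -> R^o) y ->
  'D_v (phi : _ -> R^o) y = \sum_j v ord0 j * 'D_(delta_mx ord0 j) (phi : _ -> R^o) y.
Proof.
move=> dphi; rewrite deriveE// [in LHS](row_sum_delta v) linear_sum.
by apply: eq_bigr => j _; rewrite linearZ deriveE.
Qed.

(** Moving the derivative from the mollifier to [f] is the definition of the weak
    gradient; its minus sign is absorbed by the reflection in [conv]. *)
Lemma conv_derive_weak K phi rho f g c v : weak_grad_on K f g ->
  smooth_expr phi -> small_support rho phi -> cube c rho `<=` K ->
  measurable_fun setT f -> (N1 f < +oo)%E ->
  conv ('D_(- v) (phi : _ -> R^o)) f c = \sum_j v ord0 j * conv phi (g j) c.
Proof.
move=> wg sphi supp cK mf Nf.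
rewrite (_ : 'D_(- v) _ = (fun y => \sum_j (- v) ord0 j * 'D_(delta_mx ord0 j) (phi : _ -> R^o) y)); last first.
  by apply/funext => y; apply: derive_sum_coord; exact: smooth_expr_diff.
rewrite (conv_sum _ _ c (rho := rho) _ _ mf Nf).2 //.
- by apply: eq_bigr => j _; rewrite (wg _ _ _ sphi supp cK) mxE mulrNN.
- by move=> j; exact: smooth_expr_derive.
- by move=> j; exact: small_support_derive.
Qed.

(** The fundamental theorem of calculus on a segment, in the form of a mean
    value inequality with a remainder [H]. *)
Lemma conv_segment K phi rho f g x v (H : R) : weak_grad_on K f g ->
  smooth_expr phi -> small_support rho phi ->
  (forall s, 0 <= s <= 1 -> cube (x + s *: v) rho `<=` K) ->
  measurable_fun setT f -> (N1 f < +oo)%E ->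
  (`|conv phi f (x + v) - conv phi f x - H|%:E <=
  \int[lebesgue_measure]_(s in `[0%R, 1%R])
     `|\sum_j v ord0 j * conv phi (g j) (x + s *: v) - H|%:E)%E.
Proof.
move=> wg sphi supp xK mf Nf.
pose dF (s : R) := conv ('D_(- v) (phi : _ -> R^o)) f (x + s *: v).
have dFE s : 0 <= s <= 1 -> dF s = \sum_j v ord0 j * conv phi (g j) (x + s *: v).
  by move=> s01; apply: (conv_derive_weak v wg sphi supp (xK _ s01) mf Nf).
have cdF : continuous (dF : R^o -> R^o).
  move=> s; apply: differentiable_continuous; apply/derivable1_diffP.
  by have [] := is_derive_conv x v s (smooth_expr_derive (- v) sphi)
    (small_support_derive (v := - v) supp) mf Nf.
pose F (s : R) : R^o := conv phi f (x + s *: v) - s * H.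
have isF (s : R) : is_derive s 1 F (dF s - H).
  have i1 := is_derive_conv x v s sphi supp mf Nf.
  have i2 : is_derive s 1 (fun s : R => s * H : R^o) (H : R^o).
    have := @is_deriveM _ _ (@id R) (cst H) s 1 _ _ (is_derive_id s 1) (is_derive_cst H s 1).
    by move=> h; apply: is_derive_eq h _; rewrite scaler0 add0r /= [LHS]mulr1.
  exact: is_deriveB i1 i2.
have cF : continuous F.
  move=> s; apply: differentiable_continuous; apply/derivable1_diffP.
  by have [] := isF s.
have cdFH : continuous (fun s => dF s - H).
  by move=> s; apply: cvgB; [exact: cdF|exact: cvg_cst].
have FTC : (\int[lebesgue_measure]_(s in `[0%R, 1%R]) (dF s - H)%:E = (F 1)%:E - (F 0)%:E)%E.
  apply: (@continuous_FTC2 R (fun s => dF s - H) F 0 1 ltr01).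
  - exact: continuous_subspaceT.
  - split.
    + by move=> s _; have [] := isF s.
    + exact: cvg_at_right_filter (cF 0).
    + exact: cvg_at_left_filter (cF 1).
  - by move=> s _; rewrite derive1E; have [_ ->] := isF s.
have -> : conv phi f (x + v) - conv phi f x - H = F 1 - F 0.
  by rewrite /F scale1r scale0r addr0 mul1r mul0r subr0; ring.
rewrite (_ : `|F 1 - F 0|%:E = `|(F 1)%:E - (F 0)%:E|)%E// -FTC.
have mdF : measurable_fun (`[0%R, 1%R]%classic : set (measurableTypeR R)) (fun s => (dF s - H)%:E).
  apply/measurable_EFinP; apply: measurable_funTS.
  exact: continuous_measurable_fun.
apply: le_trans (le_abse_integral _ _ _) _ => //.
rewrite le_eqVlt; apply/orP; left; apply/eqP; apply: eq_integral => s.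
by rewrite inE/= in_itv/= => /dFE <-.
Qed.

Lemma conv_measurable phi rho f : smooth_expr phi -> small_support rho phi ->
  measurable_fun setT f -> measurable_fun setT (conv phi f).
Proof.
move=> sphi supp mf.
pose F (p : 'rV[R]_n * 'rV[R]_n) : \bar R := (f p.2 * phi (p.2 - p.1))%:E.
have mF : measurable_fun setT F.
  apply/measurable_EFinP; apply: measurable_funM.
    exact: (measurableT_comp mf measurable_snd).
  apply: (measurableT_comp (measurable_smooth sphi)).
  apply: measurable_fun_rV => i; under eq_fun do rewrite !mxE.
  apply: measurable_funB.
    by apply: (measurableT_comp (measurable_rV_coord i)); exact: measurable_snd.
  by apply: (measurableT_comp (measurable_rV_coord i)); exact: measurable_fst.
rewrite (_ : conv phi f = (fun x => fine (fubini_F L F^\+%E x - fubini_F L F^\-%E x)%E)).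
  apply: (measurableT_comp (fine_measurable measurableT)); apply: emeasurable_funB.
    by apply: measurable_fun_fubini_tonelli_F => //; exact: measurable_funepos.
  by apply: measurable_fun_fubini_tonelli_F => //; exact: measurable_funeneg.
apply/funext => x; rewrite /conv /Rintegral integralE /fubini_F; congr (fine (_ - _)%E).
  by apply: eq_integral => z _; rewrite !funeposE.
by apply: eq_integral => z _; rewrite !funenegE.
Qed.

(** The mollification is an average of translates. *)
Lemma norm1_conv phi rho f (e : R) : 0 <= rho -> smooth_expr phi -> small_support rho phi ->
  (forall y, 0 <= phi y) -> (\int[L]_y (phi y)%:E = 1)%E ->
  measurable_fun setT f -> (N1 f < +oo)%E ->
  (forall h : 'rV[R]_n, `|h| <= rho -> (N1 (fun x => f (x + h) - f x)%R <= e%:E)%E) ->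
  (N1 (fun x => conv phi f x - f x)%R <= e%:E)%E.
Proof.
move=> rho0 sphi supp phi0 phi1 mf Nf fe.
have mphi := measurable_smooth sphi.
have [C C0 phiC] := smooth_bounded sphi supp.
have intphi : L.-integrable setT (EFin \o phi).
  apply/integrableP; split; first exact/measurable_EFinP.
  by under eq_integral do rewrite /= ger0_norm//; rewrite phi1 ltry.
pose D (p : 'rV[R]_n * 'rV[R]_n) : \bar R := `|(f (p.1 + p.2) - f p.1) * phi p.2|%:E.
have mD : measurable_fun setT D.
  apply: measurable_abs_EFin; apply: measurable_funM; last first.
    exact: (measurableT_comp mphi measurable_snd).
  apply: measurable_funB; last exact: (measurableT_comp mf measurable_fst).
  apply: (measurableT_comp mf).
  apply: measurable_fun_rV => i; under eq_fun do rewrite !mxE.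
  apply: measurable_funD.
    by apply: (measurableT_comp (measurable_rV_coord i)); exact: measurable_fst.
  by apply: (measurableT_comp (measurable_rV_coord i)); exact: measurable_snd.
have D0 p : (0 <= D p)%E by rewrite lee_fin.
have pt x : (`|conv phi f x - f x|%:E <= \int[L]_z D (x, z))%E.
  have mfx : measurable_fun setT (fun z : 'rV[R]_n => f (z + x)) by exact: measurable_fun_shift.
  have Nfx : (N1 (fun z : 'rV[R]_n => f (z + x)%R) < +oo)%E by rewrite norm1_shift.
  have i1 := integrable_mul_bounded mfx Nfx mphi phiC.
  have i2 : L.-integrable setT (EFin \o (fun z => f x * phi z)).
    exact: (integrableZl measurableT (f x) intphi).
  have -> : conv phi f x - f x = \int[L]_z (f (z + x) * phi z - f x * phi z).
    rewrite RintegralB//; congr (_ - _).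
      rewrite /conv /Rintegral -(integral_shift n0 x); last first.
        by apply/measurable_EFinP; exact: measurable_conv_integrand.
      by congr fine; apply: eq_integral => z _; rewrite addrK.
    by rewrite RintegralZl// /Rintegral phi1 mulr1.
  have i3 : L.-integrable setT (EFin \o (fun z => f (z + x) * phi z - f x * phi z)).
    exact: (integrableB measurableT i1 i2).
  apply: (@le_trans _ _ (\int[L]_z `|f (z + x) * phi z - f x * phi z|%:E)%E).
    rewrite /Rintegral -abse_EFin fineK; last exact: integrable_fin_num.
    by apply: le_abse_integral => //; have /integrableP[] := i3.
  rewrite le_eqVlt; apply/orP; left; apply/eqP; apply: eq_integral => z _.
  by rewrite /D /= mulrBl [z + x]addrC.
apply: (@le_trans _ _ (\int[L]_x \int[L]_z D (x, z))%E).
  apply: ge0_le_integral => //.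
  - apply: measurable_abs_EFin; apply: measurable_funB => //.
    exact: conv_measurable sphi supp mf.
  - exact: (@measurable_fun_fubini_tonelli_F _ _ _ _ R L D mD D0).
rewrite (@fubini_tonelli _ _ _ _ R L L D mD D0).
apply: (@le_trans _ _ (\int[L]_z (e%:E * (phi z)%:E))%E); last first.
  by rewrite integralZl//= phi1 mule1.
have e0 : 0 <= e.
  by rewrite -lee_fin; apply: le_trans (fe 0 _); [exact: norm1_ge0|rewrite normr0].
apply: ge0_le_integral => //.
- by move=> z _; apply: integral_ge0.
- exact: (@measurable_fun_fubini_tonelli_G _ _ _ _ R L D mD D0).
- by apply: emeasurable_funM => //; exact/measurable_EFinP.
move=> z _; have [z0|z0] := eqVneq (phi z) 0.
  rewrite z0 mule0; under eq_integral do rewrite /D /= z0 mulr0 normr0.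
  by rewrite integral0.
apply: (@le_trans _ _ (\int[L]_x ((phi z)%:E * `|f (x + z) - f x|%:E))%E).
  apply: ge0_le_integral => //.
  - by apply: (measurableT_comp mD); exact: measurable_pair2.
  - apply: emeasurable_funM => //; apply: measurable_abs_EFin.
    by apply: measurable_funB => //; exact: measurable_fun_shift.
  - by move=> x _; rewrite /D /= lee_fin normrM mulrC (ger0_norm (phi0 z)).
rewrite ge0_integralZl_EFin//; last first.
  apply: measurable_abs_EFin.
  by apply: measurable_funB => //; exact: measurable_fun_shift.
by rewrite muleC; apply: lee_wpmul2r; [rewrite lee_fin|exact: fe (supp _ z0)].
Qed.

End mollified_gradient.

Section mollifier_existence.
Context {R : realType} {n : nat}.
Hypothesis n0 : (0 < n)%N.
Local Notation L := (borel_lebesgue R n).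
Local Notation N1 := (norm1 L).
Implicit Types (f phi : 'rV[R]_n -> R).

Definition mollifier (rho : R) phi := [/\ smooth_expr phi, small_support rho phi,
  forall y, 0 <= phi y & (\int[L]_y (phi y)%:E = 1)%E].

Lemma lebesgue_cube_lty (c : 'rV[R]_n) (r : R) : (L (cube c r) < +oo)%E.
Proof.
have [r0|r0] := leP 0 r; last first.
  rewrite (_ : cube c r = set0) ?measure0//; apply/seteqP; split=> // x /=.
  by rewrite /cube/= leNgt (lt_le_trans r0).
rewrite -outer_lebesgueE; last exact: measurable_cube.
exact: le_lt_trans (outer_lebesgue_sub_cube n0 r0 (@subset_refl _ _)) (ltry _).
Qed.

Lemma lebesgue_ball_gt0 (c : 'rV[R]_n) (r : R) : 0 < r -> (0 < L (ball c r))%E.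
Proof.
move=> r0.
pose p : 'rV[R]_n * 'rV[R]_n := (c - const_mx (r / 2), c + const_mx (r / 2)).
apply: (@lt_le_trans _ _ (L (box p))).
  rewrite borel_lebesgue_box lte_fin; apply: prodr_gt0 => i _.
  by rewrite !mxE lt_max; apply/orP; right; lra.
apply: le_measure; rewrite ?inE; [exact: measurable_box|exact: measurable_rV_ball|].
move=> x px; rewrite rV_ballE/=; apply: rV_norm_lt => // i.
have := px i; rewrite !mxE => /andP[h1 h2]; rewrite ltr_norml.
by apply/andP; split; lra.
Qed.

Lemma mollifier_exists rho : 0 < rho -> exists phi, mollifier rho phi.
Proof.
move=> rho0; pose b : 'rV[R]_n -> R := bump rho.
have sb : smooth_expr b := smooth_bump rho.
have supp : small_support rho b by move=> y; exact: bump_support.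
have b0 y : 0 <= b y := bump_ge0 rho y.
have mb := measurable_smooth sb.
have [C C0 bC] := smooth_bounded sb supp.
pose I := (\int[L]_y (b y)%:E)%E.
have Ioo : (I < +oo)%E.
  apply: (@le_lt_trans _ _ (\int[L]_y (C * \1_(cube 0 rho) y)%:E)%E).
    apply: ge0_le_integral => //.
    - by move=> y _; rewrite lee_fin.
    - exact/measurable_EFinP.
    - apply/measurable_EFinP; apply: measurable_funM => //.
      by apply: measurable_indic; exact: measurable_cube.
    - move=> y _; rewrite lee_fin indicE.
      have [/set_mem yr|/negP yr] := boolP (y \in cube 0 rho).
        by rewrite mulr1; apply: le_trans (bC y); exact: ler_norm.
      rewrite mulr0 (small_supportP supp)// ltNge; apply/negP => h.
      by apply: yr; rewrite inE /cube/= subr0.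
  under eq_integral do rewrite EFinM.
  rewrite ge0_integralZl_EFin//; last first.
    apply/measurable_EFinP; apply: measurable_indic; exact: measurable_cube.
  rewrite integral_indic//; last exact: measurable_cube.
  rewrite setIT lte_mul_pinfty//; exact: lebesgue_cube_lty.
have I0 : (0 < I)%E.
  have b00 : 0 < b 0.
    apply: bump_gt0; rewrite /dot big1 ?exprn_gt0// => i _.
    by rewrite !mxE mul0r.
  have : \forall y \near (0 : 'rV[R]_n), b 0 / 2 < b y.
    have cb : b @ (0 : 'rV[R]_n) --> b 0 by exact: (smooth_expr_continuous sb).
    by apply: (cvgr_gt (b 0) cb); rewrite ltr_pdivrMr// ltr_pMr// ltr1n.
  move=> /nbhs_ballP[d /= d0 db].
  pose z0 : 'rV[R]_n := 0.
  have c0 : (0 < (b z0 / 2)%:E * L (ball z0 d))%E.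
    by rewrite mule_gt0 ?lebesgue_ball_gt0// lte_fin divr_gt0.
  apply: (lt_le_trans c0).
  rewrite -(integral_cst L (measurable_rV_ball _ _)).
  apply: (ge0_integralS_le _ (measurable_rV_ball _ _)).
  - exact: measurable_cst.
  - exact/measurable_EFinP.
  - by move=> x; rewrite lee_fin divr_ge0.
  - by move=> y; rewrite lee_fin.
  - by move=> y /db; rewrite lee_fin => /ltW.
have Ifin : I \is a fin_num by rewrite ge0_fin_numE// ltW.
have fI0 : 0 < fine I by rewrite fine_gt0// I0.
exists (fun y => (fine I)^-1 * b y); split.
- by apply: smooth_mul => //; exact: smooth_cst.
- by move=> y; rewrite mulf_eq0 negb_or => /andP[_]; exact: supp.
- by move=> y; rewrite mulr_ge0// invr_ge0 ltW.
- under eq_integral do rewrite EFinM.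
  rewrite ge0_integralZl_EFin//.
  + by rewrite -/I -(fineK Ifin) -EFinM mulVf// gt_eqF.
  + by move=> y _; rewrite lee_fin.
  + exact/measurable_EFinP.
  + by rewrite invr_ge0 ltW.
Qed.

(** One mollifier serves finitely many functions: its support is small for the
    modulus of continuity in the mean of each of them. *)
Lemma mollify_family (I : finType) (F : I -> 'rV[R]_n -> R) (rho0 e : R) :
  (forall i, measurable_fun setT (F i)) -> (forall i, N1 (F i) < +oo)%E ->
  0 < rho0 -> 0 < e -> exists phi rho, [/\ 0 < rho <= rho0, mollifier rho phi &
    forall i, (N1 (fun x => conv phi (F i) x - F i x)%R <= e%:E)%E].
Proof.
move=> mF NF r0 e0.
have /choice[d dP] i : exists d : R, 0 < d /\ forall h : 'rV[R]_n, `|h| < d ->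
    (N1 (fun x : 'rV[R]_n => F i (x + h) - F i x)%R <= e%:E)%E.
  by have [d d0 dF] := transl_cont_L1 n0 (mF i) (NF i) e0; exists d.
pose rho := \big[Num.min/rho0]_i (d i / 2).
have rho_gt0 : 0 < rho.
  by apply/bigmin_gtP; split=> // i _; rewrite divr_gt0//; have [] := dP i.
have [phi mphi] := mollifier_exists rho_gt0.
exists phi, rho; split=> //; first by rewrite rho_gt0 bigmin_le_id.
move=> i; have [sphi supp phi0 phi1] := mphi; have [di0 di] := dP i.
apply: (norm1_conv n0 (ltW rho_gt0) sphi supp phi0 phi1 (mF i) (NF i)) => h hr.
apply: di; apply: (le_lt_trans hr); apply: (@le_lt_trans _ _ (d i / 2)).
  exact: bigmin_le_cond.
by rewrite ltr_pdivrMr// ltr_pMr// ltr1n.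
Qed.

End mollifier_existence.

(** * A mean value inequality in the mean for weakly differentiable functions *)

Section key_inequality.
Context {R : realType} {n : nat}.
Hypothesis n0 : (0 < n)%N.
Local Notation L := (borel_lebesgue R n).
Local Notation N1 := (norm1 L).
Local Open Scope ereal_scope.

Variables (f : 'rV[R]_n -> R) (g : 'I_n -> 'rV[R]_n -> R) (K : set 'rV[R]_n).
Hypotheses (mf : measurable_fun setT f) (Nf : N1 f < +oo).
Hypotheses (mg : forall j, measurable_fun setT (g j)) (Ng : forall j, N1 (g j) < +oo).
Hypothesis wg : weak_grad_on K f g.
Variables (B : set 'rV[R]_n) (G : 'rV[R]_n -> 'rV[R]_n) (C R0 : R).
Hypotheses (mB : measurable B) (mG : measurable_fun B G).
Hypotheses (C0 : (0 <= C)%R) (R00 : (0 < R0)%R).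
Hypothesis distortion : forall F : 'rV[R]_n -> \bar R, measurable_fun setT F ->
  (forall x, 0 <= F x) -> \int[L]_(y in B) F (G y) <= C%:E * \int[L]_x F x.
Hypothesis GK : forall y, B y -> cube (G y) R0 `<=` K.

(** Cut off outside of [B], since nothing is known of [G] there. *)
Definition pullback (F : 'rV[R]_n -> R) := (fun y => F (G y)) \_ B.

Definition dir_deriv (N : 'rV[R]_n -> 'rV[R]_n) (gg : 'I_n -> 'rV[R]_n -> R) y : R :=
  (\sum_j N y ord0 j * pullback (gg j) y)%R.

Lemma measurable_pullback F : measurable_fun setT F -> measurable_fun setT (pullback F).
Proof.
move=> mF; apply/(measurable_restrictT _ mB).
by apply: (measurable_comp measurableT) => //; exact: mG.
Qed.

Lemma norm1_pullback F : measurable_fun setT F -> N1 (pullback F) <= C%:E * N1 F.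
Proof.
move=> mF; apply: le_trans (distortion (measurable_abs_EFin mF) _) => //.
rewrite [leRHS]integral_mkcond le_eqVlt; apply/orP; left; apply/eqP.
apply: eq_integral => y _; rewrite /pullback /patch.
by case: ifP => //; rewrite normr0.
Qed.

Lemma pullbackB F1 F2 y :
  (pullback F1 y - pullback F2 y = pullback (fun x => F1 x - F2 x) y)%R.
Proof. by rewrite /pullback /patch; case: ifP => //; rewrite subrr. Qed.

Lemma pullback_in F y : B y -> pullback F y = F (G y).
Proof. by move=> By; rewrite /pullback /patch mem_set. Qed.

Lemma measurable_dir_deriv (N : 'rV[R]_n -> 'rV[R]_n) (gg : 'I_n -> 'rV[R]_n -> R) : measurable_fun setT N ->
  (forall j, measurable_fun setT (gg j)) -> measurable_fun setT (dir_deriv N gg).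
Proof.
move=> mN mgg; apply: measurable_sum => j; apply: measurable_funM.
  exact: (measurableT_comp (measurable_rV_coord j) mN).
exact: measurable_pullback.
Qed.

Lemma norm1_dir_deriv (N : 'rV[R]_n -> 'rV[R]_n) (gg : 'I_n -> 'rV[R]_n -> R) (CN e : R) : measurable_fun setT N ->
  (forall j, measurable_fun setT (gg j)) -> (forall y, `|N y| <= CN)%R ->
  (forall j, N1 (gg j) <= e%:E) ->
  N1 (dir_deriv N gg) <= (CN * C * e *+ n)%:E.
Proof.
move=> mN mgg NC gge.
have mNj j : measurable_fun setT (fun y => N y ord0 j).
  exact: (measurableT_comp (measurable_rV_coord j) mN).
apply: le_trans (norm1_sum _ _) _.
  by move=> j; apply: measurable_funM => //; exact: measurable_pullback.
apply: (@le_trans _ _ (\sum_(j < n) (CN * C * e)%:E)); last first.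
  by rewrite sumEFin lee_fin sumr_const card_ord.
apply: lee_sum => j _.
have CN0 : (0 <= CN)%R by apply: le_trans (NC 0%R).
apply: (@le_trans _ _ (N1 (fun y => CN * pullback (gg j) y)%R)).
  apply: norm1_le => [||y].
  - by apply: measurable_funM => //; exact: measurable_pullback.
  - by apply: measurable_funM => //; exact: measurable_pullback.
  - rewrite !normrM ler_wpM2r// (ger0_norm CN0).
    by apply: le_trans (NC y); exact: rV_coord_le.
rewrite norm1Z; last exact: measurable_pullback.
rewrite (ger0_norm CN0) -mulrA EFinM; apply: lee_wpmul2l; first by rewrite lee_fin.
apply: le_trans (norm1_pullback (mgg j)) _.
by rewrite EFinM; apply: lee_wpmul2l; [rewrite lee_fin|exact: gge].
Qed.

Variables (B' : set 'rV[R]_n) (a : 'rV[R]_n) (N : 'rV[R]_n -> 'rV[R]_n) (CN : R).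
Hypotheses (mB' : measurable B') (mN : measurable_fun setT N).
Hypothesis NC : forall y, (`|N y| <= CN)%R.
Hypothesis B'B : forall y s, B' y -> (0 <= s <= 1)%R -> B (y + s *: a)%R.
Hypothesis Ga : forall y s, B' y -> (0 <= s <= 1)%R -> G (y + s *: a)%R = (G y + s *: N y)%R.
Hypothesis Na : forall y s, B' y -> (0 <= s <= 1)%R -> N (y + s *: a)%R = N y.

Local Notation w := (pullback f).
Local Notation h := (dir_deriv N g).

(** [G] maps the segment from [y] to [y + a] affinely onto the one from [G y] to
    [G y + N y], so for a smooth [f] the increment of [w] would be the integral
    of [h] over the former, and Tonelli's theorem would give the bound. It does
    for the mollifications of [f]; [distortion] makes the errors on both sides
    small in the mean. *)
Lemma mean_value_inequality (M : R) :
  (forall s : R, (0 <= s <= 1)%R -> \int[L]_(y in B') `|h (y + s *: a) - h y|%:E <= M%:E) ->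
  \int[L]_(y in B') `|w (y + a) - w y - h y|%:E <= M%:E.
Proof.
move=> hM; have CN0 : (0 <= CN)%R by apply: le_trans (NC 0%R).
pose Q := (2 * C + 3 * (CN * C *+ n))%R.
have Q0 : (0 <= Q)%R.
  by rewrite addr_ge0 ?mulr_ge0// mulrn_wge0// mulr_ge0.
suff main (e : R) : (0 < e)%R ->
    \int[L]_(y in B') `|w (y + a) - w y - h y|%:E <= M%:E + (Q * e)%:E.
  apply/lee_addgt0Pr => e e0; have Q1 : (0 < Q + 1)%R by rewrite ltr_wpDl.
  apply: (le_trans (main (e / (Q + 1))%R _)); first by rewrite divr_gt0.
  rewrite leeD2l// lee_fin mulrA ler_pdivrMr// mulrC ler_wpM2l ?(ltW e0)//.
  by rewrite lerDl.
move=> e0.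
(* [None] stands for [f], so that one mollifier is chosen for [f] and all [g j]. *)
pose F (o : option 'I_n) := if o is Some j then g j else f.
have [||phi [rho [/andP[rho0 rhoR] [sphi supp phi0 phi1] FE]]] :=
    @mollify_family R n n0 _ F R0 e _ _ R00 e0; [by case..|].
have mcf := conv_measurable sphi supp mf.
have mcg j := conv_measurable sphi supp (mg j).
pose we := pullback (conv phi f).
pose he := dir_deriv N (fun j => conv phi (g j)).
have mw := measurable_pullback mf.
have mwe : measurable_fun setT we := measurable_pullback mcf.
have mh := measurable_dir_deriv mN mg.
have mhe : measurable_fun setT he := measurable_dir_deriv mN mcg.
have mdw : measurable_fun setT (fun y => we y - w y)%R by exact: measurable_funB.
have mdh : measurable_fun setT (fun y => he y - h y)%R by exact: measurable_funB.
have Ndw : N1 (fun y => we y - w y)%R <= (C * e)%:E.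
  rewrite (_ : (fun y => _) = pullback (fun x => conv phi f x - f x)%R); last first.
    by apply/funext => y; exact: pullbackB.
  apply: le_trans (norm1_pullback _) _; first exact: measurable_funB.
  by rewrite EFinM; apply: lee_wpmul2l; [rewrite lee_fin|exact: (FE None)].
have Ndh : N1 (fun y => he y - h y)%R <= (CN * C * e *+ n)%:E.
  rewrite (_ : (fun y => _) = dir_deriv N (fun j x => conv phi (g j) x - g j x)%R); last first.
    apply/funext => y; rewrite /he /dir_deriv -sumrB; apply: eq_bigr => j _.
    by rewrite -mulrBr pullbackB.
  apply: norm1_dir_deriv => // [j|j]; first exact: measurable_funB.
  exact: (FE (Some j)).
have seg y : B' y -> `|we (y + a)%R - we y - he y|%:E <=
    \int[lebesgue_measure]_(s in `[0%R, 1%R]) `|he (y + s *: a)%R - he y|%:E.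
  move=> B'y; have s1 : (0 <= (1:R) <= 1)%R by rewrite ler01 lexx.
  have s0 : (0 <= (0:R) <= 1)%R by rewrite ler01 lexx.
  have By : B y by have := B'B B'y s0; rewrite scale0r addr0.
  have Bya : B (y + a)%R by have := B'B B'y s1; rewrite scale1r.
  have Gya : G (y + a)%R = (G y + N y)%R by have := Ga B'y s1; rewrite !scale1r.
  rewrite /we (pullback_in _ By) (pullback_in _ Bya) Gya.
  apply: le_trans (conv_segment (K := K) (he y) wg sphi supp _ mf Nf) _.
    move=> s s01 x xc; rewrite -(Ga B'y s01) in xc; apply: (GK (B'B B'y s01)).
    exact: le_trans xc rhoR.
  rewrite le_eqVlt; apply/orP; left; apply/eqP; apply: eq_integral => s.
  rewrite inE/= in_itv/= => s01; congr (`|_ - _|%:E)%R.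
  rewrite /he /dir_deriv; apply: eq_bigr => j _.
  by rewrite (Na B'y s01) (pullback_in _ (B'B B'y s01)) (Ga B'y s01).
pose Phi (p : 'rV[R]_n * measurableTypeR R) := `|he (p.1 + p.2 *: a)%R - he p.1|%:E.
have mPhi : measurable_fun setT Phi.
  apply: measurable_abs_EFin; apply: measurable_funB.
    apply: (measurableT_comp mhe).
    apply: measurable_fun_rV => i; under eq_fun do rewrite !mxE.
    apply: measurable_funD.
      by apply: (measurableT_comp (measurable_rV_coord i)); exact: measurable_fst.
    by apply: measurable_funM => //; exact: measurable_snd.
  exact: (measurableT_comp mhe measurable_fst).
pose I : set (measurableTypeR R) := `[0%R, 1%R]%classic.
have mI : measurable I by exact: measurable_itv.
have mBI : measurable (B' `*` I) by exact: measurableX.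
pose E := Phi \_ (B' `*` I).
have mE : measurable_fun setT E.
  by apply/(measurable_restrictT _ mBI); exact: measurable_funTS.
have E0 p : 0 <= E p by rewrite /E /patch; case: ifP => // _; rewrite lee_fin.
have Phi0 p : 0 <= Phi p by rewrite lee_fin.
have LI : lebesgue_measure I = 1.
  by rewrite lebesgue_measure_itv/= lte_fin ltr01 -EFinB subr0.
have inner_y y : B' y -> \int[lebesgue_measure]_(s in I) Phi (y, s) =
    \int[lebesgue_measure]_s E (y, s).
  move=> B'y; rewrite integral_mkcond; apply: eq_integral => s _.
  by rewrite /E /patch in_setX (mem_set B'y).
have outer_y y : ~ B' y -> \int[lebesgue_measure]_s E (y, s) = 0.
  move=> B'y; rewrite -[RHS](integral0 lebesgue_measure setT); apply: eq_integral => s _.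
  by rewrite /E /patch in_setX (memNset B'y).
(* The integral over the segments, evaluated in the other order. *)
have T4 : \int[L]_(y in B') \int[lebesgue_measure]_(s in I) Phi (y, s) <=
    M%:E + (2 * (CN * C * e *+ n))%:E.
  have -> : \int[L]_(y in B') \int[lebesgue_measure]_(s in I) Phi (y, s) =
      \int[L]_y \int[lebesgue_measure]_s E (y, s).
    rewrite integral_mkcond; apply: eq_integral => y _; rewrite /patch.
    by case: ifPn => [/set_mem /inner_y //|/negP yB]; rewrite outer_y// => /mem_set.
  rewrite (@fubini_tonelli _ _ _ _ R L lebesgue_measure E mE E0).
  have M0 : 0 <= M%:E.
    apply: le_trans (hM 0%R _); last by rewrite lexx ler01.
    by apply: integral_ge0 => y _; rewrite lee_fin.
  have bound s : I s -> \int[L]_y E (y, s) <= M%:E + (2 * (CN * C * e *+ n))%:E.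
    rewrite /I /= in_itv/= => s01.
    have mhs : measurable_fun setT (fun y : 'rV[R]_n => h (y + s *: a)%R).
      exact: measurable_fun_shift.
    have mdhs : measurable_fun setT (fun y : 'rV[R]_n => he (y + s *: a) - h (y + s *: a))%R.
      exact: (measurable_fun_shift (s *: a) mdh).
    have md0 : measurable_fun setT (fun y : 'rV[R]_n => -1 * (he y - h y))%R.
      by apply: measurable_funM => //; exact: measurable_cst.
    have mhh : measurable_fun B' (fun y : 'rV[R]_n => `|h (y + s *: a) - h y|%:E)%R.
      by apply: measurable_funTS; apply: measurable_abs_EFin; exact: measurable_funB.
    have -> : \int[L]_y E (y, s) = \int[L]_(y in B') Phi (y, s).
      rewrite [RHS]integral_mkcond; apply: eq_integral => y _.
      rewrite /E /patch in_setX (_ : (s \in I) = true) ?andbT//.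
      by apply/mem_set; rewrite /I/= in_itv.
    apply: (@le_trans _ _ (\int[L]_(y in B') (`|h (y + s *: a)%R - h y|%:E +
       (`|he (y + s *: a)%R - h (y + s *: a)%R|%:E + `|-1 * (he y - h y)|%:E)))).
      apply: ge0_le_integral => //.
      - by apply: measurable_funTS; apply: (measurableT_comp mPhi); exact: measurable_pair2.
      - apply: emeasurable_funD => //; apply: measurable_funTS.
        by apply: emeasurable_funD; exact: measurable_abs_EFin.
      - move=> y _; rewrite /Phi /= -!EFinD lee_fin.
        rewrite (_ : he (y + s *: a) - he y = (h (y + s *: a) - h y) +
          ((he (y + s *: a) - h (y + s *: a)) + -1 * (he y - h y)))%R; last by ring.
        apply: le_trans (ler_normD _ _) _; rewrite lerD2l; exact: ler_normD.
    rewrite ge0_integralD//; last 2 first.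
      - by move=> y _; rewrite -EFinD lee_fin addr_ge0.
      - by apply: measurable_funTS; apply: emeasurable_funD; exact: measurable_abs_EFin.
    apply: leeD; first exact: hM.
    rewrite ge0_integralD//; last 2 first.
      - by apply: measurable_funTS; exact: measurable_abs_EFin.
      - by apply: measurable_funTS; exact: measurable_abs_EFin.
    rewrite mulrDl mul1r EFinD; apply: leeD.
      apply: le_trans Ndh; rewrite -(norm1_shift n0 (s *: a)%R mdh).
      by apply: ge0_subset_integral => //; exact: measurable_abs_EFin.
    apply: (@le_trans _ _ (N1 (fun y => -1 * (he y - h y))%R)).
      by apply: ge0_subset_integral => //; exact: measurable_abs_EFin.
    by rewrite norm1Z// normrN normr1 mul1e.
  apply: (@le_trans _ _ (\int[lebesgue_measure]_(s in I)
      (M%:E + (2 * (CN * C * e *+ n))%:E))).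
    rewrite [leRHS]integral_mkcond; apply: ge0_le_integral => //.
    - by move=> s _; apply: integral_ge0.
    - exact: (@measurable_fun_fubini_tonelli_G _ _ _ _ R L E mE E0).
    - by apply/(measurable_restrictT _ mI); exact: measurable_cst.
    move=> s _; rewrite /patch; case: ifPn => [/set_mem /bound //|/negP sI].
    rewrite le_eqVlt; apply/orP; left; apply/eqP.
    rewrite -[RHS](integral0 L setT); apply: eq_integral => y _.
    by rewrite /E /patch in_setX (_ : (s \in I) = false) ?andbF//; exact/negP.
  rewrite integral_cst//; apply: (@le_trans _ _ ((M%:E + (2 * (CN * C * e *+ n))%:E) * 1)).
    by rewrite -LI.
  by rewrite mule1.
have ce0 : (0 <= CN * C * e *+ n)%R.
  by rewrite mulrn_wge0// !mulr_ge0// ltW.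
have -> : M%:E + (Q * e)%:E = (C * e)%:E + ((C * e)%:E + ((CN * C * e *+ n)%:E +
    (M%:E + (2 * (CN * C * e *+ n))%:E))).
  rewrite -!EFinD; congr EFin; rewrite /Q -!mulrnAl; move: (CN *+ n)%R => z.
  by ring.
pose T1 y := `|we (y + a)%R - w (y + a)%R|%:E.
pose T2 y := `|we y - w y|%:E.
pose T3 y := `|he y - h y|%:E.
pose T y := \int[lebesgue_measure]_(s in I) Phi (y, s).
have mT1 : measurable_fun setT T1.
  by apply: measurable_abs_EFin; exact: (measurable_fun_shift a mdw).
have mT2 : measurable_fun setT T2 by exact: measurable_abs_EFin.
have mT3 : measurable_fun setT T3 by exact: measurable_abs_EFin.
have mT : measurable_fun B' T.
  apply: (@eq_measurable_fun _ _ _ _ _ (fun y => \int[lebesgue_measure]_s E (y, s))).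
    by move=> y /set_mem By; rewrite /T inner_y.
  apply: measurable_funTS.
  exact: (@measurable_fun_fubini_tonelli_F _ _ _ _ R lebesgue_measure E mE E0).
have T1ge y : 0 <= T1 y by rewrite lee_fin.
have T2ge y : 0 <= T2 y by rewrite lee_fin.
have T3ge y : 0 <= T3 y by rewrite lee_fin.
have T0 y : 0 <= T y by exact: integral_ge0.
have m3 : measurable_fun B' (T3 \+ T).
  by apply: emeasurable_funD => //; exact: measurable_funTS.
have m2 : measurable_fun B' (T2 \+ (T3 \+ T)).
  by apply: emeasurable_funD => //; exact: measurable_funTS.
apply: (@le_trans _ _ (\int[L]_(y in B') (T1 \+ (T2 \+ (T3 \+ T))) y)).
  apply: ge0_le_integral => //.
  - apply: measurable_funTS; apply: measurable_abs_EFin; apply: measurable_funB => //.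
    by apply: measurable_funB => //; exact: measurable_fun_shift.
  - by apply: emeasurable_funD => //; exact: measurable_funTS.
  move=> y B'y /=; apply: (@le_trans _ _ (T1 y + (T2 y + (T3 y + `|we (y + a)%R - we y - he y|%:E)))).
    rewrite -!EFinD lee_fin.
    rewrite (_ : w (y + a) - w y - h y = - (we (y + a) - w (y + a)) + ((we y - w y) +
      ((he y - h y) + (we (y + a) - we y - he y))))%R; last by ring.
    apply: le_trans (ler_normD _ _) _; rewrite normrN lerD2l.
    by apply: le_trans (ler_normD _ _) _; rewrite lerD2l ler_normD.
  by rewrite !leeD2l//; exact: seg.
have T1B : \int[L]_(y in B') T1 y <= (C * e)%:E.
  apply: le_trans Ndw; rewrite -(norm1_shift n0 a mdw).
  by exact: (ge0_integralS_le L mB' mT1 mT1 T1ge T1ge (fun y _ => lexx _)).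
have T2B : \int[L]_(y in B') T2 y <= (C * e)%:E.
  by apply: le_trans Ndw; exact: (ge0_integralS_le L mB' mT2 mT2 T2ge T2ge (fun y _ => lexx _)).
have T3B : \int[L]_(y in B') T3 y <= (CN * C * e *+ n)%:E.
  by apply: le_trans Ndh; exact: (ge0_integralS_le L mB' mT3 mT3 T3ge T3ge (fun y _ => lexx _)).
have p3 y : 0 <= (T3 \+ T) y by rewrite /= adde_ge0// lee_fin.
have p2 y : 0 <= (T2 \+ (T3 \+ T)) y by rewrite /= adde_ge0// lee_fin.
rewrite ge0_integralD//; last exact: measurable_funTS.
apply: leeD => //; rewrite ge0_integralD//; last exact: measurable_funTS.
apply: leeD => //; rewrite ge0_integralD//; last exact: measurable_funTS.
exact: leeD.
Qed.

End key_inequality.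

(** * Weak derivatives along the fibres of a chart *)

Section distortion.
Context {R : realType} {n : nat}.
Hypothesis n0 : (0 < n)%N.
Local Notation L := (borel_lebesgue R n).
Local Open Scope ereal_scope.

Lemma ge0_integral_mrestr d (T : measurableType d) (mu : {measure set T -> \bar R})
    (D : set T) (mD : measurable D) (F : T -> \bar R) :
  measurable_fun setT F -> (forall x, 0 <= F x) ->
  \int[mrestr mu mD]_x F x = \int[mu]_(x in D) F x.
Proof.
move=> mF F0; rewrite -(setUv D) ge0_integral_setU//; last 3 first.
- exact: measurableC.
- by rewrite setUv.
- by apply/disj_setPS => x [].
rewrite (eq_measure_integral mu)/=; last first.
  by move=> A mA AD; rewrite /mrestr (setIidl AD).
rewrite [X in _ + X](eq_measure_integral mzero)/=; last first.
  move=> A mA AD; rewrite /mrestr (_ : A `&` D = set0) ?measure0//.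
  by apply/seteqP; split=> // x [/AD].
by rewrite integral_measure_zero adde0.
Qed.

(** The measure of [B] pushed forward by [G] is at most [C] times Lebesgue
    measure. *)
Lemma ge0_integral_distortion (B : set 'rV[R]_n) (G : 'rV[R]_n -> 'rV[R]_n) (C : R)
    (F : 'rV[R]_n -> \bar R) :
  measurable B -> measurable_fun B G -> (0 <= C)%R ->
  (forall A, measurable A -> L (B `&` G @^-1` A) <= C%:E * L A) ->
  measurable_fun setT F -> (forall x, 0 <= F x) ->
  \int[L]_(y in B) F (G y) <= C%:E * \int[L]_x F x.
Proof.
move=> mB mG C0 GC mF F0.
pose G1 := G \_ B.
have mG1 : measurable_fun setT G1 by apply/(measurable_restrictT _ mB).
rewrite (eq_integral (F \o G1)); last first.
  by move=> y yB; rewrite /= /G1 /patch yB.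
have mFG : measurable_fun setT (F \o G1) by exact: measurableT_comp.
rewrite -(ge0_integral_mrestr L mB mFG (fun x => F0 (G1 x))).
rewrite -[leLHS](ge0_integral_pushforward mG1 _ measurableT mF)//.
rewrite -[C]/((NngNum C0)%:num) -ge0_integral_mscale//.
apply: ge0_le_measure_integral => // A mA.
rewrite /= /pushforward /mrestr /mscale/= (_ : _ `&` B = B `&` G @^-1` A); first exact: GC.
by apply/seteqP; split=> [y [+ By]|y [By +]]; rewrite /preimage/= /G1 /patch mem_set.
Qed.

Variables (B : set 'rV[R]_n) (G : 'rV[R]_n -> 'rV[R]_n) (C : R).
Hypotheses (C0 : (0 < C)%R).
Hypothesis G_expand : forall x y, B x -> B y -> (`|x - y| <= C * `|G x - G y|)%R.

Lemma outer_preimage_expanding A :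
  outer_lebesgue R n (B `&` G @^-1` A) <= ((8 * C) ^+ n)%:E * outer_lebesgue R n A.
Proof.
apply: le_trans (outer_lebesgue_expanding n0 C0 _) _.
  by move=> x y [Bx _] [By _]; exact: G_expand.
apply: lee_wpmul2l; first by rewrite lee_fin exprn_ge0// mulr_ge0// ltW.
by apply: le_outer_measure => _ [y [_ Ay] <-].
Qed.

Lemma outer_null_preimage A :
  outer_lebesgue R n A = 0 -> outer_lebesgue R n (B `&` G @^-1` A) = 0.
Proof.
move=> A0; apply/eqP; rewrite eq_le outer_measure_ge0 andbT.
by apply: le_trans (outer_preimage_expanding A) _; rewrite A0 mule0.
Qed.

End distortion.

Section null_integrals.
Context {R : realType} {n : nat}.
Local Notation L := (borel_lebesgue R n).
Local Open Scope ereal_scope.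

Lemma integral_abs_null (D : set 'rV[R]_n) (F : 'rV[R]_n -> R) :
  measurable D -> measurable_fun D F ->
  (\int[L]_(x in D) `|F x|%:E = 0 <->
   outer_lebesgue R n [set x | D x /\ F x != 0%R] = 0).
Proof.
move=> mD mF.
have mEF : measurable_fun D (EFin \o F) by exact/measurable_EFinP.
have E := ae_eq_integral_abs L mD mEF.
have Eset : [set x | D x /\ F x != 0%R] = ~` [set x | D x -> (EFin \o F) x = cst 0 x].
  apply/seteqP; split=> x /=; first by case=> Dx /eqP F0 /(_ Dx) [].
  by move=> /not_implyP[Dx FN]; split=> //; apply/eqP => F0; apply: FN; rewrite F0.
split=> [/E[A [mA A0 DA]]|F0].
  apply: (@outer_null_subset _ _ _ A); last by rewrite outer_lebesgueE.
  by rewrite Eset.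
apply/E; have [A [mA DA A0]] := borel_null_hull F0.
by exists A; split=> //; rewrite -Eset.
Qed.

End null_integrals.

Section fibre_derivative.
Context {R : realType} {k d : nat}.
Hypotheses (k0 : (0 < k)%N) (d0 : (0 < d)%N).
Local Notation n := (k + d)%N.
Local Notation L := (borel_lebesgue R (k + d)).
Local Notation oL := (outer_lebesgue R (k + d)).
Local Notation N1 := (norm1 L).

Variables (f : 'rV[R]_n -> R) (g : 'I_n -> 'rV[R]_n -> R) (K : set 'rV[R]_n).
Hypotheses (mf : measurable_fun setT f) (Nf : (N1 f < +oo)%E).
Hypotheses (mg : forall j, measurable_fun setT (g j)) (Ng : forall j, (N1 (g j) < +oo)%E).
Hypothesis wg : weak_grad_on K f g.
Variables (y0 : 'rV[R]_n) (rho C R0 : R) (G : 'rV[R]_n -> 'rV[R]_n).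
Variables (q : 'rV[R]_k -> 'rV[R]_n) (nm : 'rV[R]_k -> 'M[R]_(d, n)).
Hypotheses (rho0 : 0 < rho) (C0 : 0 < C) (R00 : 0 < R0).
Local Notation B := (ball y0 rho).
Hypothesis GE : forall y, B y -> G y = q (lsubmx y) + rsubmx y *m nm (lsubmx y).
Hypothesis G_lip : forall x y, B x -> B y -> `|G x - G y| <= C * `|x - y|.
Hypothesis G_expand : forall x y, B x -> B y -> `|x - y| <= C * `|G x - G y|.
Hypothesis GK : forall y, B y -> cube (G y) R0 `<=` K.

Let n0 : (0 < n)%N. Proof. by rewrite addn_gt0 k0. Qed.

Definition vert (a : 'rV[R]_d) : 'rV[R]_n := row_mx 0 a.

Lemma norm_vert a : `|vert a| <= `|a|.
Proof.
apply: rV_norm_le => // i; case: (splitP i) => j ij.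
  by rewrite (_ : i = lshift d j) ?row_mxEl ?mxE ?normr0//; exact: val_inj.
by rewrite (_ : i = rshift k j) ?row_mxEr ?rV_coord_le//; exact: val_inj.
Qed.

Lemma vertZ s a : s *: vert a = vert (s *: a).
Proof. by rewrite /vert scale_row_mx scaler0. Qed.

Lemma lsubmx_vert y a : lsubmx (y + vert a) = lsubmx y.
Proof. by rewrite linearD /= row_mxKl addr0. Qed.

Lemma rsubmx_vert y a : rsubmx (y + vert a) = rsubmx y + a.
Proof. by rewrite linearD /= row_mxKr. Qed.

Definition fibre_dir (a : 'rV[R]_d) (y : 'rV[R]_n) := a *m nm (lsubmx y).

(** The gradient [g] at [G y], applied to the image [fibre_dir a y] of the
    vertical vector [a] under the differential of [G]. *)
Definition fibre_deriv (a : 'rV[R]_d) (y : 'rV[R]_n) : R :=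
  \sum_j fibre_dir a y ord0 j * g j (G y).

Lemma ball_shift (y b : 'rV[R]_n) (r s : R) : ball y0 r y -> `|b| <= s -> ball y0 (r + s) (y + b).
Proof.
rewrite !rV_ballE/= => yr bs.
have -> : y0 - (y + b) = (y0 - y) - b by rewrite opprD addrA.
by apply: le_lt_trans (ler_normB _ _) _; rewrite ltr_leD.
Qed.

Lemma G_vert y a : B y -> B (y + vert a) -> G (y + vert a) = G y + fibre_dir a y.
Proof.
by move=> By Bya; rewrite !GE// lsubmx_vert rsubmx_vert mulmxDl addrA.
Qed.

Lemma G_continuous y : B y -> {for y, continuous G}.
Proof.
move=> By; apply/(@cvgrPdist_lt _ _ _ (nbhs y)) => e e0; near=> z.
have Bz : B z by near: z; apply: open_nbhs_nbhs; split=> //; exact: ball_open.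
apply: le_lt_trans (G_lip By Bz) _; rewrite -ltr_pdivlMl//.
near: z; apply: cvgr_dist_lt; first exact: cvg_id.
by rewrite mulr_gt0// invr_gt0.
Unshelve. all: by end_near. Qed.

Let r2 := rho / 2.
Let r4 := rho / 4.
Local Notation B2 := (ball y0 r2).
Local Notation B4 := (ball y0 r4).

Let r2B : B2 `<=` B.
Proof. by apply: le_ball; rewrite /r2; move: rho0; lra. Qed.

Let mBr r : measurable (ball y0 r : set 'rV[R]_n).
Proof. exact: measurable_rV_ball. Qed.

Let mGB2 : measurable_fun B2 G.
Proof.
apply: continuous_measurable_rV => [|y /r2B]; first exact: ball_open.
exact: G_continuous.
Qed.

Let Cd := (8 * C) ^+ n.

Let Cd0 : 0 <= Cd.
Proof. by rewrite exprn_ge0// mulr_ge0// ltW. Qed.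

Let dist2 (F : 'rV[R]_n -> \bar R) : measurable_fun setT F -> (forall x, 0 <= F x)%E ->
  (\int[L]_(y in B2) F (G y) <= Cd%:E * \int[L]_x F x)%E.
Proof.
apply: ge0_integral_distortion => // A mA.
have mBA : measurable (B2 `&` G @^-1` A) by exact: mGB2.
rewrite -!outer_lebesgueE//; apply: outer_preimage_expanding => // x y Bx By.
by apply: G_expand; exact: r2B.
Qed.

Section one_direction.
Variable a : 'rV[R]_d.
Hypothesis a4 : `|a| <= r4.

Let r40 : 0 < r4. Proof. by rewrite /r4; move: rho0; lra. Qed.

Let va4 : `|vert a| <= r4. Proof. exact: le_trans (norm_vert a) a4. Qed.

Let B2B y : B2 y -> B (y + vert a).
Proof.
move=> yB; apply: (le_ball _ (ball_shift yB va4)).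
by rewrite /r2 /r4; move: rho0; lra.
Qed.

(** [fibre_dir a] on [B2], as an increment of [G]: in this form it is measurable
    because [G] is continuous. *)
Let N (y : 'rV[R]_n) : 'rV[R]_n :=
  \row_j ((fun y : 'rV[R]_n => (G (y + vert a) - G y) ord0 j) \_ B2) y.

Let NE y : B2 y -> N y = fibre_dir a y.
Proof.
move=> yB; apply/rowP => j; rewrite mxE /patch mem_set// G_vert//; [|exact: r2B|exact: B2B].
by rewrite addrAC subrr add0r.
Qed.

Let mN : measurable_fun setT N.
Proof.
apply: measurable_fun_rV => j; under eq_fun do rewrite mxE.
apply/(measurable_restrictT _ (mBr r2)).
apply: continuous_measurable_rV_real => [|y yB]; first exact: ball_open.
have cGa : {for y, continuous (fun y : 'rV[R]_n => G (y + vert a))}.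
  apply: (@continuous_comp _ _ _ (fun y : 'rV[R]_n => y + vert a) G); last exact: G_continuous (B2B yB).
  by apply: (@continuousD _ _ _ id (cst (vert a))); [exact: cvg_id|exact: cst_continuous].
apply: (@continuous_comp _ _ _ (fun y : 'rV[R]_n => G (y + vert a) - G y)
  (fun x : 'rV[R]_n => x ord0 j)); last exact: coord_continuous.
exact: (@continuousB _ _ _ (fun y : 'rV[R]_n => G (y + vert a)) G _ cGa (G_continuous (r2B yB))).
Qed.

Let NC y : `|N y| <= C * r4.
Proof.
have Cr : 0 <= C * r4 by rewrite mulr_ge0// ltW.
apply: rV_norm_le => // j; rewrite mxE /patch.
case: ifPn => [/set_mem yB|_]; last by rewrite normr0.
apply: le_trans (rV_coord_le _ _) _.
apply: le_trans (G_lip (B2B yB) (r2B yB)) _.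
by rewrite addrAC subrr add0r ler_wpM2l// ltW.
Qed.

Let s_vert (s : R) : 0 <= s <= 1 -> `|s *: vert a| <= r4.
Proof.
move=> /andP[s0 s1]; rewrite normrZ (ger0_norm s0).
by apply: le_trans va4; rewrite ler_piMl.
Qed.

Let B4B2 y (s : R) : B4 y -> 0 <= s <= 1 -> B2 (y + s *: vert a).
Proof.
move=> yB /s_vert sa; apply: (le_ball _ (ball_shift yB sa)).
by rewrite /r2 /r4; move: rho0; lra.
Qed.

Let B4B2' y : B4 y -> B2 y.
Proof. by apply: le_ball; rewrite /r2 /r4; move: rho0; lra. Qed.

Let fibre_dir_vert b c y : fibre_dir b (y + vert c) = fibre_dir b y.
Proof. by rewrite /fibre_dir lsubmx_vert. Qed.

Let Ga y (s : R) : B4 y -> 0 <= s <= 1 -> G (y + s *: vert a) = G y + s *: N y.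
Proof.
move=> yB s01; have yB2 := B4B2' yB; rewrite NE// vertZ G_vert//.
- by rewrite /fibre_dir scalemxAl.
- exact: r2B.
- by rewrite -vertZ; apply/r2B/B4B2.
Qed.

Let Na y (s : R) : B4 y -> 0 <= s <= 1 -> N (y + s *: vert a) = N y.
Proof.
move=> yB s01; rewrite NE; last exact: B4B2.
by rewrite NE ?vertZ ?fibre_dir_vert//; exact: B4B2'.
Qed.

Local Notation w := (pullback B2 G f).
Local Notation h := (dir_deriv B2 G N g).

Let hE y : B2 y -> h y = fibre_deriv a y.
Proof.
move=> yB; apply: eq_bigr => j _; rewrite /pullback /patch mem_set//.
by rewrite NE.
Qed.

Let mvi := @mean_value_inequality R n n0 f g K mf Nf mg Ng wg B2 G Cd R0 (mBr r2) mGB2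
  Cd0 R00 dist2 (fun y yB => GK (r2B yB)) B4 (vert a) N (C * r4) (mBr r4) mN NC B4B2 Ga Na.

Let mw : measurable_fun setT w. Proof. exact: (measurable_pullback (mBr r2) mGB2 mf). Qed.

Let mh : measurable_fun setT h. Proof. exact: (measurable_dir_deriv (mBr r2) mGB2 mN mg). Qed.

Let hE' : h = fibre_deriv a \_ B2.
Proof.
apply/funext => y; rewrite /patch; case: ifPn => [/set_mem/hE//|yB].
by rewrite /dir_deriv big1// => j _; rewrite /pullback /patch (negbTE yB) mulr0.
Qed.

Lemma measurable_fibre_deriv : measurable_fun setT (fibre_deriv a \_ B2).
Proof. by rewrite -hE'; exact: mh. Qed.

Lemma norm1_fibre_deriv : (N1 (fibre_deriv a \_ B2) < +oo)%E.
Proof.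
rewrite -hE'; pose e := \sum_j fine (N1 (g j)).
have ge j : (N1 (g j) <= e%:E)%E.
  have fin : N1 (g j) \is a fin_num by rewrite ge0_fin_numE ?norm1_ge0.
  rewrite -(fineK fin) lee_fin /e (bigD1 j)//= lerDl sumr_ge0// => i _.
  by rewrite fine_ge0// norm1_ge0.
apply: le_lt_trans (norm1_dir_deriv (mBr r2) mGB2 Cd0 dist2 mN mg NC ge) _.
by rewrite ltry.
Qed.

Lemma fibre_mean_value (M : R) :
  (forall s : R, 0 <= s <= 1 ->
    (\int[L]_(y in B4) `|(fibre_deriv a \_ B2) (y + s *: vert a)%R -
                          (fibre_deriv a \_ B2) y|%:E <= M%:E)%E) ->
  (\int[L]_(y in B4) `|w (y + vert a)%R - w y - (fibre_deriv a \_ B2) y|%:E <= M%:E)%E.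
Proof. by rewrite -hE'; exact: mvi. Qed.

Let B4va y : B4 y -> B2 (y + vert a).
Proof. by move=> yB; rewrite -[vert a]scale1r; apply: B4B2; rewrite // ler01 lexx. Qed.

Let wE y : B4 y -> w (y + vert a) - w y = f (G (y + vert a)) - f (G y).
Proof.
by move=> yB; rewrite (pullback_in _ _ (B4va yB)) (pullback_in _ _ (B4B2' yB)).
Qed.

Let mwa : measurable_fun setT (fun y : 'rV[R]_n => w (y + vert a)).
Proof. exact: measurable_fun_shift. Qed.

(** A derivative that vanishes almost everywhere does not oscillate in the mean:
    the mean value inequality holds with the bound 0. *)
Lemma fibre_shift_invariant :
  oL [set y | B2 y /\ fibre_deriv a y != 0] = 0%E ->
  oL [set y | B4 y /\ f (G (y + vert a)) != f (G y)] = 0%E.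
Proof.
set h0 := fibre_deriv a \_ B2; move=> a0.
have mh0 : measurable_fun setT h0 := measurable_fibre_deriv.
have h0E y : h0 y != 0 -> B2 y /\ fibre_deriv a y != 0.
  by rewrite /h0 /patch; case: ifPn => [/set_mem|]; rewrite ?eqxx.
have Nh0 : N1 h0 = 0%E.
  apply/integral_abs_null => //; apply: outer_null_subset a0.
  by move=> y [_ /h0E].
have Nm (s : R) : N1 (fun y : 'rV[R]_n => h0 (y + s *: vert a) + -1 * h0 y)%R = 0%E.
  apply/eqP; rewrite eq_le norm1_ge0 andbT.
  apply: le_trans (norm1D _ _ _) _.
  - exact: measurable_fun_shift.
  - by apply: measurable_funM => //; exact: measurable_cst.
  - by rewrite norm1_shift// norm1Z// Nh0 mule0 adde0.
have : (\int[L]_(y in B4) `|w (y + vert a)%R - w y - h0 y|%:E = 0)%E.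
  apply/eqP; rewrite eq_le; apply/andP; split; last first.
    by apply: integral_ge0 => y _; rewrite lee_fin.
  apply: (@fibre_mean_value 0) => s _.
  apply: (@le_trans _ _ (N1 (fun y : 'rV[R]_n => h0 (y + s *: vert a) + -1 * h0 y)%R)); last first.
    by rewrite Nm.
  have mF : measurable_fun setT (fun y : 'rV[R]_n => `|h0 (y + s *: vert a) + -1 * h0 y|%:E).
    apply: measurable_abs_EFin; apply: measurable_funD; first exact: measurable_fun_shift.
    by apply: measurable_funM => //; exact: measurable_cst.
  have F0 (y : 'rV[R]_n) : (0 <= `|h0 (y + s *: vert a)%R + -1 * h0 y|%:E)%E by rewrite lee_fin.
  apply: (ge0_integralS_le L (mBr r4) _ mF _ F0).
  - by apply: measurable_abs_EFin; apply: measurable_funB => //; exact: measurable_fun_shift.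
  - by move=> y; rewrite lee_fin.
  - by move=> y _; rewrite mulN1r.
have mF : measurable_fun B4 (fun y => w (y + vert a) - w y - h0 y).
  by apply: measurable_funTS; apply: measurable_funB => //; exact: measurable_funB.
move=> /(integral_abs_null (mBr r4) mF) w0; apply: outer_null_subset (outer_nullU w0 a0) => y [yB fy].
have [h0y|/h0E] := eqVneq (h0 y) 0; last by right.
by left; split=> //; rewrite h0y subr0 wE// subr_eq0.
Qed.

End one_direction.

Lemma fibre_derivZ (t : R) a y : fibre_deriv (t *: a) y = t * fibre_deriv a y.
Proof.
rewrite /fibre_deriv mulr_sumr; apply: eq_bigr => j _.
by rewrite /fibre_dir -scalemxAl mxE mulrA.
Qed.

(** If [f] is invariant under all small vertical translations then its
    derivative, being the limit of the difference quotients in the mean,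
    vanishes. *)
Lemma fibre_deriv_eq0 a : `|a| <= r4 ->
  (forall t, 0 < t <= 1 ->
    oL [set y | B4 y /\ f (G (y + vert (t *: a))) != f (G y)] = 0%E) ->
  oL [set y | B4 y /\ fibre_deriv a y != 0] = 0%E.
Proof.
move=> a4 finv; set h0 := fibre_deriv a \_ B2.
have mh0 : measurable_fun setT h0 := measurable_fibre_deriv a4.
have B42 y : B4 y -> B2 y by apply: le_ball; rewrite /r2 /r4; move: rho0; lra.
suff : (\int[L]_(y in B4) `|h0 y|%:E = 0)%E.
  have mF : measurable_fun B4 h0 by exact: measurable_funTS.
  move=> /(integral_abs_null (mBr r4) mF) h00.
  apply: outer_null_subset h00 => y [yB fy]; split=> //.
  by rewrite /h0 /patch mem_set//; exact: B42.
have I0 : (0 <= \int[L]_(y in B4) `|h0 y|%:E)%E.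
  by apply: integral_ge0 => y _; rewrite lee_fin.
apply/eqP; rewrite eq_le I0 andbT; apply/lee_addgt0Pr => e e0; rewrite add0e.
(* Translations by less than [del] move [h0] by at most [e] in the mean; the
   step [t] is taken accordingly. *)
have [del del0 hdel] := transl_cont_L1 n0 mh0 (norm1_fibre_deriv a4) e0.
pose t := Num.min 1 (del / (`|vert a| + 1)).
have va1 : 0 < `|vert a| + 1 by rewrite ltr_wpDl.
have t0 : 0 < t by rewrite lt_min ltr01 divr_gt0.
have t1 : t <= 1 by rewrite ge_min lexx.
have tdel : t * `|vert a| < del.
  apply: (@lt_le_trans _ _ (t * (`|vert a| + 1))); first by rewrite ltr_pM2l// ltrDl.
  by rewrite -ler_pdivlMr// ge_min lexx orbT.
have ta4 : `|t *: a| <= r4.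
  by rewrite normrZ gtr0_norm//; apply: le_trans a4; rewrite ler_piMl.
have htE : fibre_deriv (t *: a) \_ B2 = (fun y => t * h0 y).
  by apply/funext => y; rewrite /h0 /patch; case: ifP => _; rewrite ?fibre_derivZ ?mulr0.
have mth : measurable_fun setT (fun y => t * h0 y).
  by apply: measurable_funM => //; exact: measurable_cst.
have MV : (\int[L]_(y in B4) `|pullback B2 G f (y + vert (t *: a))%R - pullback B2 G f y -
    t * h0 y|%:E <= (t * e)%:E)%E.
  have := @fibre_mean_value _ ta4 (t * e); rewrite htE; apply=> s /andP[s0 s1].
  have sd : `|s *: vert (t *: a)| < del.
    have t0' := ltW t0; rewrite -vertZ scalerA normrZ ger0_norm; last exact: mulr_ge0.
    by apply: le_lt_trans tdel; rewrite ler_wpM2r//; apply: ler_piMl.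
  have mF : measurable_fun setT (fun y : 'rV[R]_n => h0 (y + s *: vert (t *: a)) - h0 y).
    exact: measurable_transl.
  apply: (@le_trans _ _ (N1 (fun y : 'rV[R]_n => t * (h0 (y + s *: vert (t *: a)) - h0 y))%R)).
    have mG' := measurable_abs_EFin (measurable_funM (measurable_cst t) mF : measurable_fun setT _).
    apply: (ge0_integralS_le L (mBr r4) _ mG').
    - apply: measurable_abs_EFin; apply: measurable_funB => //.
      exact: (measurable_fun_shift _ mth).
    - by move=> y; rewrite lee_fin.
    - by move=> y; rewrite lee_fin.
    - by move=> y _; rewrite /= mulrBr.
  rewrite norm1Z// gtr0_norm// EFinM; apply: lee_wpmul2l; first by rewrite lee_fin ltW.
  exact: hdel.
have tinv : (\int[L]_(y in B4) `|t * h0 y|%:E <= (t * e)%:E)%E.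
  apply: le_trans MV; rewrite le_eqVlt; apply/orP; left; apply/eqP.
  have t01 : 0 < t <= 1 by rewrite t0.
  have [A [mA NA A0]] := borel_null_hull (finv t t01).
  apply: ge0_ae_eq_integral => //.
  - by apply: measurable_funTS; exact: measurable_abs_EFin.
  - apply: measurable_funTS; apply: measurable_abs_EFin; apply: measurable_funB => //.
    have mw := measurable_pullback (mBr r2) mGB2 mf.
    by apply: measurable_funB => //; exact: (measurable_fun_shift _ mw).
  exists A; split=> // y /= nE; apply: NA; move: nE => /not_implyP[yB nE].
  split=> //; apply: contra_notN nE => /eqP fy.
  have yta : B2 (y + vert (t *: a)).
    apply: (le_ball _ (ball_shift yB (le_trans (norm_vert _) ta4))).
    by rewrite /r2 /r4; move: rho0; lra.
  by rewrite (pullback_in _ _ yta) (pullback_in _ _ (B42 _ yB)) fy subrr sub0r normrN.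
have : (t%:E * \int[L]_(y in B4) `|h0 y|%:E <= (t * e)%:E)%E.
  apply: le_trans tinv; rewrite -ge0_integralZl_EFin//.
  - rewrite le_eqVlt; apply/orP; left; apply/eqP; apply: eq_integral => y _.
    by rewrite normrM gtr0_norm// EFinM.
  - by apply: measurable_funTS; exact: measurable_abs_EFin.
  - exact: ltW.
by rewrite EFinM lee_pmul2l// lte_fin.
Qed.

End fibre_derivative.

(** * Locally Lipschitz maps and maps of class C^1 *)

Section lip_near.
Context {R : realType}.
Implicit Types V W : normedModType R.

(** All that is used of the C^1 maps between charts: Lipschitz maps preserve null
    sets, which replaces a change of variables. *)
Definition lip_near V W (f : V -> W) (x : V) := exists C e : R,
  [/\ 0 <= C, 0 < e & forall y z, ball x e y -> ball x e z ->
    `|f y - f z| <= C * `|y - z|].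

Lemma lip_near_eq V W (f g : V -> W) x :
  (\forall y \near x, f y = g y) -> lip_near f x -> lip_near g x.
Proof.
move=> /nbhs_ballP[e' /= e'0 fg] [C [e [C0 e0 Cf]]].
exists C, (Num.min e e'); split=> //; first by rewrite lt_min e0.
have sub e1 y : Num.min e e' <= e1 -> ball x (Num.min e e') y -> ball x e1 y.
  by move=> le1; exact: le_ball.
move=> y z yx zx; rewrite -!fg.
- by apply: Cf; apply: sub => //; rewrite ge_min lexx.
- by apply: sub zx; rewrite ge_min lexx orbT.
- by apply: sub yx; rewrite ge_min lexx orbT.
Qed.

Lemma lip_near_continuous V W (f : V -> W) x : lip_near f x -> {for x, continuous f}.
Proof.
move=> [C [e [C0 e0 Cf]]]; apply/(@cvgrPdist_lt _ _ _ (nbhs x)) => eps eps0.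
near=> y; apply: (@le_lt_trans _ _ (C * `|x - y|)).
  apply: Cf; first exact: ballxx.
  by near: y; exact: nbhsx_ballx.
apply: (@le_lt_trans _ _ ((C + 1) * `|x - y|)); first by rewrite ler_wpM2r// lerDl.
rewrite -ltr_pdivlMl ?ltr_wpDl//.
near: y; apply: (@cvgr_dist_lt _ _ _ (nbhs x) _ id); first exact: cvg_id.
by rewrite mulr_gt0// invr_gt0 ltr_wpDl.
Unshelve. all: by end_near. Qed.

Lemma lip_near_cst V W (c : W) x : lip_near (fun _ : V => c) x.
Proof.
by exists 0, 1; split=> // y z _ _; rewrite subrr normr0 mul0r.
Qed.

Lemma lip_near_id V (x : V) : lip_near id x.
Proof. by exists 1, 1; split=> // y z _ _; rewrite mul1r. Qed.

Let min2 (a b : R) : 0 < a -> 0 < b ->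
  exists2 e, 0 < e & e <= a /\ e <= b.
Proof.
by move=> a0 b0; exists (Num.min a b); rewrite ?lt_min ?a0// !ge_min !lexx orbT.
Qed.

Lemma lip_near_add V W (f g : V -> W) x :
  lip_near f x -> lip_near g x -> lip_near (fun y => f y + g y) x.
Proof.
move=> [C [e [C0 e0 Cf]]] [D [a [D0 a0 Dg]]].
have [b b0 [be ba]] := min2 e0 a0.
exists (C + D), b; split=> //; first exact: addr_ge0.
move=> y z yx zx; rewrite opprD addrACA mulrDl.
apply: le_trans (ler_normD _ _) _; apply: lerD.
- by apply: Cf; exact: le_ball be _ _.
- by apply: Dg; exact: le_ball ba _ _.
Qed.

Lemma lip_near_comp V V' W (f : V -> V') (g : V' -> W) x :
  lip_near f x -> lip_near g (f x) -> lip_near (g \o f) x.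
Proof.
move=> lf [D [a [D0 a0 Dg]]].
have /lip_near_continuous/(_ _ (nbhsx_ballx _ _ a0))/nbhs_ballP[e' /= e'0 fe] := lf.
have [C [e [C0 e0 Cf]]] := lf.
have [b b0 [be be']] := min2 e0 e'0.
exists (D * C), b; split=> //; first exact: mulr_ge0.
move=> y z yx zx /=; apply: le_trans (Dg _ _ _ _) _.
- by apply: fe; exact: le_ball be' _ _.
- by apply: fe; exact: le_ball be' _ _.
- by rewrite -mulrA ler_wpM2l//; apply: Cf; exact: le_ball be _ _.
Qed.

Lemma lip_near_mul V (f g : V -> R) x :
  lip_near f x -> lip_near g x -> lip_near (fun y => f y * g y) x.
Proof.
move=> lf lg; have [C [e [C0 e0 Cf]]] := lf; have [D [a [D0 a0 Dg]]] := lg.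
have bd (h : V -> R) : lip_near h x -> exists2 e, 0 < e &
    forall y, ball x e y -> `|h y| <= `|h x| + 1.
  move=> /lip_near_continuous/(_ _ (nbhsx_ballx _ _ ltr01))/nbhs_ballP[r /= r0 hr].
  exists r => // y /hr; rewrite /= -ball_normE/= => hy.
  rewrite -[h y](subrK (h x)) addrC (le_trans (ler_normD _ _))// lerD2l.
  by rewrite distrC ltW.
have [e1 e10 f1] := bd _ lf; have [e2 e20 g2] := bd _ lg.
have [b b0 [be ba]] := min2 e0 a0.
have [c c0 [c1 c2]] := min2 e10 e20.
have [r r0 [rb rc]] := min2 b0 c0.
exists ((`|f x| + 1) * D + C * (`|g x| + 1)), r; split=> //.
  by rewrite addr_ge0// mulr_ge0// addr_ge0.
move=> y z yx zx.
rewrite (_ : _ - _ = f y * (g y - g z) + (f y - f z) * g z); last by ring.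
rewrite (le_trans (ler_normD _ _))// !normrM mulrDl lerD//.
- rewrite -mulrA ler_pM//.
  + by apply: f1; exact: le_ball (le_trans rc c1) _ _.
  + by apply: Dg; exact: le_ball (le_trans rb ba) _ _.
- rewrite mulrAC ler_pM//.
  + by apply: Cf; exact: le_ball (le_trans rb be) _ _.
  + by apply: g2; exact: le_ball (le_trans rc c2) _ _.
Qed.

Lemma lip_near_opp V W (f : V -> W) x : lip_near f x -> lip_near (fun y => - f y) x.
Proof.
move=> [C [e [C0 e0 Cf]]]; exists C, e; split=> // y z yx zx.
by rewrite -opprD normrN; exact: Cf.
Qed.

Lemma lip_near_sum V W (I : finType) (F : I -> V -> W) x :
  (forall i, lip_near (F i) x) -> lip_near (fun y => \sum_i F i y) x.
Proof.
move=> lF; have H (s : seq I) : lip_near (fun y => \sum_(i <- s) F i y) x.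
  elim: s => [|i s IH].
    by under eq_fun do rewrite big_nil; exact: lip_near_cst.
  by under eq_fun do rewrite big_cons; exact: lip_near_add.
exact: H.
Qed.

Lemma lip_near_coord V n (f : V -> 'rV[R]_n) x j :
  lip_near f x -> lip_near (fun y => f y ord0 j) x.
Proof.
move=> [C [e [C0 e0 Cf]]]; exists C, e; split=> // y z yx zx.
by have := rV_coord_le (f y - f z) j; rewrite !mxE => /le_trans; apply; exact: Cf.
Qed.

Lemma lip_near_row V n (f : V -> 'rV[R]_n) x :
  (forall j, lip_near (fun y => f y ord0 j) x) -> lip_near f x.
Proof.
move=> lf.
have : lip_near (fun y => \sum_j f y ord0 j *: (delta_mx ord0 j : 'rV[R]_n)) x.
  apply: lip_near_sum => j; have [C [e [C0 e0 Cf]]] := lf j.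
  exists (C * `|(delta_mx ord0 j : 'rV[R]_n)|), e; split=> //; first by rewrite mulr_ge0.
  by move=> y z yx zx; rewrite -scalerBl normrZ mulrAC ler_wpM2r//; exact: Cf.
by apply: lip_near_eq; near=> y; rewrite -row_sum_delta.
Unshelve. all: by end_near. Qed.

Lemma is_derive_line V W (f : V -> W) (z w : V) (t : R) :
  derivable f (z + t *: w) w ->
  is_derive t 1 (fun s : R => f (z + s *: w)) ('D_w f (z + t *: w)).
Proof.
move=> df.
have E : (fun h : R => h^-1 *: (f (z + (h *: (1 : R) + t) *: w) - f (z + t *: w))) =
         (fun h : R => h^-1 *: (f (h *: w + (z + t *: w)) - f (z + t *: w))).
  by apply/funext => h; rewrite [h *: 1]mulr1 scalerDl addrCA.
by split; [rewrite /derivable E|rewrite /derive E].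
Qed.

(** A map whose partial derivatives are bounded near a point is Lipschitz there,
    by the mean value theorem on segments. *)
Lemma Cn1_lip_near n m (U : set 'rV[R]_n) (f : 'rV[R]_n -> 'rV[R]_m) x :
  open U -> U x -> Cn 1 U f -> lip_near f x.
Proof.
move=> oU Ux [df cf]; apply: lip_near_row => i.
pose D (j : 'I_n) := 'D_(delta_mx ord0 j) f.
have /nbhs_ballP[e1 /= e10 e1U] : nbhs x U by apply: open_nbhs_nbhs.
have Dx j : \forall y \near x, `|D j y| < `|D j x| + 1.
  have cj : 'D_(delta_mx ord0 j) f @ x --> D j x := cf _ _ Ux.
  by apply: (cvgr_norm_lt _ cj); rewrite ltrDl.
have /nbhs_ballP[e2 /= e20 e2D] := filter_forall (nbhs_filter x) Dx.
have [e e0 [ee1 ee2]] := min2 e10 e20.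
exists (\sum_j (`|D j x| + 1)), e; split=> //; first by apply: sumr_ge0 => j _; rewrite addr_ge0.
move=> y z yx zx; pose w := y - z.
have inB (t : R) : 0 <= t <= 1 -> ball x e (z + t *: w).
  move=> /andP[t0 t1]; move: yx zx; rewrite -!ball_normE/= => yx zx.
  have -> : x - (z + t *: w) = t *: (x - y) + (1 - t) *: (x - z).
    apply/rowP => c; rewrite !mxE; ring.
  apply: le_lt_trans (ler_normD _ _) _; rewrite !normrZ !ger0_norm ?subr_ge0//.
  have [->|tn0] := eqVneq t 0; first by rewrite mul0r add0r subr0 mul1r.
  have tp : 0 < t by rewrite lt_neqAle eq_sym tn0.
  rewrite (_ : e = t * e + (1 - t) * e); last by ring.
  by apply: ltr_leD; [rewrite ltr_pM2l|rewrite ler_wpM2l ?subr_ge0// ltW].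
have isd (t : R) : 0 <= t <= 1 -> is_derive t 1 (fun s : R => f (z + s *: w) ord0 i)
    (('D_w f (z + t *: w)) ord0 i).
  move=> t01; have dfx : differentiable f (z + t *: w).
    by apply/df/e1U/(le_ball ee1)/inB.
  have dv : derivable f (z + t *: w) w by exact: diff_derivable.
  have [d1 d2] := is_derive_line dv.
  split; first by have /derivable_mxP := d1.
  by rewrite -d2 derive_mx// mxE.
have [c c01 E] : exists2 c, c \in `[0, 1]%R &
    f (z + 1 *: w) ord0 i - f (z + 0 *: w) ord0 i = ('D_w f (z + c *: w)) ord0 i * (1 - 0).
  apply: (@MVT_segment _ (fun s : R => f (z + s *: w) ord0 i)
     (fun c : R => ('D_w f (z + c *: w)) ord0 i)) => //.
    by move=> t t01; apply: isd; rewrite !(itvP t01).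
  apply: derivable_within_continuous => t t01.
  by have [] := isd t; rewrite ?(itvP t01).
move: E; rewrite scale0r addr0 scale1r (addrC z) /w subrK subr0 mulr1 => ->.
rewrite -/w deriveE; last by apply/df/e1U/(le_ball ee1)/inB; rewrite !(itvP c01).
have B2 : ball x e2 (z + c *: w) by apply/(le_ball ee2)/inB; rewrite !(itvP c01).
rewrite [w in 'd _ _ w]row_sum_delta linear_sum/= summxE mulr_suml.
apply: le_trans (ler_norm_sum _ _ _) _; apply: ler_sum => j _.
rewrite linearZ mxE normrM mulrC ler_pM ?rV_coord_le//.
rewrite -deriveE; last by apply/df/e1U/(le_ball ee1)/inB; rewrite !(itvP c01).
by apply: le_trans (rV_coord_le _ _) _; rewrite ltW//; exact: e2D.
Qed.

Lemma near_eq_differentiable V W (f g : V -> W) x :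
  (\forall y \near x, f y = g y) -> differentiable f x -> differentiable g x.
Proof.
move=> fg df.
have o : g \o shift x = cst (g x) + 'd f x +o_ 0 id.
  have fg0 : \forall y \near (0 : V), f (y + x) = g (y + x).
    by have := fg; rewrite (near_shift 0 x)/= subr0; exact: filterS.
  have /eqaddoP fo := diff_locally df.
  apply/eqaddoP => eps eps0; have := fo _ eps0; move: fg0; apply: filterS2.
  by move=> y /= E; rewrite !fctE /= E (nbhs_singleton fg).
have cd : continuous ('d f x) by exact: diff_continuous.
apply/diff_locallyP; have -> := diff_unique cd o.
by split.
Qed.

End lip_near.

Section Cn_on_open.
Context {R : realType} {n m : nat}.
Variables (A : set 'rV[R]_n) (f : 'rV[R]_n -> 'rV[R]_m) (x : 'rV[R]_n).
Hypotheses (oA : open A) (Ax : A x).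

Let local_rep s : Cn_on s A f -> exists U g, [/\ open U, U x, Cn s U g &
  \forall y \near x, g y = f y].
Proof.
move=> /(_ x Ax)[U [g [oU Ux Cg gf]]]; exists U, g; split=> //.
have := open_nbhs_nbhs (conj oA Ax); have := open_nbhs_nbhs (conj oU Ux).
by apply: filterS2 => y Uy Ay; exact: gf.
Qed.

Lemma Cn_on_differentiable s : Cn_on s.+1 A f -> differentiable f x.
Proof.
move=> /local_rep[U [g [oU Ux [dg _] gf]]].
exact: near_eq_differentiable gf (dg _ Ux).
Qed.

Lemma Cn_weaken s (U : set 'rV[R]_n) (g : 'rV[R]_n -> 'rV[R]_m) : open U -> Cn s.+1 U g -> Cn 1 U g.
Proof.
move=> oU; case: s => [//|s] [dg cg]; split=> // v y Uy.
by have [dv _] := cg v; apply/differentiable_continuous/dv.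
Qed.

Lemma Cn_on_lip_near s : Cn_on s.+1 A f -> lip_near f x.
Proof.
move=> /local_rep[U [g [oU Ux Cg gf]]].
apply: lip_near_eq gf _; exact: (Cn1_lip_near oU Ux (Cn_weaken oU Cg)).
Qed.

Lemma Cn_on_lip_near_derive s v : Cn_on s.+2 A f -> lip_near ('D_v f) x.
Proof.
move=> /local_rep[U [g [oU Ux [_ Cg] gf]]].
apply: (@lip_near_eq _ _ _ ('D_v g)).
  have := near_join gf; apply: filterS => y; exact: near_eq_derive.
exact: (Cn1_lip_near oU Ux (Cn_weaken oU (Cg v))).
Qed.

End Cn_on_open.

(** * Fibred charts of a tubular neighbourhood *)

Section block_rows.
Context {R : realType}.

Lemma dotE n (u v : 'rV[R]_n) : dot u v = (u *m v^T) ord0 ord0.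
Proof. by rewrite mxE; apply: eq_bigr => i _; rewrite mxE. Qed.

Lemma dot_eq0 n (u : 'rV[R]_n) : dot u u = 0 -> u = 0.
Proof.
move=> u0; apply/rowP => i; rewrite mxE; apply/eqP; rewrite -sqrf_eq0 expr2.
by move: u0 => /eqP; rewrite /dot psumr_eq0 => [/allP/(_ i (mem_index_enum _))|j _];
  rewrite // -expr2 sqr_ge0.
Qed.

Lemma mulmx_rsub (m n k d : nat) (A : 'M[R]_(m, n)) (B : 'M[R]_(n, k + d)) :
  A *m rsubmx B = rsubmx (A *m B).
Proof. by rewrite -{2}[B]hsubmxK mul_mx_row row_mxKr. Qed.

Lemma lsubmx_norm (k d : nat) (y : 'rV[R]_(k + d)) : `|lsubmx y| <= `|y|.
Proof. by apply: rV_norm_le => // i; rewrite mxE rV_coord_le. Qed.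

Lemma rsubmx_norm (k d : nat) (y : 'rV[R]_(k + d)) : `|rsubmx y| <= `|y|.
Proof. by apply: rV_norm_le => // i; rewrite mxE rV_coord_le. Qed.

Lemma row_mx_norm_le (k d : nat) (a : 'rV[R]_k) (b : 'rV[R]_d) (e : R) :
  `|a| <= e -> `|b| <= e -> `|row_mx a b| <= e.
Proof.
move=> ae be; apply: rV_norm_le => [|i]; first exact: le_trans ae.
case: (splitP i) => j ij.
  by rewrite (_ : i = lshift d j) ?row_mxEl ?(le_trans (rV_coord_le _ _))//; exact: val_inj.
by rewrite (_ : i = rshift k j) ?row_mxEr ?(le_trans (rV_coord_le _ _))//; exact: val_inj.
Qed.

Lemma mx_eq_rV m n (A B : 'M[R]_(m, n)) :
  (forall v : 'rV[R]_m, v *m A = v *m B) -> A = B.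
Proof. by move=> AB; apply/row_matrixP => i; rewrite !rowE. Qed.

End block_rows.

(** In the section below [psi] is a slice chart of [M] with inverse [q]. *)
Section slice_chart.
Context {R : realType} {k d : nat}.
Local Notation n := (k + d)%N.
Variables (M : set 'rV[R]_n) (r : nat) (V W : set 'rV[R]_n) (psi q : 'rV[R]_n -> 'rV[R]_n).
Hypotheses (r2 : (2 <= r)%N) (oV : open V) (oW : open W).
Hypotheses (psi_smooth : Cn_on r V psi) (q_smooth : Cn_on r W q).
Hypothesis psiV : forall x, V x -> W (psi x) /\ q (psi x) = x.
Hypothesis qW : forall w, W w -> V (q w) /\ psi (q w) = w.
Hypothesis slice : forall x, V x -> (M x <-> rsubmx (psi x) = 0).

Let r1 : r = r.-2.+2. Proof. by case: r r2 => [//|[]]. Qed.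

Let dpsi x : V x -> differentiable psi x.
Proof. by move=> Vx; apply: (@Cn_on_differentiable _ _ _ V _ _ oV Vx r.-2.+1); rewrite -r1. Qed.

Let dq w : W w -> differentiable q w.
Proof. by move=> Vx; apply: (@Cn_on_differentiable _ _ _ W _ _ oW Vx r.-2.+1); rewrite -r1. Qed.

Let lpsi x : V x -> lip_near psi x.
Proof. by move=> Vx; apply: (@Cn_on_lip_near _ _ _ V _ _ oV Vx r.-2.+1); rewrite -r1. Qed.

Let lq w : W w -> lip_near q w.
Proof. by move=> Vx; apply: (@Cn_on_lip_near _ _ _ W _ _ oW Vx r.-2.+1); rewrite -r1. Qed.

Let lJ (A : set 'rV[R]_n) (f : 'rV[R]_n -> 'rV[R]_n) x i j : open A -> A x -> Cn_on r A f ->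
  lip_near (fun y => jacobian f y i j) x.
Proof.
rewrite r1 => oA Ax fA; have := Cn_on_lip_near_derive oA Ax (delta_mx ord0 i) fA.
move=> /(@lip_near_coord _ _ _ _ _ j); apply: lip_near_eq.
have := open_nbhs_nbhs (conj oA Ax); apply: filterS => y Ay.
have dy := Cn_on_differentiable oA Ay fA.
by rewrite deriveEjacobian// -rowE mxE.
Qed.

Let jacobian_mul p : V p -> jacobian q (psi p) *m jacobian psi p = 1%:M.
Proof.
move=> Vp; have [Wp qp] := psiV Vp; apply: mx_eq_rV => v; rewrite mulmx1 mulmxA.
have dp : differentiable psi (q (psi p)) by rewrite qp; exact: dpsi.
rewrite -[X in jacobian psi X]qp -deriveEjacobian// deriveE//.
rewrite -deriveEjacobian; last exact: dq.
rewrite deriveE; last exact: dq.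
rewrite -[LHS]/(('d psi (q (psi p)) \o 'd q (psi p)) v).
rewrite -diff_comp//; last exact: dq.
rewrite -deriveE; last by apply: differentiable_comp => //; exact: dq.
rewrite (@near_eq_derive _ _ _ _ id); first by rewrite derive_id.
by have := open_nbhs_nbhs (conj oW Wp); apply: filterS => w /qW[].
Qed.

Let jacobian_mulC p : V p -> jacobian psi p *m jacobian q (psi p) = 1%:M.
Proof. by move=> /jacobian_mul/mulmx1C. Qed.

(** Curves in [M] have velocities killed by the differentials of the defining
    coordinates of [psi]; conversely such a vector is the velocity of the curve
    that is a straight line in the chart. *)
Lemma tangent_spaceP p v : V p -> M p ->
  tangent_space M p v <-> v *m rsubmx (jacobian psi p) = 0.
Proof.
move=> Vp Mp; have [Wp qp] := psiV Vp; rewrite mulmx_rsub.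
have psip0 : rsubmx (psi p) = 0 by apply/slice.
split=> [[gamma [e [e0 [dg _] gM g0 <-]]]|].
  have dg0 : differentiable gamma (0 : R^o) by apply: dg; exact: ballxx.
  have dpg : differentiable psi (gamma 0) by rewrite g0; exact: dpsi.
  rewrite -[X in jacobian psi X]g0 -deriveEjacobian// deriveE// deriveE//.
  rewrite -[X in rsubmx X]/(('d psi (gamma 0) \o 'd gamma (0 : R^o)) 1) -diff_comp//.
  have dc : differentiable (psi \o gamma) (0 : R^o) by exact: differentiable_comp.
  rewrite -deriveE//; apply/rowP => j; rewrite mxE derive_mx; last exact: diff_derivable.
  rewrite !mxE (@near_eq_derive _ _ _ _ (cst 0)); first by rewrite derive_cst.
  have cg : {for (0 : R^o), continuous gamma} by exact: differentiable_continuous.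
  have Vg : \forall t \near (0 : R^o), V (gamma t).
    by apply: cg; rewrite g0; apply: open_nbhs_nbhs; split.
  have := nbhsx_ballx (0 : R^o) _ e0; move: Vg; apply: filterS2 => t Vt /gM /(slice Vt).
  by move=> /rowP/(_ j); rewrite !mxE.
set w := v *m jacobian psi p => w0.
pose aff (t : R^o) : 'rV[R]_n := psi p + t *: w.
have laff t : lip_near aff t.
  apply: lip_near_add; first exact: lip_near_cst.
  exists `|w|, 1; split=> // y z _ _; by rewrite -scalerBl normrZ mulrC.
have isaff t : is_diff (t : R^o) aff (fun s : R^o => s *: w).
  have -> : aff = cst (psi p) + (fun s : R^o => s *: w) by [].
  have -> : (fun s : R^o => s *: w) = (0 : R^o -> 'rV[R]_n) + (fun s : R^o => s *: w).
    by rewrite add0r.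
  by rewrite {1}add0r; exact: is_diffD.
have : \forall t \near (0 : R^o), W (aff t).
  apply: (lip_near_continuous (laff 0)); apply: open_nbhs_nbhs; split=> //.
  by rewrite /aff scale0r addr0.
move=> /nbhs_ballP[e /= e0 eW].
have dgam t : ball (0 : R^o) e t -> differentiable (q \o aff) (t : R^o).
  by move=> /eW Wt; apply: differentiable_comp => //; exact: dq.
have Dgam s t : ball (0 : R^o) e t -> 'D_s (q \o aff) t = 'D_(s *: w) q (aff t).
  move=> et; have Wt := eW _ et.
  rewrite deriveE; last exact: dgam.
  rewrite diff_comp//; last exact: dq.
  by rewrite /= diff_val deriveE//; exact: dq.
have aff0 : aff 0 = psi p by rewrite /aff scale0r addr0.
exists (q \o aff), e; split=> //.
- split=> // s t et; apply: lip_near_continuous.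
  apply: (@lip_near_eq _ _ _ ('D_(s *: w) q \o aff)).
    have := open_nbhs_nbhs (conj (ball_open (0 : R^o) e) et).
    by apply: filterS => t' /Dgam ->.
  apply: lip_near_comp (laff _) _; have := q_smooth; rewrite r1 => qs.
  exact: (Cn_on_lip_near_derive oW (eW _ et) _ qs).
- move=> t /eW Wt; have [Vt E] := qW Wt; apply/slice => //; rewrite /= E /aff.
  by rewrite linearD linearZ /= psip0 w0 scaler0 addr0.
- by rewrite /= aff0.
- rewrite Dgam; last exact: ballxx.
  rewrite scale1r aff0 deriveEjacobian; last exact: dq.
  by rewrite /w -mulmxA jacobian_mulC// mulmx1.
Qed.

(** The rows of the Jacobian of [q] and the columns of that of [psi] are dual
    bases. The first [k] rows are tangent, so a normal vector has nonzero
    coefficients on the last [d] columns only. *)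
Lemma normal_vectorE p v : V p -> M p ->
  (forall w, tangent_space M p w -> dot v w = 0) ->
  v = rsubmx (v *m (jacobian q (psi p))^T) *m (rsubmx (jacobian psi p))^T.
Proof.
move=> Vp Mp vN; set J := jacobian psi p; set K := jacobian q (psi p).
have KJ : K *m J = 1%:M := jacobian_mul Vp.
have vE : v = v *m K^T *m J^T by rewrite -mulmxA -trmx_mul jacobian_mulC// trmx1 mulmx1.
have l0 : lsubmx (v *m K^T) = 0.
  apply/rowP => j; rewrite !mxE -[RHS](vN (row (lshift d j) K)).
    by apply: eq_bigr => i _; rewrite !mxE.
  apply/(tangent_spaceP _ Vp Mp); rewrite mulmx_rsub -row_mul KJ.
  by apply/rowP => i; rewrite !mxE eq_lrshift.
rewrite {1}vE -[v *m K^T]hsubmxK l0 -{1}[J]hsubmxK tr_row_mx mul_row_col mul0mx add0r.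
by rewrite row_mxKr.
Qed.

Definition base (a : 'rV[R]_k) : 'rV[R]_n := q (row_mx a 0).

(** The rows are the gradients of the last [d] coordinates of [psi], a basis of
    the normal space of [M] at [base a]. *)
Definition normals (a : 'rV[R]_k) : 'M[R]_(d, n) := (rsubmx (jacobian psi (base a)))^T.

Definition tube_map (y : 'rV[R]_n) : 'rV[R]_n :=
  base (lsubmx y) + rsubmx y *m normals (lsubmx y).

Lemma base_M a : W (row_mx a 0) -> M (base a).
Proof. by move=> /[dup] Wa /qW[Va E]; apply/slice => //; rewrite E row_mxKr. Qed.

Lemma tangent_baseP a v : W (row_mx a 0) ->
  tangent_space M (base a) v <-> v *m (normals a)^T = 0.
Proof.
by move=> Wa; rewrite trmxK; apply: tangent_spaceP (base_M Wa); have [] := qW Wa.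
Qed.

Lemma normals_normal a b w : W (row_mx a 0) -> tangent_space M (base a) w ->
  dot (b *m normals a) w = 0.
Proof.
move=> Wa /(tangent_baseP _ Wa) wN.
by rewrite dotE -mulmxA -[normals a *m _]trmxK trmx_mul trmxK wN trmx0 mulmx0 mxE.
Qed.

(** The Jacobians of [q] and [psi] are inverse to each other. *)
Lemma normals_row_free a : W (row_mx a 0) -> row_free (normals a).
Proof.
move=> Wa; have [Va E] := qW Wa; apply/row_freeP.
exists (dsubmx (jacobian q (psi (base a))))^T.
rewrite -trmx_mul mulmx_rsub; rewrite -[X in X^T = _]mulmx_rsub -/(base a).
set K := jacobian q _; set J := jacobian psi _.
have : dsubmx K *m J = dsubmx 1%:M by rewrite -(jacobian_mul Va) mul_dsub_mx.
move=> KJ; rewrite mulmx_rsub KJ.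
by apply/matrixP => i j; rewrite !mxE (inj_eq (@rshift_inj _ _)) eq_sym.
Qed.

(** Projecting orthogonally onto the kernel of a full rank matrix is solving the
    normal equations. *)
Lemma base_normal_proj (phi : 'rV[R]_n -> 'rV[R]_n) x v a : W (row_mx a 0) ->
  phi x = base a ->
  normal_proj M phi x v = 0 <-> v *m (normals a)^T = 0.
Proof.
move=> Wa phix; rewrite /normal_proj /tangent_proj /orth_proj phix.
set N := normals a; set T := tangent_space M (base a).
have TP w : T w <-> w *m N^T = 0 by exact: tangent_baseP.
set X := [set _ | _]; have X0 : X !=set0.
  have NN : N *m N^T \in unitmx.
    rewrite -row_free_unit -kermx_eq0; apply/eqP/row_matrixP => i.
    rewrite row0; set c := row i _.
    have : c *m (N *m N^T) = 0 by rewrite /c -row_mul mulmx_ker row0.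
    move=> cN; have : dot (c *m N) (c *m N) = 0.
      by rewrite dotE trmx_mul mulmxA -(mulmxA c) cN mul0mx mxE.
    move=> /dot_eq0 cN0; have /row_freeP[B NB] := normals_row_free Wa.
    by rewrite -[c]mulmx1 -NB mulmxA -/N cN0 mul0mx.
  exists (v - v *m N^T *m invmx (N *m N^T) *m N); split.
    by apply/TP; rewrite mulmxBl -!mulmxA mulVmx// mulmx1 subrr.
  by move=> z Tz; rewrite opprB addrC subrK; exact: normals_normal.
have [gT gN] : X (get X) by case: X0 => w; exact: getI.
split=> [/subr0_eq ->|vN]; first exact/TP.
apply: dot_eq0; apply: gN; apply/TP; rewrite mulmxBl vN.
by move/TP : gT => ->; rewrite subr0.
Qed.

Let lemb (y : 'rV[R]_n) : lip_near (fun y : 'rV[R]_n => row_mx (lsubmx y) 0 : 'rV[R]_n) y.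
Proof.
exists 1, 1; split=> // x z _ _; rewrite mul1r opp_row_mx add_row_mx subr0 -linearB.
by apply: row_mx_norm_le; [exact: lsubmx_norm|rewrite normr0].
Qed.

Lemma lip_near_base y : W (row_mx (lsubmx y) 0) -> lip_near (fun y : 'rV[R]_n => base (lsubmx y)) y.
Proof.
by move=> Wy; apply: (lip_near_comp (lemb y)); exact: lq.
Qed.

Lemma lip_near_normals y : W (row_mx (lsubmx y) 0) ->
  lip_near (fun y : 'rV[R]_n => rsubmx y *m normals (lsubmx y)) y.
Proof.
move=> Wy; have [Vy _] := qW Wy; apply: lip_near_row => j.
under eq_fun do rewrite mxE.
apply: lip_near_sum => i; apply: lip_near_mul.
  under eq_fun do rewrite mxE; exact/lip_near_coord/lip_near_id.
under eq_fun do rewrite /normals 2!mxE.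
exact: (lip_near_comp (lip_near_base Wy) (lJ j (rshift k i) oV Vy psi_smooth)).
Qed.

Lemma lip_near_tube_map y : W (row_mx (lsubmx y) 0) -> lip_near tube_map y.
Proof.
move=> Wy; apply: lip_near_add; [exact: lip_near_base|exact: lip_near_normals].
Qed.

Section tube_coord.
Variable phi : 'rV[R]_n -> 'rV[R]_n.

(** The inverse of [tube_map]: [phi x] gives the base point, and by
    [normal_vectorE] the coefficients of [x - phi x] in the basis of normals are
    its products with the dual vectors. *)
Definition tube_coord (x : 'rV[R]_n) : 'rV[R]_n :=
  row_mx (lsubmx (psi (phi x))) (rsubmx ((x - phi x) *m (jacobian q (psi (phi x)))^T)).

Lemma lip_near_tube_coord x : V (phi x) -> lip_near phi x -> lip_near tube_coord x.
Proof.
move=> Vx lphi; have [Wx _] := psiV Vx.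
have lpp : lip_near (psi \o phi) x := lip_near_comp lphi (lpsi Vx).
apply: lip_near_row => j; case: (splitP j) => i ji.
  have -> : j = lshift d i by exact: val_inj.
  by under eq_fun do rewrite row_mxEl mxE; exact: (lip_near_coord _ lpp).
have -> : j = rshift k i by exact: val_inj.
under eq_fun do rewrite row_mxEr !mxE.
apply: lip_near_sum => c; apply: lip_near_mul.
  under eq_fun do rewrite !mxE; apply: lip_near_add; first exact/lip_near_coord/lip_near_id.
  exact/lip_near_opp/lip_near_coord.
under eq_fun do rewrite mxE.
exact: (lip_near_comp lpp (lJ _ _ oW Wx q_smooth)).
Qed.

Lemma tube_mapK y : W (row_mx (lsubmx y) 0) -> phi (tube_map y) = base (lsubmx y) ->
  tube_coord (tube_map y) = y.
Proof.
move=> Wy phiy; have [Vy E] := qW Wy; rewrite /tube_coord phiy E row_mxKl.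
rewrite /tube_map addrC addKr -mulmxA -trmx_mul mulmx_rsub.
have -> : jacobian q (row_mx (lsubmx y) 0) *m jacobian psi (base (lsubmx y)) = 1%:M.
  by rewrite -[X in jacobian q X]E; exact: jacobian_mul.
have -> : (rsubmx (1%:M : 'M[R]_n))^T = row_mx 0 1%:M.
  by rewrite scalar_mx_block block_mxEh row_mxKr tr_col_mx trmx0 trmx1.
by rewrite mul_mx_row mulmx0 mulmx1 row_mxKr hsubmxK.
Qed.

Lemma tube_coordK x : V (phi x) -> M (phi x) ->
  (forall w, tangent_space M (phi x) w -> dot (x - phi x) w = 0) ->
  tube_map (tube_coord x) = x.
Proof.
move=> Vx Mx xN; have [Wx E] := psiV Vx; rewrite /tube_map /tube_coord row_mxKl row_mxKr.
have psiE : row_mx (lsubmx (psi (phi x))) 0 = psi (phi x).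
  by rewrite -[RHS]hsubmxK; congr row_mx; apply/esym/slice.
by rewrite /normals /base psiE E -normal_vectorE// addrC subrK.
Qed.

End tube_coord.

End slice_chart.

(** A bi-Lipschitz parametrization [G] of a piece of [D] for which the fibres of
    [phi] are vertical slices and the rows of [nm] span the normal space. The
    margin [R0] leaves room for mollification. *)
Record fibred_chart {R : realType} {k d : nat} (M : set 'rV[R]_(k + d))
    (phi : 'rV[R]_(k + d) -> 'rV[R]_(k + d)) (D : set 'rV[R]_(k + d))
    (y0 : 'rV[R]_(k + d)) (rho C R0 : R) (G : 'rV[R]_(k + d) -> 'rV[R]_(k + d))
    (q : 'rV[R]_k -> 'rV[R]_(k + d)) (nm : 'rV[R]_k -> 'M[R]_(d, k + d)) : Prop :=
  FibredChart {
  chart_rho0 : 0 < rho;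
  chart_C0 : 0 < C;
  chart_R00 : 0 < R0;
  chart_E : forall y, ball y0 rho y -> G y = q (lsubmx y) + rsubmx y *m nm (lsubmx y);
  chart_lip : forall x y, ball y0 rho x -> ball y0 rho y -> `|G x - G y| <= C * `|x - y|;
  chart_expand : forall x y, ball y0 rho x -> ball y0 rho y -> `|x - y| <= C * `|G x - G y|;
  chart_cube : forall y, ball y0 rho y -> cube (G y) R0 `<=` D;
  chart_base_lip : forall a b, ball (lsubmx y0) rho a -> ball (lsubmx y0) rho b ->
    `|q a - q b| <= C * `|a - b|;
  chart_base_expand : forall a b, ball (lsubmx y0) rho a -> ball (lsubmx y0) rho b ->
    `|a - b| <= C * `|q a - q b|;
  chart_base : forall a, ball (lsubmx y0) rho a -> M (q a);
  chart_phi : forall y, ball y0 rho y -> phi (G y) = q (lsubmx y);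
  chart_proj : forall y v, ball y0 rho y ->
    (normal_proj M phi (G y) v = 0 <-> v *m (nm (lsubmx y))^T = 0) }.

Section fibred_chart_exists.
Context {R : realType} {k d : nat}.
Local Notation n := (k + d)%N.
Variables (M : set 'rV[R]_n) (r : nat) (U : set 'rV[R]_n) (phi : 'rV[R]_n -> 'rV[R]_n).
Hypotheses (r2 : (2 <= r)%N) (Mr : submanifold r k M) (tub : tubular_neighborhood r.-1 M U phi).

Lemma tubular_normal x : U x ->
  M (phi x) /\ forall w, tangent_space M (phi x) w -> dot (x - phi x) w = 0.
Proof.
have [oU _ _ [N0 [ [ O1 oO N0E] _ _ [_ [g [_ _ gU]]] N0phi]]] := tub.
move=> /gU[]; case: (g x) => p v /= pv <-; rewrite (N0phi _ _ pv).
move: pv; rewrite N0E => -[[Mp vN] _]; split=> // w /vN.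
by rewrite addrC addKr.
Qed.

Lemma tubular_lip_near x : U x -> lip_near phi x.
Proof.
have [oU Cphi _ _] := tub => Ux; apply: (@Cn_on_lip_near _ _ _ U _ _ oU Ux r.-2).
by case: r r2 Cphi => [//|[//|]].
Qed.

(** The chart is [tube_map] near the coordinates of [x0]; every condition holds
    near that point, and the image of a ball contains a neighbourhood of [x0]
    because the coordinates are continuous there. The radius [rho / 8] is the one
    to which the analysis on the ball of radius [rho] shrinks. *)
Lemma fibred_chart_exists (D : set 'rV[R]_n) (x0 : 'rV[R]_n) :
  open D -> D x0 -> D `<=` U ->
  exists y0 rho C R0 G q nm, fibred_chart M phi D y0 rho C R0 G q nm /\
    nbhs x0 (G @` ball y0 (rho / 8)).
Proof.
move=> oD Dx0 DU; have Ux0 := DU _ Dx0.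
have [Mp0 x0N] := tubular_normal Ux0.
have [V [W [psi [oV Vp0 oW [psiC [q [qC psiV qW]]] sl]]]] := Mr Mp0.
have slice x : V x -> (M x <-> rsubmx (psi x) = 0).
  move=> /sl Mx; split=> [/Mx psi0|/rowP psi0].
    by apply/rowP => j; rewrite !mxE psi0// /= leq_addr.
  apply/Mx => i ki; case: (splitP i) => j ij; first by have := ltn_ord j; rewrite -ij ltnNge ki.
  have -> : i = rshift k j by exact: val_inj.
  by have := psi0 j; rewrite !mxE.
pose G := tube_map psi q; pose H := tube_coord psi q phi.
pose Q (y : 'rV[R]_n) := base q (lsubmx y).
pose y0 := H x0.
have GHK x : U x -> V (phi x) -> G (H x) = x.
  move=> Ux Vx; have [Mx xN] := tubular_normal Ux.
  exact: (tube_coordK r2 oV oW psiC qC psiV qW slice).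
have Gy0 : G y0 = x0 by exact: GHK.
have [Wp0 qp0] := psiV _ Vp0.
have emby0 : row_mx (lsubmx y0) 0 = psi (phi x0).
  rewrite /y0 /H /tube_coord row_mxKl -[RHS]hsubmxK; congr row_mx.
  exact/esym/slice.
have Wy0 : W (row_mx (lsubmx y0) 0) by rewrite emby0.
have Qy0 : Q y0 = phi x0 by rewrite /Q /base emby0.
have lphi := tubular_lip_near Ux0.
have lH : lip_near H x0 by exact: (lip_near_tube_coord r2 oV oW psiC qC psiV).
have lG : lip_near G y0 by exact: (lip_near_tube_map r2 oV oW psiC qC qW).
have lQ : lip_near Q y0 by exact: (lip_near_base r2 oW qC).
have lN : lip_near (fun y : 'rV[R]_n => rsubmx y *m normals psi q (lsubmx y)) y0.
  exact: (lip_near_normals r2 oV oW psiC qC qW).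
have lpsi : lip_near psi (phi x0).
  by apply: (@Cn_on_lip_near _ _ _ V _ _ oV Vp0 r.-1); rewrite prednK// (leq_trans _ r2).
have cG : {for y0, continuous G} := lip_near_continuous lG.
have cQ : {for y0, continuous Q} := lip_near_continuous lQ.
have cN := lip_near_continuous lN.
have lE : lip_near (fun y : 'rV[R]_n => row_mx (lsubmx y) 0 : 'rV[R]_n) y0.
  exists 1, 1; split=> // x z _ _; rewrite mul1r opp_row_mx add_row_mx subr0 -linearB.
  by apply: row_mx_norm_le; [exact: lsubmx_norm|rewrite normr0].
have nW : \forall y \near y0, W (row_mx (lsubmx y) 0).
  by apply: (lip_near_continuous lE); apply: open_nbhs_nbhs.
have [_ _ _ [N0 [ [ O1 oO N0E] _ _ [_ [g [_ _ gU]]] N0phi]]] := tub.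
have Ox0 : O1 (phi x0, x0 - phi x0).
  have [] := gU _ Ux0; case: (g x0) => p v /= pv pvx; move: (N0phi _ _ pv); rewrite pvx => ->.
  by rewrite -pvx addrC addKr; move: pv; rewrite N0E => -[].
have nO : \forall y \near y0, O1 (Q y, rsubmx y *m normals psi q (lsubmx y)).
  have nO1 : nbhs (Q y0, rsubmx y0 *m normals psi q (lsubmx y0)) O1.
    apply: open_nbhs_nbhs; split=> //.
    have -> : rsubmx y0 *m normals psi q (lsubmx y0) = x0 - phi x0.
      by rewrite -[X in _ = X - _]Gy0 -Qy0 /G /tube_map addrC addKr.
    by rewrite Qy0.
  exact: (cvg_pair cQ cN nO1).
have phiG y : W (row_mx (lsubmx y) 0) -> O1 (Q y, rsubmx y *m normals psi q (lsubmx y)) ->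
    phi (G y) = Q y.
  move=> Wy Oy; apply: N0phi; rewrite N0E; split=> //; split=> /=.
    exact: (base_M qW slice).
  by move=> w; exact: (normals_normal r2 oV oW psiC qC psiV qW slice).
have [CG [eG [CG0 eG0 GL]]] := lG.
have [CH [eH [CH0 eH0 HL]]] := lH.
have [CQ [eQ [CQ0 eQ0 QL]]] := lQ.
have [CP [eP [CP0 eP0 PL]]] := lpsi.
have nGH : \forall y \near y0, ball x0 eH (G y).
  by apply: cG; rewrite -/G Gy0; exact: nbhsx_ballx.
have nQP : \forall y \near y0, ball (phi x0) eP (Q y).
  by apply: cQ; rewrite Qy0; exact: nbhsx_ballx.
have /nbhs_ballP[r0 /= r00 r0D] : nbhs x0 D by exact: open_nbhs_nbhs.
pose R0 := r0 / 2; have R00 : 0 < R0 by rewrite divr_gt0.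
have nR0 : \forall y \near y0, ball x0 R0 (G y).
  by apply: cG; rewrite -/G Gy0; exact: nbhsx_ballx.
have : \forall y \near y0, [/\ W (row_mx (lsubmx y) 0),
    O1 (Q y, rsubmx y *m normals psi q (lsubmx y)), ball x0 eH (G y),
    ball (phi x0) eP (Q y) & ball x0 R0 (G y)].
  by near=> y; split; near: y.
move=> /nbhs_ballP[e1 /= e10 near1].
pose rho := Num.min e1 (Num.min eG eQ).
have rho0 : 0 < rho by rewrite !lt_min e10 eG0.
have rho1 y : ball y0 rho y -> ball y0 e1 y by apply: le_ball; rewrite ge_min lexx.
have rhoG y : ball y0 rho y -> ball y0 eG y by apply: le_ball; rewrite !ge_min lexx !orbT.
have rhoQ y : ball y0 rho y -> ball y0 eQ y by apply: le_ball; rewrite !ge_min lexx !orbT.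
pose C := CG + CH + CQ + CP + 1.
have lift a : ball (lsubmx y0) rho a -> ball y0 rho (row_mx a (rsubmx y0)).
  rewrite -!ball_normE/= => ya; rewrite -{1}[y0]hsubmxK opp_row_mx add_row_mx subrr.
  by apply: le_lt_trans ya; apply: row_mx_norm_le; rewrite ?normr0.
have Cle (c : R) (X Y : R) : c <= C -> 0 <= Y -> X <= c * Y -> X <= C * Y.
  by move=> cC Y0 /le_trans; apply; rewrite ler_wpM2r.
exists y0, rho, C, R0, G, (base q), (normals psi q); split; last first.
  have nU : \forall x \near x0, U x by have [oU _ _ _] := tub; exact: open_nbhs_nbhs.
  have nV : \forall x \near x0, V (phi x).
    by apply: (lip_near_continuous lphi); exact: open_nbhs_nbhs.
  have nB : \forall x \near x0, ball y0 (rho / 8) (H x).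
    by apply: (lip_near_continuous lH); apply: nbhsx_ballx; rewrite divr_gt0.
  by near=> x; exists (H x); [near: x|apply: GHK; near: x].
split=> //.
- by rewrite /C; move: CG0 CH0 CQ0 CP0; lra.
- move=> x y xB yB; apply: (Cle CG); rewrite //; first by rewrite /C; move: CH0 CQ0 CP0; lra.
  by apply: GL; exact: rhoG.
- move=> x y xB yB; have [Wx Ox xH _ _] := near1 _ (rho1 _ xB).
  have [Wy Oy yH _ _] := near1 _ (rho1 _ yB).
  apply: (Cle CH) => //; first by rewrite /C; move: CG0 CQ0 CP0; lra.
  have HGK z (Wz : W (row_mx (lsubmx z) 0)) : phi (G z) = Q z -> H (G z) = z.
    exact: (tube_mapK r2 oV oW psiC qC psiV qW Wz).
  have Hx := HGK x Wx (phiG _ Wx Ox); have Hy := HGK y Wy (phiG _ Wy Oy).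
  have HLxy : `|H (G x) - H (G y)| <= CH * `|G x - G y| := HL (G x) (G y) xH yH.
  clearbody G H.

  rewrite Hx Hy in HLxy.
  exact: HLxy.
- move=> y yB z; have [_ _ _ _ yR] := near1 _ (rho1 _ yB) => zR; apply: r0D.
  move: zR yR; rewrite -!ball_normE /cube/= => zR yR.
  rewrite -(subrKA (G y)) (le_lt_trans (ler_normD _ _))// [ltRHS]splitr.
  by apply: ltr_leD; rewrite // distrC.
- move=> a b /lift aB /lift bB; apply: (Cle CQ) => //.
    by rewrite /C; move: CG0 CH0 CP0; lra.
  have := QL _ _ (rhoQ _ aB) (rhoQ _ bB); rewrite /Q !row_mxKl => /le_trans; apply.
  rewrite ler_wpM2l// opp_row_mx add_row_mx subrr.
  by apply: row_mx_norm_le; rewrite ?normr0.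
- move=> a b /lift aB /lift bB; have [Wx _ _ xP _] := near1 _ (rho1 _ aB).
  have [Wy _ _ yP _] := near1 _ (rho1 _ bB).
  apply: (Cle CP) => //; first by rewrite /C; move: CG0 CH0 CQ0; lra.
  move: Wx xP Wy yP; rewrite /Q !row_mxKl => Wx xP Wy yP.
  have := PL _ _ xP yP; rewrite /base; have [_ ->] := qW _ Wx; have [_ ->] := qW _ Wy.
  apply: le_trans; rewrite opp_row_mx add_row_mx subrr.
  by have := lsubmx_norm (row_mx (a - b) (0 : 'rV[R]_d)); rewrite row_mxKl.
- move=> a /lift aB; have [Wx _ _ _ _] := near1 _ (rho1 _ aB).
  by apply: (base_M qW slice); move: Wx; rewrite row_mxKl.
- by move=> y /rho1/near1[Wy Oy _ _ _]; exact: phiG.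
- move=> y v /rho1/near1[Wy Oy _ _ _].
  by apply: (base_normal_proj r2 oV oW psiC qC psiV qW slice) => //; exact: phiG.
Unshelve. all: by end_near. Qed.

End fibred_chart_exists.

(** * Borel versions of Sobolev functions *)

Section borel_version.
Context {R : realType} {n : nat}.
Hypothesis n0 : (0 < n)%N.
Local Notation T := (lebesgue_rV R n).
Local Notation mu := (@lebesgue R n).
Local Notation L := (borel_lebesgue R n).
Local Notation oL := (outer_lebesgue R n).
Local Notation N1 := (norm1 L).

Lemma borel_version (K : set 'rV[R]_n) (u : 'rV[R]_n -> R) : measurable K ->
  mu.-integrable (K : set T) (fun x => (u x)%:E) ->
  exists f : 'rV[R]_n -> R, [/\ measurable_fun setT f, (N1 f < +oo)%E,
    forall x, ~ K x -> f x = 0 & oL [set x | K x /\ f x != u x] = 0%E].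
Proof.
move=> mK iu; have /integrableP[mu' fu] := iu.
have muK : measurable_fun (K : set T) (u : T -> measurableTypeR R) by exact/measurable_EFinP.
have [N [mN N0 mf]] := borel_representative mK muK.
exists (u \_ (K `\` N)); split=> //.
- have mKT := borel_measurable_lebesgue mK.
  apply: le_lt_trans fu; rewrite /norm1 -ge0_integral_lebesgue; last 2 first.
  + exact: measurable_abs_EFin.
  + by move=> x; rewrite lee_fin.
  have mfT : measurable_fun (setT : set T) (u \_ (K `\` N) : T -> measurableTypeR R).
    by move=> _ A mA; apply: borel_measurable_lebesgue; exact: mf.
  rewrite [leRHS]integral_mkcond; apply: (ge0_le_integral _ measurableT).
  + by move=> x _; rewrite lee_fin.
  + by apply/measurable_EFinP; apply: (measurableT_comp _ mfT).
  + by apply/(measurable_restrictT _ mKT); apply: (measurableT_comp _ mu').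
  + move=> x _; rewrite /patch; case: ifPn => [/set_mem[Kx _]|_]; first by rewrite mem_set.
    by rewrite normr0; case: ifP => // _; rewrite abse_ge0.
- by move=> x Kx; rewrite /patch; case: ifPn => // /set_mem[].
- apply: (@outer_null_subset _ _ _ N); last by rewrite outer_lebesgueE.
  move=> x [Kx]; apply: contraPP => Nx; apply/negP; rewrite negbK.
  by rewrite /patch mem_set.
Qed.

(** On a set of finite measure, [|u| <= 1 + u ^ 2] suffices. *)
Lemma square_integrable_integrable (Omega K : set 'rV[R]_n) (u : 'rV[R]_n -> R) :
  open Omega -> measurable K -> (L K < +oo)%E -> K `<=` Omega ->
  square_integrable Omega u -> mu.-integrable (K : set T) (fun x => (u x)%:E).
Proof.
move=> oO mK LK KO [mu' fu].
have mKT := borel_measurable_lebesgue mK.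
have mOT := borel_measurable_lebesgue (open_measurable_rV oO).
have muK : measurable_fun (K : set T) (u : T -> measurableTypeR R) by exact: measurable_funS mu'.
have mu2 : measurable_fun (Omega : set T) (fun x : T => ((u x) ^+ 2)%:E).
  by apply/measurable_EFinP; exact: measurable_funX.
have mu2K : measurable_fun (K : set T) (fun x : T => ((u x) ^+ 2)%:E) by exact: measurable_funS mu2.
apply/integrableP; split; first exact/measurable_EFinP.
apply: (@le_lt_trans _ _ (\int[mu]_(x in K) (1 + ((u x) ^+ 2)%:E))%E).
  apply: (ge0_le_integral _ mKT).
  - by move=> x _; rewrite abse_ge0.
  - by apply: (measurableT_comp _ (_ : measurable_fun _ (fun x : T => (u x)%:E))); last exact/measurable_EFinP.
  - by apply: emeasurable_funD => //; exact: measurable_cst.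
  - move=> x _; rewrite -EFinD lee_fin.
    have [u0|u0] := leP 0 (u x); first by rewrite ger0_norm//; nra.
    by rewrite ltr0_norm//; nra.
rewrite ge0_integralD//; last by move=> x _; rewrite lee_fin sqr_ge0.
rewrite integral_cst// mul1e; apply: lte_add_pinfty.
  by rewrite -(outer_lebesgueE mK) in LK; exact: LK.
apply: le_lt_trans fu; apply: ge0_subset_integral => //.
by move=> x _; rewrite lee_fin sqr_ge0.
Qed.

Lemma integral_borel_version (Omega K : set 'rV[R]_n) (u f psi : 'rV[R]_n -> R) :
  measurable K -> K `<=` Omega ->
  measurable_fun (K : set T) (u : T -> measurableTypeR R) -> measurable_fun setT f ->
  measurable_fun setT psi ->
  oL [set x | K x /\ f x != u x] = 0%E -> (forall x, ~ K x -> psi x = 0) ->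
  \int[mu]_(x in Omega) (u x * psi x) = \int[L]_x (f x * psi x).
Proof.
move=> mK KO muK mf mpsi fu psi0; have mKT := borel_measurable_lebesgue mK.
have toT (h : 'rV[R]_n -> R) : measurable_fun setT h ->
    measurable_fun (setT : set T) (h : T -> measurableTypeR R).
  by move=> mh _ A mA; apply: borel_measurable_lebesgue; exact: mh.
rewrite /Rintegral; congr fine.
have E : ((fun x => (u x * psi x)%:E) \_ Omega) = ((fun x => (u x * psi x)%:E) \_ K).
  apply/funext => x; rewrite /patch; case: ifPn => [/set_mem Ox|Ox].
    by case: ifPn => // /negP Kx; rewrite psi0 ?mulr0// => Kx'; apply: Kx; exact: mem_set.
  case: ifPn => // /set_mem/KO Kx; by rewrite mem_set in Ox.
rewrite integral_mkcond E -integral_mkcond.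
transitivity (\int[mu]_(x in K) (f x * psi x)%:E)%E.
  apply: (ae_eq_integral _ _ mKT).
  - by apply/measurable_EFinP; apply: measurable_funM => //; apply: measurable_funTS; exact: toT.
  - by apply/measurable_EFinP; apply: measurable_funM; apply: measurable_funTS; exact: toT.
  - apply/lebesgue_aeP; apply: outer_null_subset fu => x /= /not_implyP[Kx ne]; split=> //.
    by apply: contra_notN ne => /eqP ->.
rewrite -integral_lebesgue; last by apply/measurable_EFinP; exact: measurable_funM.
rewrite integral_mkcond; apply: eq_integral => x _.
rewrite /patch; case: ifPn => // /negP Kx; rewrite psi0 ?mulr0// => Kx'.
by apply: Kx; exact: mem_set.
Qed.

(** Mollifiers centred in the cube are test functions that see neither what
    happens outside of the cube nor on null sets. *)
Lemma sobolev_borel_version (Omega : set 'rV[R]_n) (u : 'rV[R]_n -> R) grad_u x0 r :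
  open Omega -> square_integrable Omega u -> weak_gradient Omega u grad_u ->
  cube x0 r `<=` Omega ->
  exists f (g : 'I_n -> 'rV[R]_n -> R), [/\ measurable_fun setT f /\ (N1 f < +oo)%E,
    forall j, measurable_fun setT (g j) /\ (N1 (g j) < +oo)%E,
    weak_grad_on (cube x0 r) f g,
    oL [set x | cube x0 r x /\ f x != u x] = 0%E &
    forall j, oL [set x | cube x0 r x /\ g j x != grad_u x ord0 j] = 0%E].
Proof.
move=> oO u2 wu KO; set K := cube x0 r.
have mK : measurable K := measurable_cube _ _.
have iu := square_integrable_integrable oO mK (lebesgue_cube_lty n0 _ _) KO u2.
have [f [mf Nf f0 fu]] := borel_version mK iu.
have ig j : mu.-integrable (K : set T) (fun x => (grad_u x ord0 j)%:E).
  by have [lg _] := wu j; apply: lg => //; exact: (@compact_cube).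
have /choice[g gP] j := borel_version mK (ig j).
have muK h : mu.-integrable (K : set T) (fun x => (h x)%:E) ->
    measurable_fun (K : set T) (h : T -> measurableTypeR R).
  by move=> /integrableP[/measurable_EFinP].
exists f, g; split; [by []| | |by []|].
- by move=> j; have [] := gP j.
- move=> phi rho c sphi supp cK j; rewrite /conv.
  have [mg Ng g0 gu] := gP j.
  have sD := smooth_expr_derive (delta_mx ord0 j) sphi.
  have out (h : 'rV[R]_n -> R) : (forall x, rho < `|x| -> h x = 0) ->
      forall x, ~ K x -> h (x - c) = 0.
    move=> h0 x Kx; apply: h0; rewrite ltNge; apply/negP => xc; apply: Kx; exact: cK.
  have mD := measurable_fun_shift (- c) (measurable_smooth sD).
  have mphi := measurable_fun_shift (- c) (measurable_smooth sphi).
  have D0 := out ('D_(delta_mx ord0 j) (phi : _ -> R^o)) (fun x => derive_support _ supp).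
  have phi0 := out phi (fun x => small_supportP supp).
  rewrite -(integral_borel_version mK KO (muK _ iu) mf mD fu D0).
  rewrite -(integral_borel_version mK KO (muK _ (ig j)) mg mphi gu phi0).
  have [_ wuj] := wu j; have := wuj _ (test_function_shift sphi supp (subset_trans cK KO)).
  by under eq_Rintegral do rewrite derive_shift.
- by move=> j; have [] := gP j.
Qed.

End borel_version.

(** * Functions invariant along the fibres of a product *)

Section null_sections.
Context {R : realType}.

Lemma integral_eq0_null n (F : 'rV[R]_n -> \bar R) : measurable_fun setT F ->
  (forall x, 0 <= F x)%E ->
  (\int[borel_lebesgue R n]_x F x = 0)%E <-> outer_lebesgue R n [set x | F x != 0%E] = 0%E.
Proof.
move=> mF F0; have E := ae_eq_integral_abs (borel_lebesgue R n) measurableT mF.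
have Eset : [set x | F x != 0%E] = ~` [set x | setT x -> F x = cst 0%E x].
  apply/seteqP; split=> x /=; first by move=> /eqP F0' /(_ Logic.I).
  by move=> FN; apply/eqP => F0'; apply: FN.
have abs0 : (\int[borel_lebesgue R n]_x `|F x| = \int[borel_lebesgue R n]_x F x)%E.
  by apply: eq_integral => x _; rewrite gee0_abs.
rewrite -abs0; split=> [/E[A [mA A0 DA]]|F0'].
  apply: (@outer_null_subset _ _ _ A); last by rewrite outer_lebesgueE.
  by rewrite Eset.
apply/E; have [A [mA DA A0]] := borel_null_hull F0'.
by exists A; split=> //; rewrite -[X in X `<=` _]Eset.
Qed.

Lemma null_slices k d (A : set 'rV[R]_(k + d)) : outer_lebesgue R (k + d) A = 0%E ->
  outer_lebesgue R k [set a | outer_lebesgue R d (slice A a) != 0%E] = 0%E.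
Proof.
move=> /borel_null_hull[B [mB AB B0]].
have [mF E] := borel_lebesgue_slice mB; rewrite B0 in E.
have /(integral_eq0_null mF (fun _ => measure_ge0 _ _)) := esym E.
apply: outer_null_subset => a; apply: contraNN => /eqP Ba; apply/eqP.
apply: (@outer_null_subset _ _ _ (slice B a)); first by move=> z; exact: AB.
by rewrite outer_lebesgueE//; exact: measurable_slice.
Qed.

Lemma slices_null k d (A : set 'rV[R]_(k + d)) : measurable A ->
  outer_lebesgue R k [set a | outer_lebesgue R d (slice A a) != 0%E] = 0%E ->
  outer_lebesgue R (k + d) A = 0%E.
Proof.
move=> mA A0; have [mF E] := borel_lebesgue_slice mA.
rewrite outer_lebesgueE// E; apply/(integral_eq0_null mF); first by move=> a; exact: measure_ge0.
apply: outer_null_subset A0 => a /=.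
by rewrite outer_lebesgueE//; exact: measurable_slice.
Qed.

(** Tonelli's theorem: the set is null for the product measure, computed with the
    sections of one kind, so almost all sections of the other kind are null. *)
Lemma null_sections n d (A : set ('rV[R]_n * 'rV[R]_d)) : measurable A ->
  (forall a, borel_lebesgue R n (ysection A a) = 0%E) ->
  outer_lebesgue R n [set y | borel_lebesgue R d (xsection A y) != 0%E] = 0%E.
Proof.
move=> mA A0; apply/(integral_eq0_null (measurable_fun_xsection _ mA)).
  by move=> y; exact: measure_ge0.
have := indic_fubini_tonelli (borel_lebesgue R n) (borel_lebesgue R d) mA.
rewrite indic_fubini_tonelli_FE// indic_fubini_tonelli_GE// => ->.
by rewrite integral0_eq// => a _; exact: A0.
Qed.

Lemma outer_null_shift n (A : set 'rV[R]_n) a : (0 < n)%N ->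
  outer_lebesgue R n A = 0%E -> outer_lebesgue R n [set z | A (z + a)] = 0%E.
Proof.
move=> n0 /borel_null_hull[B [mB AB B0]].
apply: (@outer_null_subset _ _ _ [set z | B (z + a)]); first by move=> z; exact: AB.
have mBa : measurable [set z | B (z + a)].
  by have := @measurable_shift R n a measurableT _ mB; rewrite setTI.
by rewrite outer_lebesgueE// -[RHS]B0; exact: borel_lebesgue_shift.
Qed.

Lemma ball_row_mx k d (y0 : 'rV[R]_(k + d)) r a z : 0 < r ->
  ball y0 r (row_mx a z) <-> ball (lsubmx y0) r a /\ ball (rsubmx y0) r z.
Proof.
move=> r0; rewrite -!ball_normE/=; split=> [yr|[ar zr]].
  have la := lsubmx_norm (y0 - row_mx a z); have ra := rsubmx_norm (y0 - row_mx a z).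
  rewrite linearB/= row_mxKl in la; rewrite linearB/= row_mxKr in ra.
  by split; [exact: le_lt_trans la yr|exact: le_lt_trans ra yr].
rewrite -[y0]hsubmxK opp_row_mx add_row_mx.
apply: (@le_lt_trans _ _ (Num.max `|lsubmx y0 - a| `|rsubmx y0 - z|)).
  by apply: row_mx_norm_le; rewrite le_max lexx ?orbT.
by rewrite gt_max ar.
Qed.

End null_sections.

Section fibre_constant.
Context {R : realType} {k d : nat}.
Hypotheses (k0 : (0 < k)%N) (d0 : (0 < d)%N).
Local Notation n := (k + d)%N.
Local Notation oL m := (outer_lebesgue R m).

(** On almost every slice of the ball, which is a product as the norm is the sup
    norm, [w] is almost everywhere equal to a constant. *)
Definition fibre_constant (w : 'rV[R]_n -> R) (y0 : 'rV[R]_n) (r : R) :=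
  oL k [set a | ball (lsubmx y0) r a /\ ~ exists v : R,
    oL d [set z | ball (rsubmx y0) r z /\ w (row_mx a z) != v] = 0%E] = 0%E.

Lemma fibre_constant_ae (w w' : 'rV[R]_n -> R) y0 r : 0 < r ->
  oL n [set y | ball y0 r y /\ w y != w' y] = 0%E ->
  fibre_constant w y0 r -> fibre_constant w' y0 r.
Proof.
move=> r0 /null_slices ww' wc; apply: outer_null_subset (outer_nullU wc ww').
move=> a /= [ya nv]; have [wa|wa] := eqVneq (oL d (slice [set y | ball y0 r y /\ w y != w' y] a)) 0%E; last by right.
left; split=> // -[v wv]; apply: nv; exists v.
apply: outer_null_subset (outer_nullU wv wa) => z [zr zv].
have [E|ne] := eqVneq (w (row_mx a z)) (w' (row_mx a z)); first by left; split=> //; rewrite E.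
by right; split=> //; apply/ball_row_mx.
Qed.

Let n0 : (0 < n)%N. Proof. by rewrite addn_gt0 k0. Qed.

(** By Tonelli's theorem almost every [y] is such that [w (y + vert b) = w y] for
    almost every small [b]. Almost every slice contains such a point, and the
    value there is the constant: it reaches the rest of the slice by vertical
    vectors of norm less than [r]. *)
Lemma shift_invariant_fibre_constant (w : 'rV[R]_n -> R) y0 r : 0 < r ->
  measurable_fun setT w ->
  (forall a : 'rV[R]_d, `|a| <= r ->
     oL n [set y | ball y0 r y /\ w (y + vert a) != w y] = 0%E) ->
  fibre_constant w y0 (r / 2).
Proof.
move=> r0 mw winv.
pose A : set ('rV[R]_n * 'rV[R]_d) := [set p | ball y0 r p.1 /\
  (ball 0 r p.2 /\ w (p.1 + vert p.2) != w p.1)].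
have mfst : measurable_fun setT (fst : 'rV[R]_n * 'rV[R]_d -> _) := measurable_fst.
have msnd : measurable_fun setT (snd : 'rV[R]_n * 'rV[R]_d -> _) := measurable_snd.
have mshift : measurable_fun setT (fun p : 'rV[R]_n * 'rV[R]_d => p.1 + vert p.2).
  apply: measurable_fun_rV => i; under eq_fun do rewrite mxE.
  apply: measurable_funD; first exact: (measurableT_comp (measurable_rV_coord i) mfst).
  case: (splitP i) => j ij.
    have -> : i = lshift d j by exact: val_inj.
    by under eq_fun do rewrite row_mxEl mxE; exact: measurable_cst.
  have -> : i = rshift k j by exact: val_inj.
  under eq_fun do rewrite row_mxEr; exact: (measurableT_comp (measurable_rV_coord j) msnd).
have mA : measurable A.
  apply: measurableI; first by rewrite -[X in measurable X]setTI; apply: mfst => //; exact: measurable_rV_ball.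
  apply: measurableI; first by rewrite -[X in measurable X]setTI; apply: msnd => //; exact: measurable_rV_ball.
  have md : measurable_fun setT (fun p : 'rV[R]_n * 'rV[R]_d => w (p.1 + vert p.2) - w p.1).
    by apply: measurable_funB; [exact: (measurableT_comp mw mshift)|exact: (measurableT_comp mw mfst)].
  have := md measurableT _ (measurableC (measurable_set1 (0 : R))).
  rewrite setTI; congr measurable; apply/seteqP; split=> p /=.
    by move=> ne; rewrite -subr_eq0; apply/eqP.
  by move=> ne; apply/eqP; rewrite subr_eq0.
have As a : borel_lebesgue R n (ysection A a) = 0%E.
  rewrite -outer_lebesgueE; last exact: measurable_ysection.
  have [ar|ar] := leP `|a| r.
    by apply: outer_null_subset (winv _ ar) => y; rewrite /ysection/= in_setE => -[yr [_ ?]].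
  rewrite (_ : ysection A a = set0) ?outer_measure0//.
  apply/seteqP; split=> // y; rewrite /ysection/= in_setE => -[_ [+ _]].
  by rewrite -ball_normE/= sub0r normrN ltNge (ltW ar).
have := null_slices (null_sections mA As); apply: outer_null_subset => a [ya nv].
apply/negP => /eqP sl0; apply: nv.
have r20 : 0 < r / 2 by rewrite divr_gt0.
have [z1 [z1r z1N]] : exists z, ball (rsubmx y0) (r / 2) z /\
    borel_lebesgue R d (xsection A (row_mx a z)) = 0%E.
  apply: contrapT => /forallNP nz.
  have : (0 < borel_lebesgue R d (ball (rsubmx y0) (r / 2)))%E by exact: lebesgue_ball_gt0.
  rewrite -outer_lebesgueE; last exact: measurable_rV_ball.
  rewrite (_ : oL d _ = 0%E) ?ltxx//; apply: outer_null_subset sl0 => z zr /=.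
  by apply/eqP => z0; exact: (nz z).
exists (w (row_mx a z1)).
have zA : oL d [set z | xsection A (row_mx a z1) (z - z1)] = 0%E.
  apply: (outer_null_shift (- z1)) => //; rewrite outer_lebesgueE//; exact: measurable_xsection.
apply: outer_null_subset zA => z [zr wz]; rewrite /xsection/= in_setE; split=> /=.
  apply/ball_row_mx => //; split; [move: ya|move: z1r]; apply: le_ball;
  by rewrite ler_pdivrMr// ler_pMr// ler1n.
split.
  move: zr z1r; rewrite -!ball_normE/= => zr z1r; rewrite sub0r normrN -normrN opprB.
  rewrite -(subrKA (rsubmx y0)) (le_lt_trans (ler_normD _ _))// [ltRHS]splitr.
  by apply: ltrD => //; rewrite distrC.
by rewrite /vert add_row_mx addr0 addrC subrK.
Qed.

Lemma fibre_constant_shift_invariant (w : 'rV[R]_n -> R) y0 r (a : 'rV[R]_d) : 0 < r ->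
  measurable_fun setT w -> `|a| <= r / 2 -> fibre_constant w y0 r ->
  oL n [set y | ball y0 (r / 2) y /\ w (y + vert a) != w y] = 0%E.
Proof.
move=> r0 mw ar wc.
have r2r : r / 2 <= r by rewrite ler_pdivrMr// ler_pMr// ler1n.
have r20 : 0 < r / 2 by rewrite divr_gt0.
apply: slices_null.
  apply: measurableI; first exact: measurable_rV_ball.
  have md : measurable_fun setT (fun y : 'rV[R]_n => w (y + vert a) - w y).
    by apply: measurable_funB => //; exact: (measurable_fun_shift _ mw).
  have := md measurableT _ (measurableC (measurable_set1 (0 : R))).
  rewrite setTI; congr measurable; apply/seteqP; split=> p /=.
    by move=> ne; rewrite -subr_eq0; apply/eqP.
  by move=> ne; apply/eqP; rewrite subr_eq0.
apply: outer_null_subset wc => b /= sb.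
have yb : ball (lsubmx y0) (r / 2) b.
  apply: contrapT => yb; move/negP : sb; apply; apply/eqP.
  rewrite (_ : slice _ _ = set0) ?outer_measure0//.
  by apply/seteqP; split=> // z [/ball_row_mx-/(_ r20)[]].
split; first exact: le_ball yb.
move=> [v vz]; move/negP : sb; apply; apply/eqP.
apply: outer_null_subset (outer_nullU vz (outer_null_shift a d0 vz)) => z [].
move=> /(ball_row_mx _ _ _ r20)[_ zr].
have zr' : ball (rsubmx y0) r z by exact: le_ball zr.
rewrite /vert add_row_mx addr0 => ne.
have [E|] := eqVneq (w (row_mx b z)) v; last by left.
right; split; last by rewrite -E.
move: zr; rewrite -!ball_normE/= opprD addrA => zr.
rewrite (le_lt_trans (ler_normB _ _))// [ltRHS]splitr.
exact: ltr_leD.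
Qed.

End fibre_constant.

(** * The equivalence in a fibred chart *)

Lemma outer_null_exists {R : realType} n m (A : 'I_m -> set 'rV[R]_n) :
  (forall i, outer_lebesgue R n (A i) = 0%E) ->
  outer_lebesgue R n [set x | exists i, A i x] = 0%E.
Proof.
move=> A0; pose F (j : nat) : set 'rV[R]_n := if insub j is Some i then A i else set0.
apply: (@outer_null_subset _ _ _ (\bigcup_j F j)).
  by move=> x [i Ax]; exists (i : nat) => //; rewrite /F valK.
by apply: outer_null_bigcup => j; rewrite /F; case: insubP => *; rewrite ?A0 ?outer_measure0.
Qed.

Section chart_equivalence.
Context {R : realType} {k d : nat}.
Hypotheses (k0 : (0 < k)%N) (d0 : (0 < d)%N).
Local Notation n := (k + d)%N.
Local Notation oL m := (outer_lebesgue R m).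
Let n0 : (0 < n)%N. Proof. by rewrite addn_gt0 k0. Qed.

Variables (M : set 'rV[R]_n) (phi : 'rV[R]_n -> 'rV[R]_n) (Omega : set 'rV[R]_n).
Variables (u : 'rV[R]_n -> R) (grad_u : 'rV[R]_n -> 'rV[R]_n) (x0 : 'rV[R]_n) (r0 : R).
Variables (f : 'rV[R]_n -> R) (g : 'I_n -> 'rV[R]_n -> R).
Local Notation K := (cube x0 r0).
Hypotheses (KO : K `<=` Omega).
Hypotheses (mf : measurable_fun setT f) (Nf : (norm1 (borel_lebesgue R n) f < +oo)%E).
Hypotheses (mg : forall j, measurable_fun setT (g j))
  (Ng : forall j, (norm1 (borel_lebesgue R n) (g j) < +oo)%E).
Hypothesis wg : weak_grad_on K f g.
Hypothesis fu : oL n [set x | K x /\ f x != u x] = 0%E.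
Hypothesis gu : forall j, oL n [set x | K x /\ g j x != grad_u x ord0 j] = 0%E.
Variables (y0 : 'rV[R]_n) (rho C R0 : R) (G : 'rV[R]_n -> 'rV[R]_n).
Variables (q : 'rV[R]_k -> 'rV[R]_n) (nm : 'rV[R]_k -> 'M[R]_(d, n)).
Hypothesis ch : fibred_chart M phi K y0 rho C R0 G q nm.

Local Notation B := (ball y0 rho).
Let rho0 := chart_rho0 ch.
Let C0 := chart_C0 ch.
Let R00 := chart_R00 ch.
Let B2 : set 'rV[R]_n := ball y0 (rho / 2).
Let w := pullback B2 G f.

Let r2B y : B2 y -> B y.
Proof. by apply: le_ball; move: rho0; lra. Qed.

Let r4B2 y : ball y0 (rho / 4) y -> B2 y.
Proof. by apply: le_ball; move: rho0; lra. Qed.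

Let GK y : B y -> K (G y).
Proof.
by move=> yB; apply: (chart_cube ch yB); rewrite /cube/= subrr normr0 ltW// (chart_R00 ch).
Qed.

Let mw : measurable_fun setT w.
Proof.
apply: measurable_pullback mf; first exact: measurable_rV_ball.
apply: continuous_measurable_rV; first exact: ball_open.
by move=> y /r2B yB; exact: (G_continuous C0 (chart_lip ch)).
Qed.

Let wE y : B2 y -> w y = f (G y).
Proof. by move=> yB; rewrite /w (pullback_in _ _ yB). Qed.

Let fuG : oL n [set y | B2 y /\ w y != u (G y)] = 0%E.
Proof.
apply: outer_null_subset (outer_null_preimage n0 C0 (chart_expand ch) fu).
by move=> y [yB]; rewrite wE// => ne; split; [exact: r2B|split=> //; exact/GK/r2B].
Qed.

Let bad : set 'rV[R]_n := [set y | exists j, B y /\ g j (G y) != grad_u (G y) ord0 j].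

Let bad0 : oL n bad = 0%E.
Proof.
apply: outer_null_exists => j.
apply: outer_null_subset (outer_null_preimage n0 C0 (chart_expand ch) (gu j)).
by move=> y [yB ne]; split=> //; split=> //; exact: GK.
Qed.

Let fibre_derivE a y : B y -> ~ bad y ->
  fibre_deriv g G nm a y = (a *m (grad_u (G y) *m (nm (lsubmx y))^T)^T) ord0 ord0.
Proof.
move=> yB nb; rewrite trmx_mul trmxK mulmxA mxE; apply: eq_bigr => j _.
by congr (_ * _); rewrite mxE; apply: contrapT => ne; apply: nb; exists j; split=> //; apply/eqP.
Qed.

Let shift_in (a : 'rV[R]_d) y : `|a| <= rho / 4 -> ball y0 (rho / 4) y -> B2 (y + vert a).
Proof.
move=> ar yB; have := ball_shift yB (le_trans (norm_vert a) ar).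
by apply: le_ball; lra.
Qed.

(** The derivatives along the fibres are the products of the gradient with normal
    vectors. *)
Lemma normal_proj0_fibre_constant :
  oL n [set x | Omega x /\ normal_proj M phi x (grad_u x) != 0] = 0%E ->
  fibre_constant (u \o G) y0 (rho / 8).
Proof.
move=> np0.
have fd0 (a : 'rV[R]_d) : oL n [set y | B2 y /\ fibre_deriv g G nm a y != 0] = 0%E.
  apply: outer_null_subset
    (outer_nullU bad0 (outer_null_preimage n0 C0 (chart_expand ch) np0)).
  move=> y [/r2B yB ne]; have [|nb] := pselect (bad y); first by left.
  right; split=> //; split; first exact/KO/GK.
  apply: contra_notN (elimN eqP ne) => /eqP/(chart_proj ch _ yB) E.
  by rewrite fibre_derivE// E trmx0 mulmx0 mxE.
have r40 : 0 < rho / 4 by rewrite divr_gt0.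
have : fibre_constant w y0 (rho / 4 / 2).
  apply: shift_invariant_fibre_constant => // a ar.
  apply: outer_null_subset (fibre_shift_invariant k0 mf Nf mg Ng wg rho0 C0 R00
    (chart_E ch) (chart_lip ch) (chart_expand ch) (chart_cube ch) ar (fd0 a)).
  by move=> y [yB ne]; split=> //; rewrite -!wE//; [exact: r4B2|exact: shift_in].
have -> : rho / 4 / 2 = rho / 8 by lra.
apply: fibre_constant_ae; first by rewrite divr_gt0.
apply: outer_null_subset fuG => y [yB ne]; split=> //.
by move: yB; apply: le_ball; move: rho0; lra.
Qed.

(** The derivatives along multiples of the unit vectors vanish, so the gradient is
    orthogonal to a basis of the normal space. Lipschitz images of null sets being
    null, this holds almost everywhere on the image of the chart. *)
Lemma fibre_constant_normal_proj0 :
  fibre_constant (u \o G) y0 (rho / 2) ->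
  oL n [set x | (G @` ball y0 (rho / 8)) x /\ normal_proj M phi x (grad_u x) != 0] = 0%E.
Proof.
move=> uc; have r20 : 0 < rho / 2 by rewrite divr_gt0.
have wc : fibre_constant w y0 (rho / 2).
  apply: fibre_constant_ae uc => //; apply: outer_null_subset fuG => y [yB ne].
  by split=> //; rewrite eq_sym.
have r22 : rho / 2 / 2 = rho / 4 by lra.
have inv (a : 'rV[R]_d) : `|a| <= rho / 4 ->
    oL n [set y | ball y0 (rho / 4) y /\ f (G (y + vert a)) != f (G y)] = 0%E.
  move=> ar; have ar' : `|a| <= rho / 2 / 2 by rewrite r22.
  have := fibre_constant_shift_invariant d0 r20 mw ar' wc; rewrite r22.
  apply: outer_null_subset => y [yB ne]; split=> //; rewrite !wE//; first exact: r4B2.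
  exact: shift_in.
have r40 : 0 < rho / 4 by rewrite divr_gt0.
pose e (i : 'I_d) : 'rV[R]_d := (rho / 4) *: delta_mx ord0 i.
have e4 i : `|e i| <= rho / 4.
  rewrite normrZ gtr0_norm// ger_pMr//; apply: rV_norm_le => // j.
  by rewrite mxE; case: (_ && _); rewrite ?normr0 ?normr1.
have fd0 i : oL n [set y | ball y0 (rho / 4) y /\ fibre_deriv g G nm (e i) y != 0] = 0%E.
  apply: (fibre_deriv_eq0 k0 mf Nf mg Ng wg rho0 C0 R00
    (chart_E ch) (chart_lip ch) (chart_expand ch) (chart_cube ch) (e4 i)).
  move=> t /andP[t0 t1]; apply: inv; rewrite normrZ gtr0_norm//.
  by apply: le_trans (e4 i); rewrite ler_piMl.
pose A : set 'rV[R]_n := bad `|` [set y | exists i, ball y0 (rho / 4) y /\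
  fibre_deriv g G nm (e i) y != 0].
have A0 : oL n (B `&` A) = 0%E.
  apply: outer_null_subset (outer_nullU bad0 (outer_null_exists fd0)).
  by move=> y [].
have GA0 : oL n (G @` (B `&` A)) = 0%E.
  apply: (@outer_lebesgue_null_expanding _ _ _ _ id 1 n0) => //.
    by move=> x y _ _; rewrite mul1r.
  rewrite image_id; apply: (hausdorff_null_lipschitz n0 C0 _ A0).
  by move=> x y [xB _] [yB _]; exact: (chart_lip ch).
apply: outer_null_subset GA0 => x [[y y8 <-] ne].
have yB : B y by move: y8; apply: le_ball; move: rho0; lra.
exists y => //; split=> //; apply: contrapT => nA.
move/eqP : ne; apply; apply/(chart_proj ch _ yB).
have nb : ~ bad y by move=> yb; apply: nA; left.
apply/rowP => i; rewrite [RHS]mxE.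
have : fibre_deriv g G nm (e i) y = 0.
  apply: contrapT => /eqP ne; apply: nA; right; exists i; split=> //.
  by move: y8; apply: le_ball; move: rho0; lra.
rewrite fibre_derivE// /e -scalemxAl mxE -rowE 2!mxE => /eqP.
by rewrite mulf_eq0 gt_eqF//= => /eqP.
Qed.

End chart_equivalence.

(** * From charts to the whole domain *)

Section global.
Context {R : realType} {k d : nat}.
Hypotheses (k0 : (0 < k)%N) (d0 : (0 < d)%N).
Local Notation n := (k + d)%N.
Local Notation oL m := (outer_lebesgue R m).
Let n0 : (0 < n)%N. Proof. by rewrite addn_gt0 k0. Qed.

Variables (M : set 'rV[R]_n) (r : nat) (U : set 'rV[R]_n) (phi : 'rV[R]_n -> 'rV[R]_n).
Hypotheses (r2 : (2 <= r)%N) (Mr : submanifold r k M) (tub : tubular_neighborhood r.-1 M U phi).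
Variables (Omega : set 'rV[R]_n) (u : 'rV[R]_n -> R) (grad_u : 'rV[R]_n -> 'rV[R]_n).
Hypotheses (oO : open Omega) (OU : Omega `<=` U).
Hypotheses (u2 : square_integrable Omega u) (wu : weak_gradient Omega u grad_u).

Local Notation Np x := (normal_proj M phi x (grad_u x)).

Lemma fibred_chart_sub (D D' : set 'rV[R]_n) y0 rho C R0 G (q : 'rV[R]_k -> 'rV[R]_n) nm :
  D `<=` D' -> fibred_chart M phi D y0 rho C R0 G q nm ->
  fibred_chart M phi D' y0 rho C R0 G q nm.
Proof.
move=> DD' ch; case: (ch) => rho0 C0 R00 GE Gl Ge Gc bl be bM Gphi Gproj; split=> //.
by move=> y yB; exact: subset_trans (Gc y yB) DD'.
Qed.

(** The weak gradient is taken on a cube in [Omega], where [u] and its gradient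
    have integrable Borel versions. The radii differ since each passage between
    translations and slices shrinks the ball. *)
Lemma local_equivalence x0 : Omega x0 -> exists y0 rho C R0 G (q : 'rV[R]_k -> 'rV[R]_n) nm,
  [/\ fibred_chart M phi Omega y0 rho C R0 G q nm,
      nbhs x0 (G @` ball y0 (rho / 8)),
      oL n [set x | Omega x /\ Np x != 0] = 0%E -> fibre_constant (u \o G) y0 (rho / 8) &
      fibre_constant (u \o G) y0 (rho / 2) ->
        oL n [set x | (G @` ball y0 (rho / 8)) x /\ Np x != 0] = 0%E].
Proof.
move=> Ox0; have /nbhs_ballP[e /= e0 eO] : nbhs x0 Omega by exact: open_nbhs_nbhs.
pose r0 := e / 2; have r00 : 0 < r0 by rewrite divr_gt0.
have KO : cube x0 r0 `<=` Omega.
  move=> x xK; apply: eO; rewrite -ball_normE/= distrC; apply: le_lt_trans xK _.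
  by rewrite /r0; lra.
have bK : ball x0 r0 `<=` cube x0 r0.
  by move=> x; rewrite -ball_normE/= /cube/= distrC => /ltW.
have [f [g [[mf Nf] mg wg fu gu]]] := sobolev_borel_version n0 oO u2 wu KO.
have [y0 [rho [C [R0 [G [q [nm [ch nG]]]]]]]] := fibred_chart_exists r2 Mr tub
  (ball_open x0 r0) (ballxx x0 r00) (subset_trans bK (subset_trans KO OU)).
have chK := fibred_chart_sub bK ch.
have mg' j := (mg j).1; have Ng j := (mg j).2.
exists y0, rho, C, R0, G, q, nm; split=> //.
- exact: fibred_chart_sub KO chK.
- exact: (normal_proj0_fibre_constant k0 d0 KO mf Nf mg' Ng wg fu gu chK).
- exact: (fibre_constant_normal_proj0 k0 d0 mf Nf mg' Ng wg fu gu chK).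
Qed.

Section chart_fibres.
Variables (y0 : 'rV[R]_n) (rho C R0 : R) (G : 'rV[R]_n -> 'rV[R]_n).
Variables (q : 'rV[R]_k -> 'rV[R]_n) (nm : 'rV[R]_k -> 'M[R]_(d, n)).
Hypothesis ch : fibred_chart M phi Omega y0 rho C R0 G q nm.
Local Notation B := (ball y0 rho).
Let rho0 := chart_rho0 ch.
Let C0 := chart_C0 ch.

Lemma chart_Omega y : B y -> Omega (G y).
Proof.
by move=> yB; apply: (chart_cube ch yB); rewrite /cube/= subrr normr0 ltW// (chart_R00 ch).
Qed.

Let in_B a z : ball (lsubmx y0) rho a -> ball (rsubmx y0) rho z -> B (row_mx a z).
Proof. by move=> ar zr; apply/ball_row_mx. Qed.

Let fibre_lip a z z' : ball (lsubmx y0) rho a -> ball (rsubmx y0) rho z ->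
  ball (rsubmx y0) rho z' -> `|G (row_mx a z) - G (row_mx a z')| <= C * `|z - z'|.
Proof.
move=> ar zr zr'; apply: le_trans (chart_lip ch (in_B ar zr) (in_B ar zr')) _.
apply: ler_wpM2l; [exact: ltW|rewrite opp_row_mx add_row_mx subrr].
by apply: row_mx_norm_le; rewrite ?normr0.
Qed.

Let fibre_expand a z z' : ball (lsubmx y0) rho a -> ball (rsubmx y0) rho z ->
  ball (rsubmx y0) rho z' -> `|z - z'| <= C * `|G (row_mx a z) - G (row_mx a z')|.
Proof.
move=> ar zr zr'; apply: le_trans (chart_expand ch (in_B ar zr) (in_B ar zr')).
by have := rsubmx_norm (row_mx a z - row_mx a z'); rewrite linearB/= !row_mxKr.
Qed.

(** A relatively open piece of a fibre is an expanding image of an open set. *)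
Lemma chart_fibre_not_null y (V S : set 'rV[R]_n) : B y -> open V -> V (G y) ->
  hausdorff_measure d S = 0%E ->
  exists x, [/\ V x, Omega x, phi x = phi (G y) & ~ S x].
Proof.
move=> yB oV VGy S0.
have : nbhs y (B `&` G @^-1` V).
  apply: filterI; first by apply: open_nbhs_nbhs; split=> //; exact: ball_open.
  by apply: (G_continuous C0 (chart_lip ch) yB); exact: open_nbhs_nbhs.
move=> /nbhs_ballP[e /= e0 eBV].
pose F z := G (row_mx (lsubmx y) z).
have inB z : ball (rsubmx y) e z -> B (row_mx (lsubmx y) z) /\ V (F z).
  by move=> zr; apply: eBV; apply/ball_row_mx => //; split=> //; exact: ballxx.
apply: contrapT => /forallNP nex.
have : (0 < borel_lebesgue R d (ball (rsubmx y) e))%E by exact: lebesgue_ball_gt0.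
rewrite -outer_lebesgueE; last exact: measurable_rV_ball.
rewrite (@outer_lebesgue_null_expanding _ _ _ _ F C d0 C0) ?ltxx//.
  by move=> z z' /inB[/ball_row_mx-/(_ rho0)[ar zr] _] /inB[/ball_row_mx-/(_ rho0)[_ zr'] _];
    exact: fibre_expand.
apply: hausdorff_null_subset S0 => _ [z /inB[zB zV] <-].
apply: contrapT => nS; apply: (nex (F z)); split=> //; first exact: chart_Omega.
by rewrite /F (chart_phi ch zB) (chart_phi ch yB) row_mxKl.
Qed.

(** The segments of a fibre of the chart lie in one component of the normal
    section, where [u] is constant up to a null set. *)
Lemma section_constant_fibre_constant (Z : set 'rV[R]_n) :
  hausdorff_measure k Z = 0%E ->
  (forall p, M p -> ~ Z p -> exists2 S, hausdorff_measure d S = 0%E &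
    forall xbar, normal_section Omega phi p xbar -> exists v : R, forall x,
      connected_component (normal_section Omega phi p) xbar x -> ~ S x -> u x = v) ->
  fibre_constant (u \o G) y0 (rho / 2).
Proof.
move=> Z0 uZ; pose A := [set a | ball (lsubmx y0) rho a /\ Z (q a)].
have A0 : oL k A = 0%E.
  apply: (@outer_lebesgue_null_expanding _ _ _ A q C k0 C0).
    by move=> a b [ar _] [br _]; exact: (chart_base_expand ch).
  by apply: hausdorff_null_subset Z0 => _ [a [_ Za] <-].
have r2r : rho / 2 <= rho by move: rho0; lra.
apply: outer_null_subset A0 => a [ar nv].
have ar' : ball (lsubmx y0) rho a by exact: le_ball ar.
split=> //; apply: contrapT => nZ; apply: nv.
have [S S0 uS] := uZ _ (chart_base ch ar') nZ.
pose F z := G (row_mx a z).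
have Fsec z : ball (rsubmx y0) rho z -> normal_section Omega phi (q a) (F z).
  move=> zr; have yB := in_B ar' zr; split; first exact: chart_Omega.
  by rewrite /F (chart_phi ch yB) row_mxKl.
have z0r : ball (rsubmx y0) rho (rsubmx y0) by exact: ballxx.
have [v uv] := uS _ (Fsec _ z0r); exists v.
have : oL d [set z | ball (rsubmx y0) rho z /\ S (F z)] = 0%E.
  apply: (@outer_lebesgue_null_expanding _ _ _ _ F C d0 C0).
    by move=> z z' [zr _] [zr' _]; exact: fibre_expand.
  by apply: hausdorff_null_subset S0 => _ [z [_ Sz] <-].
apply: outer_null_subset => z [zr uz].
have zr' : ball (rsubmx y0) rho z by exact: le_ball zr.
split=> //; apply: contrapT => nS; move/eqP : uz; apply; apply: uv => //.
pose s (t : R) := rsubmx y0 + t *: (z - rsubmx y0).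
have sB t : 0 <= t <= 1 -> ball (rsubmx y0) rho (s t).
  move=> /andP[t0 t1]; move: zr'; rewrite -!ball_normE/= /s opprD addrA subrr sub0r normrN.
  rewrite distrC normrZ ger0_norm//; apply: le_lt_trans; exact: ler_piMl.
apply: (@connected_component_max _ _ ((fun t => F (s t)) @` `[0, 1]%classic)).
- by exists 0; [rewrite /= in_itv/= lexx ler01|rewrite /s scale0r addr0].
- by move=> _ [t + <-]; rewrite /= in_itv/= => /sB; exact: Fsec.
- apply: connected_continuous_connected; first exact: segment_connected.
  apply: continuous_in_subspaceT => t; rewrite inE/= in_itv/= => t01.
  apply: (@continuous_comp _ _ _ (fun t : R => row_mx a (s t)) G); last first.
    by apply: (G_continuous C0 (chart_lip ch)); apply: in_B => //; exact: sB.
  apply: lip_near_continuous; exists `|z - rsubmx y0|, 1; split=> // t1 t2 _ _.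
  rewrite opp_row_mx add_row_mx subrr; apply: row_mx_norm_le.
    by rewrite normr0 mulr_ge0.
  by rewrite /s opprD addrACA subrr add0r -scalerBl normrZ mulrC.
- by exists 1; [rewrite /= in_itv/= lexx ler01|rewrite /s scale1r addrC subrK].
Qed.

(** The local form of (2), in which the chart provides one constant for each
    fibre; connected components only matter for the passage to [Omega]. *)
Definition fibre_const_on (O : set 'rV[R]_n) := exists Z : set 'rV[R]_n,
  [/\ Z `<=` M, hausdorff_measure k Z = 0%E & forall p, M p -> ~ Z p ->
    exists S : set 'rV[R]_n, hausdorff_measure d S = 0%E /\
      exists v : R, forall x, O x -> phi x = p -> ~ S x -> u x = v].

(** The parametrization of the base is injective, so that a point of [M] has at
    most one slice in the chart. *)
Lemma fibre_constant_const_on : fibre_constant (u \o G) y0 (rho / 8) ->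
  fibre_const_on (G @` ball y0 (rho / 8)).
Proof.
rewrite /fibre_constant; set A := [set a | _] => A0.
have r80 : 0 < rho / 8 by rewrite divr_gt0.
have r8 : rho / 8 <= rho by move: rho0; lra.
have hd0 : hausdorff_measure d (set0 : set 'rV[R]_n) = 0%E.
  rewrite -(image_set0 (fun _ : 'rV[R]_d => 0)).
  by apply: (hausdorff_null_lipschitz d0 ltr01) => //; exact: outer_measure0.
have lr a : ball (lsubmx y0) (rho / 8) a -> ball (lsubmx y0) rho a by exact: le_ball.
have rr z : ball (rsubmx y0) (rho / 8) z -> ball (rsubmx y0) rho z by exact: le_ball.
have phiG y : ball y0 (rho / 8) y -> phi (G y) = q (lsubmx y).
  by move=> yB; apply: (chart_phi ch); exact: le_ball yB.
exists (q @` A); split.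
- by move=> _ [a [/lr ar _] <-]; exact: (chart_base ch).
- apply: (hausdorff_null_lipschitz k0 C0 _ A0).
  by move=> a b [/lr ar _] [/lr br _]; exact: (chart_base_lip ch).
move=> p Mp nZ.
have [[a [ar qa]]|/forallNP na] := pselect (exists a, ball (lsubmx y0) (rho / 8) a /\ q a = p);
  last first.
  exists set0; split=> //; exists 0 => x [y yB <-]; rewrite phiG// => qp.
  by move: yB; rewrite -[y in ball _ _ y]hsubmxK => /(ball_row_mx _ _ _ r80)[yl _];
    case: (na (lsubmx y)).
have [v v0] : exists v : R,
    oL d [set z | ball (rsubmx y0) (rho / 8) z /\ (u \o G) (row_mx a z) != v] = 0%E.
  by apply: contrapT => nv; apply: nZ; exists a.
exists ((fun z => G (row_mx a z)) @`
  [set z | ball (rsubmx y0) (rho / 8) z /\ (u \o G) (row_mx a z) != v]); split.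
  apply: (hausdorff_null_lipschitz d0 C0 _ v0).
  by move=> z z' [/rr zr _] [/rr zr' _]; apply: fibre_lip => //; exact: lr.
exists v => _ [y yB <-]; rewrite phiG// -qa => qya nS.
move: (yB); rewrite -[y in ball _ _ y]hsubmxK => /(ball_row_mx _ _ _ r80)[yl yr].
have ya : lsubmx y = a.
  have := chart_base_expand ch (lr _ yl) (lr _ ar); rewrite qya subrr normr0 mulr0 normr_le0.
  by rewrite subr_eq0 => /eqP.
apply: contrapT => /eqP uv; apply: nS; exists (rsubmx y); last by rewrite -ya hsubmxK.
by split=> //=; rewrite -ya hsubmxK.
Qed.

End chart_fibres.

Lemma section_not_null x (V S : set 'rV[R]_n) : Omega x -> open V -> V x ->
  hausdorff_measure d S = 0%E ->
  exists y, [/\ V y, Omega y, phi y = phi x & ~ S y].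
Proof.
move=> Ox oV Vx S0; have [y0 [rho [C [R0 [G [q [nm [ch nG _ _]]]]]]]] := local_equivalence Ox.
have [y yB Gy] := nbhs_singleton nG; rewrite -Gy in Vx *.
apply: (chart_fibre_not_null ch) => //; move: yB; apply: le_ball.
by have := chart_rho0 ch; lra.
Qed.

(** Locally constant functions are constant on connected sets; two local values
    on overlapping pieces agree because the overlap is not negligible. *)
Lemma section_constant (F : (set 'rV[R]_n)^nat) p (S : (set 'rV[R]_n)^nat) (v : nat -> R) :
  (forall i, open (F i)) -> Omega `<=` \bigcup_i F i ->
  hausdorff_measure d (\bigcup_i S i) = 0%E ->
  (forall i x, F i x -> phi x = p -> ~ S i x -> u x = v i) ->
  forall xbar, normal_section Omega phi p xbar -> exists c : R, forall x,
    connected_component (normal_section Omega phi p) xbar x ->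
    ~ (\bigcup_i S i) x -> u x = c.
Proof.
move=> oF OF S0 uF xbar [Ox px].
have same x i j : normal_section Omega phi p x -> F i x -> F j x -> v i = v j.
  move=> [Ox' px'] Fi Fj.
  have [y [[Fiy Fjy] Oy py nS]] := section_not_null Ox' (openI (oF i) (oF j)) (conj Fi Fj) S0.
  rewrite px' in py; have nSi l : ~ S l y by move=> Sl; apply: nS; exists l.
  by rewrite -(uF i y)// (uF j y).
have [i0 _ Fx0] := OF _ Ox.
set N := normal_section Omega phi p; set cc := connected_component N xbar.
have ccN : cc `<=` N by exact: connected_component_sub.
have : cc `&` \bigcup_(i in [set i | v i = v i0]) F i = cc.
  apply: (@component_connected _ N xbar).
  - exists xbar; split; first exact: connected_component_refl.
    by exists i0.
  - by exists (\bigcup_(i in [set i | v i = v i0]) F i) => //; apply: bigcup_open => i _.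
  - exists (~` \bigcup_(i in [set i | v i != v i0]) F i).
      by apply: open_closedC; apply: bigcup_open => i _.
    apply/seteqP; split=> x [ccx]; move: (ccN _ ccx) => Nx.
      move=> [i /= vi Fi]; split=> // -[j /= vj Fj]; move/eqP : vj; apply.
      by rewrite -vi; exact: same Nx Fj Fi.
    move=> nF; split=> //; have [i _ Fi] := OF _ Nx.1; exists i => //=.
    by apply: contrapT => /eqP vi; apply: nF; exists i.
move=> ccE; exists (v i0) => x; rewrite -/N -/cc -ccE => -[ccx [i /= <- Fi]] nS.
by apply: uF => //; [exact: (ccN _ ccx).2|move=> Si; apply: nS; exists i].
Qed.

(** The exceptional sets of countably many charts are collected into [Z] and, for
    each point of [M], into [S]. *)
Lemma normal_proj0_section_constant :
  oL n [set x | Omega x /\ Np x != 0] = 0%E -> Omega !=set0 ->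
  exists Z : set 'rV[R]_n,
    [/\ Z `<=` M, hausdorff_measure k Z = 0%E & forall p, M p -> ~ Z p ->
      exists S : set 'rV[R]_n, [/\ S `<=` [set x | U x /\ phi x = p],
        hausdorff_measure d S = 0%E & forall xbar, normal_section Omega phi p xbar ->
          exists v : R, forall x,
            connected_component (normal_section Omega phi p) xbar x -> ~ S x -> u x = v]].
Proof.
move=> np0 [x1 Ox1].
have mono (O O' : set 'rV[R]_n) : O `<=` O' -> fibre_const_on O' -> fibre_const_on O.
  move=> OO' [Z [ZM Z0 uZ]]; exists Z; split=> // p Mp nZ.
  by have [S [S0 [v uv]]] := uZ p Mp nZ; exists S; split=> //; exists v => x /OO'; exact: uv.
have loc x : Omega x -> exists V, [/\ open V, V x & fibre_const_on V].
  move=> Ox; have [y0 [rho [C [R0 [G [q [nm [ch nG fwd _]]]]]]]] := local_equivalence Ox.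
  exists (G @` ball y0 (rho / 8))^°; split; [exact: open_interior|exact: nG|].
  by apply: mono (fibre_constant_const_on ch (fwd np0)); exact: interior_subset.
have [F [oF FP OF]] := rV_lindelof mono loc.
have c0 : fibre_const_on set0.
  by have [V [_ _ cV]] := loc _ Ox1; apply: mono cV; exact: sub0set.
have /choice[Z ZP] i : fibre_const_on (F i) by case: (FP i) => // ->.
exists (\bigcup_i Z i); split.
- by move=> p [i _]; have [ZM _ _] := ZP i; exact: ZM.
- by apply: hausdorff_null_bigcup k0 _ => i; have [] := ZP i.
move=> p Mp nZ.
have /choice[S SP] i : exists S : set 'rV[R]_n, hausdorff_measure d S = 0%E /\
    exists v : R, forall x, F i x -> phi x = p -> ~ S x -> u x = v.
  by have [_ _] := ZP i; apply=> // Zi; apply: nZ; exists i.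
have /choice[v vP] i := (SP i).2.
have S0 : hausdorff_measure d (\bigcup_i S i) = 0%E.
  by apply: hausdorff_null_bigcup d0 _ => i; exact: (SP i).1.
exists (\bigcup_i S i `&` normal_section Omega phi p); split.
- by move=> x [_ [/OU Ux px]].
- by apply: hausdorff_null_subset S0 => x [].
move=> xbar Nx; have [c uc] := section_constant oF OF S0 vP Nx.
exists c => x ccx nS; apply: (uc _ ccx) => Sx; apply: nS; split=> //.
exact: connected_component_sub ccx.
Qed.

Lemma section_constant_normal_proj0 (Z : set 'rV[R]_n) :
  hausdorff_measure k Z = 0%E ->
  (forall p, M p -> ~ Z p -> exists2 S, hausdorff_measure d S = 0%E &
    forall xbar, normal_section Omega phi p xbar -> exists v : R, forall x,
      connected_component (normal_section Omega phi p) xbar x -> ~ S x -> u x = v) ->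
  oL n [set x | Omega x /\ Np x != 0] = 0%E.
Proof.
move=> Z0 uZ; pose P (O : set 'rV[R]_n) := oL n [set x | O x /\ Np x != 0] = 0%E.
have mono (O O' : set 'rV[R]_n) : O `<=` O' -> P O' -> P O.
  by move=> OO'; apply: outer_null_subset => x [/OO' Ox ne].
have loc x : Omega x -> exists V, [/\ open V, V x & P V].
  move=> Ox; have [y0 [rho [C [R0 [G [q [nm [ch nG _ bwd]]]]]]]] := local_equivalence Ox.
  exists (G @` ball y0 (rho / 8))^°; split; [exact: open_interior|exact: nG|].
  apply: mono (bwd (section_constant_fibre_constant ch Z0 uZ)); exact: interior_subset.
have [F [oF FP OF]] := rV_lindelof mono loc.
apply: (@outer_null_subset _ _ _ (\bigcup_i [set x | F i x /\ Np x != 0])).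
  by move=> x [/OF[i _ Fi] ne]; exists i.
apply: outer_null_bigcup => i; case: (FP i) => // ->.
by rewrite (_ : [set x | _] = set0) ?outer_measure0//; apply/seteqP; split=> // x [].
Qed.

End global.

Theorem corollary3p2 (R : realType) (l k r : nat)
  (l_ge2 : (2 <= l)%N) (r_ge2 : (2 <= r)%N) (k_gt0 : (0 < k)%N)
  (k_lt_l : (k < l)%N)
  (M : set 'rV[R]_l) (M_submanifold : submanifold r k M)
  (U : set 'rV[R]_l) (phi : 'rV[R]_l -> 'rV[R]_l)
  (U_tubular : tubular_neighborhood r.-1 M U phi)
  (Omega : set 'rV[R]_l) (Omega_neq0 : Omega !=set0)
  (Omega_bounded : bounded_set Omega) (Omega_open : open Omega)
  (Omega_connected : connected Omega) (Omega_U : closure Omega `<=` U)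
  (u : 'rV[R]_l -> R) (u_H1 : sobolev_H1 Omega u)
  (grad_u : 'rV[R]_l -> 'rV[R]_l) (grad_uE : weak_gradient Omega u grad_u) :
  {ae @lebesgue R l, forall x, Omega x -> normal_proj M phi x (grad_u x) = 0}
  <->
  exists Z : set 'rV[R]_l,
    [/\ Z `<=` M, hausdorff_measure k Z = 0%E &
      forall p, M p -> ~ Z p ->
        exists S : set 'rV[R]_l,
          [/\ S `<=` [set x | U x /\ phi x = p],
              hausdorff_measure (l - k) S = 0%E &
              forall xbar, normal_section Omega phi p xbar ->
                exists v : R, forall x,
                  connected_component (normal_section Omega phi p) xbar x ->
                  ~ S x -> u x = v]].
Proof.
have [u2 _] := u_H1; have OU : Omega `<=` U by exact: subset_trans (@subset_closure _ _) Omega_U.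
have d0 : (0 < l - k)%N by rewrite subn_gt0.
have lE : l = (k + (l - k))%N by rewrite subnKC// ltnW.
clear l_ge2 Omega_bounded Omega_connected Omega_U u_H1 k_lt_l.
move: (l - k)%N d0 lE => d d0 lE; subst l.
rewrite lebesgue_aeP.
have -> : [set x | ~ (Omega x -> normal_proj M phi x (grad_u x) = 0)] =
          [set x | Omega x /\ normal_proj M phi x (grad_u x) != 0].
  by apply/seteqP; split=> x /=; [move=> /not_implyP[Ox /eqP]|move=> [Ox /eqP ne] /(_ Ox)].
split=> [np0|[Z [_ Z0 uZ]]].
  exact: (normal_proj0_section_constant k_gt0 d0 r_ge2 M_submanifold U_tubular).
apply: (section_constant_normal_proj0 k_gt0 d0 r_ge2 M_submanifold U_tubular _ OU u2 grad_uE Z0) => //.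
by move=> p Mp nZ; have [S [_ S0 uS]] := uZ p Mp nZ; exists S.
Qed.
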